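(* Let $f\colon\mathbb N\to\mathbb S^1$ be an MRT function with associated sequences $(t_m),(s_m)$. For $c>0$ such that $s_{m+1}^{1/c}\le t_{m+1}$ for all sufficiently large $m$ (automatic when $c\ge1/2$), let $(X,\mu_c,T)$ be the Furstenberg system for logarithmic averages of $f$, taken along the sequence of intervals $[s_{m+1}^{1/c}]$. Then $(X,\mu_c,T)$ has trivial spectrum, is strongly stationary, and is isomorphic to the system $(Z_c,\nu_c',R_c)$.
   Context: $\mathbb N=\{1,2,\ldots\}$, $\mathbb S^1$ is the complex unit circle, $\mathbb U$ is the closed complex unit disc, $\mathbb T=\mathbb R/\mathbb Z$. For real $M\ge1$, $[M]=\{1,\ldots,\lfloor M\rfloor\}$, and $\mathbb E^{\log}_{n\in[M]}a(n)=\big(\sum_{n\in[M]}\frac1n\big)^{-1}\sum_{n\in[M]}\frac{a(n)}n$. MRT function: a completely multiplicative $f\colon\mathbb N\to\mathbb S^1$ for which there exist strictly increasing sequences of integers $(t_m)$, with $t_1:=1$, and $(s_m)$ such that for each $m\in\mathbb N$: (i) $t_m<s_{m+1}<s_{m+1}^2\le t_{m+1}$; (ii) $f(p)=p^{is_{m+1}}$ for each prime $p\in(t_m,t_{m+1}]$; (iii) $|f(p)-p^{is_{m+1}}|\le1/t_m^2$ for each prime $1<p\le t_m$. Let $X=\mathbb U^{\mathbb Z}$ with the product topology and let $T\colon X\to X$ be the shift $(Tx)(k)=x(k+1)$. Extend $f$ to $\mathbb Z$ arbitrarily (the extension does not matter) and view it as a point of $X$. The Furstenberg system of $f$ for logarithmic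 averages along $([N_m])$ is $(X,\mu,T)$, where $\mu=\lim_{m\to\infty}\mathbb E^{\log}_{n\in[N_m]}\delta_{T^nf}$ (weak-star limit); part of the claim is that this limit exists for the stated intervals. For $d\in\{0,1,2,\ldots\}$ let $Y_d=\mathbb T^{d+1}$, $\nu_d=m_{\mathbb T^{d+1}}$ (Haar probability measure), and $S_d(x_0,\ldots,x_d)=(x_0,x_1+x_0,\ldots,x_d+x_{d-1})$. For $c>0$, the system $(Z_c,\nu_c',R_c)$ is defined as follows: $Z_c$ is the disjoint union of copies of $Y_d$, $d\ge\lfloor c\rfloor$, with the corresponding $\sigma$-algebra; $R_c$ equals $S_d$ on each piece $Y_d$; and $$\nu_c':=\Big(1-\frac{c}{\lceil c\rceil}\Big)\nu_{\lfloor c\rfloor}+c\sum_{d=\lceil c\rceil}^\infty\Big(\frac1d-\frac1{d+1}\Big)\nu_d.$$ The spectrum of $(X,\mu,T)$ is the set of $\alpha\in[0,1)$ for which there is a non-zero $g\in L^2(\mu)$ with $g\circ T=e^{2\pi i\alpha}g$; it is trivial if it equals $\{0\}$. With $F_0(x)=x(0)$, the system $(X,\mu,T)$ is strongly stationary if $\int\prod_{j=1}^\ell T^{n_j}F_j\,d\mu=\int\prod_{j=1}^\ell T^{rn_j}F_j\,d\mu$ for all $\ell,r\in\mathbb N$, $n_1,\ldots,n_\ell\in\mathbb Z$ and $F_1,\ldots,F_\ell\in\{F_0,\overline{F_0}\}$, where $T^nF=F\circ T^n$. Isomorphic means measure-theoretically isomorphic. *)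

(* Defs.v *)
From HB Require Import structures.
From mathcomp Require Import all_boot all_order all_algebra.
From mathcomp Require Import all_classical all_reals all_analysis.
From mathcomp Require Import complex.

Set Implicit Arguments.
Unset Strict Implicit.
Unset Printing Implicit Defensive.
Import Order.TTheory GRing.Theory Num.Theory.
Import numFieldNormedType.Exports.
Local Open Scope classical_set_scope.
Local Open Scope ring_scope.
Local Open Scope complex_scope.

Definition expi (R : realType) (t : R) : R[i] := cos t +i* sin t.

(* [n ^ (i s)]; only used for positive [n]. *)
Definition npowi (R : realType) (n : nat) (s : int) : R[i] :=
  expi (s%:~R * ln (n%:R : R)).

(* The set of positive integers is modelled by [nat]; the value [f 0] of an
   arithmetic function is never used.  The conditions imply [f 1 = 1]. *)
Definition completely_multiplicative (R : realType) (f : nat -> R[i]) : Prop :=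
  forall m n, (0 < m)%N -> (0 < n)%N -> f (m * n)%N = f m * f n.

(* The sequences are indexed from [0]: the first term of [t] is [t 0 = 1]. *)
Record is_MRT (R : realType) (f : nat -> R[i]) (t s : nat -> int) : Prop := {
  MRT_unimodular : forall n, (0 < n)%N -> `|f n| = 1;
  MRT_mult : completely_multiplicative f;
  MRT_t_increasing : forall m n, (m < n)%N -> t m < t n;
  MRT_s_increasing : forall m n, (m < n)%N -> s m < s n;
  MRT_t0 : t 0%N = 1;
  MRT_growth : forall m,
    [/\ t m < s m.+1, s m.+1 < s m.+1 ^+ 2 & s m.+1 ^+ 2 <= t m.+1];
  MRT_block : forall m p, prime p -> t m < p%:Z <= t m.+1 ->
    f p = npowi R p (s m.+1);
  MRT_approx : forall m p, prime p -> p%:Z <= t m ->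
    `|f p - npowi R p (s m.+1)| <= 1 / (t m)%:~R ^+ 2
}.

Definition unit_disc (R : realType) : set R[i]^o := [set z | `|z| <= 1].

Lemma unit_disc0 (R : realType) : (0 : R[i]^o) \in @unit_disc R.
Proof. by apply/mem_set; rewrite /unit_disc/= normr0 ler01. Qed.

Definition seqspace (R : realType) : Type :=
  prod_topology (fun _ : int => set_type (@unit_disc R)).

HB.instance Definition _ (R : realType) := Topological.copy (seqspace R)
  (prod_topology (fun _ : int => set_type (@unit_disc R))).
HB.instance Definition _ (R : realType) := isPointed.Build (seqspace R)
  (fun _ : int => exist _ (0 : R[i]^o) (unit_disc0 R)).
HB.instance Definition _ (R : realType) := Measurable.copy (seqspace R)
  (g_sigma_algebraType (@open (seqspace R))).

Definition seq_coord (R : realType) (x : seqspace R) (k : int) : R[i] :=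
  set_val (x k).

(* [shiftz n] is the [n]-th power, [n] in [int], of the shift. *)
Definition shiftz (R : realType) (n : int) (x : seqspace R) : seqspace R :=
  fun k => x (k + n).

Definition seq_shift (R : realType) : seqspace R -> seqspace R := @shiftz R 1.

Lemma shiftzD (R : realType) (m n : int) (x : seqspace R) :
  shiftz (m + n) x = shiftz m (shiftz n x).
Proof. by apply/funext => k; rewrite /shiftz addrA. Qed.

Lemma shiftz_iter (R : realType) (n : nat) (x : seqspace R) :
  shiftz n%:Z x = iter n (@seq_shift R) x.
Proof.
elim: n x => [|n IHn] x /=; first by apply/funext => k; rewrite /shiftz addr0.
by rewrite -IHn -[RHS](shiftzD 1 n x) -intS.
Qed.

Definition Elog (R : realType) (M : R) (a : nat -> R) : R :=
  (\sum_(1 <= n < (Num.truncn M).+1) n%:R^-1)^-1 *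
  \sum_(1 <= n < (Num.truncn M).+1) a n / n%:R.

Definition extends_to_Z (R : realType) (f : nat -> R[i]) (x : seqspace R) :=
  forall n, (0 < n)%N -> seq_coord x n%:Z = f n.

(* Weak-star convergence to [mu] of the logarithmic averages over [1 .. N m] of
   the Dirac masses at the n-th iterates of [x]; real test functions suffice. *)
Definition log_furstenberg (R : realType) (x : seqspace R) (N : nat -> R)
    (mu : probability (seqspace R) R) : Prop :=
  forall phi : seqspace R -> R, continuous phi ->
    Elog (N m) (fun n => phi (iter n (@seq_shift R) x)) @[m --> \oo] -->
    (\int[mu]_y phi y)%R.

Definition Cintegral d (X : measurableType d) (R : realType)
    (mu : {measure set X -> \bar R}) (g : X -> R[i]) : R[i] :=
  (\int[mu]_x complex.Re (g x)) +i* (\int[mu]_x complex.Im (g x)).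

Definition is_L2 d (X : measurableType d) (R : realType)
    (mu : {measure set X -> \bar R}) (g : X -> R[i]) : Prop :=
  (fun x => complex.Re (g x)) \in Lfun mu 2%:E /\
  (fun x => complex.Im (g x)) \in Lfun mu 2%:E.

Definition spectrum d (X : measurableType d) (R : realType)
    (mu : {measure set X -> \bar R}) (T : X -> X) : set R :=
  [set alpha | 0 <= alpha < 1 /\ exists g : X -> R[i],
     [/\ is_L2 mu g, ~ {ae mu, forall x, g x = 0} &
         {ae mu, forall x, g (T x) = expi (2 * pi * alpha) * g x}]].

Definition F0 (R : realType) (x : seqspace R) : R[i] := seq_coord x 0.

Definition strongly_stationary (R : realType)
    (mu : probability (seqspace R) R) : Prop :=
  forall (l r : nat) (n : 'I_l -> int) (F : 'I_l -> seqspace R -> R[i]),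
    (0 < l)%N -> (0 < r)%N ->
    (forall j, F j = @F0 R \/ F j = (fun x => (F0 x)^*%C)) ->
    Cintegral mu (fun x => \prod_(j < l) F j (shiftz (n j) x)) =
    Cintegral mu (fun x => \prod_(j < l) F j (shiftz (r%:Z * n j) x)).

(* There are forward invariant sets of full measure between which a bimeasurable,
   measure preserving bijection [phi], with inverse [psi], conjugates [T] to [S]. *)
Definition isomorphic_systems (R : realType)
    dX (X : measurableType dX) (mu : {measure set X -> \bar R}) (T : X -> X)
    dY (Y : measurableType dY) (nu : {measure set Y -> \bar R}) (S : Y -> Y) :
    Prop :=
  exists (A : set X) (B : set Y) (phi : X -> Y) (psi : Y -> X),
  [/\ [/\ measurable A, mu (~` A) = 0%E & T @` A `<=` A],
      [/\ measurable B, nu (~` B) = 0%E & S @` B `<=` B],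
      [/\ measurable_fun A phi, phi @` A `<=` B &
          forall x, A x -> psi (phi x) = x],
      [/\ measurable_fun B psi, psi @` B `<=` A &
          forall y, B y -> phi (psi y) = y] &
      (forall C, measurable C -> mu (A `&` phi @^-1` C) = nu C) /\
      (forall x, A x -> phi (T x) = S (phi x))].

Section torus.
Variable R : realType.

Definition integers : pred R := fun x => x \is a Num.int.

Let integers_zmod_closed : zmod_closed integers.
Proof. by split=> [|x y]; [exact: rpred0|exact: rpredB]. Qed.

HB.instance Definition _ := GRing.isZmodClosed.Build R integers
  integers_zmod_closed.

Definition torus : Type := Quotient.quot (GRing.ZmodClosed.clone R integers _).

HB.instance Definition _ := EqQuotient.on torus.
HB.instance Definition _ := GRing.Zmodule.on torus.
HB.instance Definition _ := isPointed.Build torus 0.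

Definition torus_pi (x : R) : torus := (\pi_torus x)%qT.

End torus.

Section torus_measurable.
Variable R : realType.

(* The Borel sets of R / Z are the sets with Borel preimage in R. *)
Definition torus_measurable : set (set (torus R)) :=
  [set A | measurable (@torus_pi R @^-1` A)].

Let torus_measurable0 : torus_measurable set0.
Proof. by rewrite /torus_measurable/= preimage_set0. Qed.

Let torus_measurableC A : torus_measurable A -> torus_measurable (~` A).
Proof. by rewrite /torus_measurable/= preimage_setC; exact: measurableC. Qed.

Let torus_measurable_bigcup (F : (set (torus R))^nat) :
  (forall i, torus_measurable (F i)) -> torus_measurable (\bigcup_i F i).
Proof.
move=> mF; rewrite /torus_measurable/= preimage_bigcup.
by apply: bigcup_measurable => i _; exact: mF.
Qed.

HB.instance Definition _ := @isMeasurable.Build default_measure_display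
  (torus R) torus_measurable torus_measurable0 torus_measurableC
  torus_measurable_bigcup.

Lemma measurable_torus_pi : measurable_fun [set: R] (@torus_pi R).
Proof. by move=> _ A; rewrite setTI. Qed.

(* Haar measure on R / Z: the image of Lebesgue measure on [0, 1[. *)
Definition haar1 (A : set (torus R)) : \bar R :=
  lebesgue_measure (@torus_pi R @^-1` A `&` `[0, 1[%classic).

Let haar10 : haar1 set0 = 0%E.
Proof. by rewrite /haar1 preimage_set0 set0I measure0. Qed.

Let haar1_ge0 A : (0 <= haar1 A)%E.
Proof. exact: measure_ge0. Qed.

Let haar1_sigma_additive : semi_sigma_additive haar1.
Proof.
move=> F mF tF mUF; rewrite /haar1 preimage_bigcup setI_bigcupl.
apply: measure_semi_sigma_additive.
- by move=> n; apply: measurableI => //; exact: mF.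
- apply/trivIsetP => i j _ _ ij; rewrite setIACA -preimage_setI.
  by move/trivIsetP : tF => /(_ _ _ _ _ ij) -> //; rewrite preimage_set0 set0I.
- by apply: bigcup_measurable => n _; apply: measurableI => //; exact: mF.
Qed.

HB.instance Definition _ := isMeasure.Build _ _ _ haar1
  haar10 haar1_ge0 haar1_sigma_additive.

Let haar1_setT : haar1 [set: torus R] = 1%E.
Proof.
rewrite /haar1 preimage_setT setTI lebesgue_measure_itv/= lte_fin ltr01.
by rewrite oppr0 adde0.
Qed.

HB.instance Definition _ := Measure_isProbability.Build _ _ _ haar1 haar1_setT.

End torus_measurable.

Section product_probability.
Context d1 d2 (T1 : measurableType d1) (T2 : measurableType d2) (R : realType).
Variables (P : probability T1 R) (Q : probability T2 R).

Definition prod_prob : set (T1 * T2) -> \bar R := (P \x Q)%E.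

HB.instance Definition _ := Measure.on prod_prob.

Let prod_prob_setT : prod_prob [set: T1 * T2] = 1%E.
Proof.
rewrite -setXTT [LHS]product_measure1E//.
by rewrite [X in (X * _)%E]probability_setT [X in (_ * X)%E]probability_setT mule1.
Qed.

HB.instance Definition _ :=
  Measure_isProbability.Build _ _ _ prod_prob prod_prob_setT.

End product_probability.

Section tuple_cons.
Context d (T : measurableType d) (n : nat).

Definition tuple_cons (x : T * n.-tuple T) : n.+1.-tuple T :=
  [tuple of x.1 :: x.2].

Let measurable_tuple_cons : measurable_fun setT tuple_cons.
Proof. exact: measurable_cons. Qed.

HB.instance Definition _ :=
  isMeasurableFun.Build _ _ _ _ tuple_cons measurable_tuple_cons.

End tuple_cons.

(* The n-fold product of Haar measure, that is Haar measure on (R / Z) ^ n. *)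
Fixpoint haar (R : realType) (n : nat) : probability (n.-tuple (torus R)) R :=
  match n with
  | 0%N => dirac [tuple]
  | m.+1 => distribution (prod_prob (@haar1 R) (haar R m))
      (@tuple_cons _ (torus R) m)
  end.

Definition Yd (R : realType) (d : nat) : Type := d.+1.-tuple (torus R).

HB.instance Definition _ (R : realType) (d : nat) :=
  Measurable.copy (Yd R d) (d.+1.-tuple (torus R)).

Definition nu_d (R : realType) (d : nat) : probability (Yd R d) R :=
  haar R d.+1.

Definition S_d (R : realType) (d : nat) (x : Yd R d) : Yd R d :=
  [tuple if i == 0%N :> nat then tnth x i else tnth x i + tnth x (inord i.-1)
   | i < d.+1].

Section disjoint_union.
Context d (I : pointedType) (T : I -> measurableType d).

Definition disjoint_union : Type := {i : I & T i}.

Definition inj_piece (i : I) (x : T i) : disjoint_union := existT _ i x.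
Arguments inj_piece : clear implicits.

HB.instance Definition _ := gen_eqMixin disjoint_union.
HB.instance Definition _ := gen_choiceMixin disjoint_union.
HB.instance Definition _ := isPointed.Build disjoint_union
  (inj_piece point point).

Definition du_measurable : set (set disjoint_union) :=
  [set A | forall i, measurable (inj_piece i @^-1` A)].

Let du_measurable0 : du_measurable set0.
Proof. by move=> i; rewrite preimage_set0. Qed.

Let du_measurableC A : du_measurable A -> du_measurable (~` A).
Proof. by move=> mA i; rewrite preimage_setC; apply: measurableC; exact: mA. Qed.

Let du_measurable_bigcup (F : (set disjoint_union)^nat) :
  (forall n, du_measurable (F n)) -> du_measurable (\bigcup_n F n).
Proof.
move=> mF i; rewrite preimage_bigcup.
by apply: bigcup_measurable => n _; exact: mF.
Qed.

HB.instance Definition _ := @isMeasurable.Build d disjoint_union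
  du_measurable du_measurable0 du_measurableC du_measurable_bigcup.

Lemma measurable_inj_piece i : measurable_fun [set: T i] (inj_piece i).
Proof. by move=> _ A mA; rewrite setTI; exact: mA. Qed.

HB.instance Definition _ i := isMeasurableFun.Build _ _ _ _ (inj_piece i)
  (@measurable_inj_piece i).

End disjoint_union.
Arguments inj_piece {d I T} i x.

Section Z_c.
Variables (R : realType) (c : R).

Definition floorn : nat := Num.truncn c.
Definition ceiln : nat := `|Num.ceil c|%N.

Definition Zindex : Type := {d : nat | (floorn <= d)%N}.

HB.instance Definition _ := Choice.on Zindex.
HB.instance Definition _ := SubChoice.on Zindex.
HB.instance Definition _ := isPointed.Build Zindex
  (exist _ floorn (leqnn floorn)).

Definition Zfam (i : Zindex) : measurableType _ := Yd R (val i).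

Definition Zc : Type := disjoint_union Zfam.

HB.instance Definition _ := Measurable.on Zc.

Definition Rc (z : Zc) : Zc := inj_piece (projT1 z) (S_d (projT2 z)).

(* [nu_d] carried by the piece of index [d]; [insubd] takes a junk value for
   [d < floorn], an index that does not occur below. *)
Definition nu_piece (d : nat) : probability Zc R :=
  let i : Zindex := insubd (point : Zindex) d in
  distribution (nu_d R (val i)) (inj_piece i : {mfun Zfam i >-> Zc}).

Local Open Scope ereal_scope.

(* The positivity of [c] is an argument because it is what makes [nuZ] a
   probability measure. *)
Definition nuZ (_ : (0 < c)%R) (A : set Zc) : \bar R :=
  (1 - c / ceiln%:R)%:E * nu_piece floorn A +
  c%:E * \sum_(ceiln <= d <oo) (d%:R^-1 - d.+1%:R^-1)%:E * nu_piece d A.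

Section nuZ_probability.
Hypothesis hc : (0 < c)%R.

Let ceiln_gt0 : (0 < ceiln)%N.
Proof. by rewrite /ceiln absz_gt0 gt_eqF// Num.Theory.ceil_gt0. Qed.

Let le_ceiln : (c <= ceiln%:R)%R.
Proof.
rewrite /ceiln natr_absz ger0_norm ?ceil_ge//.
by rewrite ltW// ceil_gt0.
Qed.

Let weight0_ge0 : (0 <= 1 - c / ceiln%:R)%R.
Proof. by rewrite subr_ge0 ler_pdivrMr ?mul1r// ltr0n. Qed.

Let weight_ge0 (d : nat) : (0 < d)%N -> (0 <= d%:R^-1 - d.+1%:R^-1 :> R)%R.
Proof. by move=> d0; rewrite subr_ge0 lef_pV2 ?posrE ?ltr0n// ler_nat. Qed.

Let nuZ_measure : {measure set Zc -> \bar R} :=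
  measure_add (mscale (NngNum weight0_ge0) (nu_piece floorn))
    (mscale (NngNum (ltW hc)) (mseries (fun d =>
      mscale `|d%:R^-1 - d.+1%:R^-1 : R|%:nng%R (nu_piece d)) ceiln)).

Let nuZE : nuZ hc = nuZ_measure.
Proof.
apply/funext => A; rewrite [RHS]measure_addE; congr (_ + _ * _).
rewrite ereal_series [RHS]ereal_series; apply: eq_eseriesr => d cd.
congr (_%:E * _).
by rewrite /= ger0_norm//; apply: weight_ge0; exact: leq_trans cd.
Qed.

Let nuZ0 : nuZ hc set0 = 0. Proof. by rewrite nuZE measure0. Qed.

Let nuZ_ge0 A : 0 <= nuZ hc A. Proof. by rewrite nuZE. Qed.

Let nuZ_sigma_additive : semi_sigma_additive (nuZ hc).
Proof. by rewrite nuZE; exact: measure_semi_sigma_additive. Qed.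

HB.instance Definition _ := isMeasure.Build _ _ _ (nuZ hc)
  nuZ0 nuZ_ge0 nuZ_sigma_additive.

Let nuZ_setT : nuZ hc [set: Zc] = 1.
Proof.
rewrite /nuZ probability_setT mule1.
under eq_eseriesr do rewrite probability_setT mule1.
rewrite (@cvg_lim _ _ _ _ _ _ (ceiln%:R^-1)%:E)//.
  by rewrite -EFinM -EFinD subrK.
apply: cvg_trans (_ : (ceiln%:R^-1 - n%:R^-1)%:E @[n --> \oo] --> _).
  apply: near_eq_cvg; near=> n; rewrite sumEFin; congr EFin.
  have cn : (ceiln <= n)%N by near: n; exact: nbhs_infty_ge.
  have := @telescope_sumr R ceiln n (fun k => - k%:R^-1)%R cn.
  rewrite opprK addrC => <-; apply: eq_bigr => d _.
  by rewrite opprK addrC.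
apply: cvg_EFin; first by near=> n.
rewrite -[X in _ --> X]subr0; apply: cvgB; first exact: cvg_cst.
apply/gtr0_cvgV0; last exact: cvgr_idn.
by near=> n; rewrite ltr0n; near: n; exact: nbhs_infty_gt.
Unshelve. all: by end_near. Qed.

HB.instance Definition _ := Measure_isProbability.Build _ _ _ (nuZ hc) nuZ_setT.

End nuZ_probability.

End Z_c.

(* Main.v *)
Require Import Defs.
From HB Require Import structures.
From mathcomp Require Import all_boot all_order all_algebra.
From mathcomp Require Import all_classical all_reals all_analysis.
From mathcomp Require Import measurable_realfun complex ring lra zify.
Import Order.TTheory GRing.Theory Num.Theory.
Import numFieldNormedType.Exports.
Local Open Scope classical_set_scope.
Local Open Scope ring_scope.
Local Open Scope complex_scope.
Set Implicit Arguments.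
Unset Strict Implicit.
Unset Printing Implicit Defensive.

(** A Borel probability measure on the sequence space is determined by the
    integrals of the monomials, that is of the finite products of coordinates
    and of their conjugates ([moments_determine], through a Stone-Weierstrass
    argument). So it is enough to find the limits of the logarithmic averages
    of the monomials along the orbit of [f], and to recognise them as the
    integrals of the monomials in a measure carried by orbits of the model.

    On the scale of the [m]-th average, [f n] can be replaced by [n ^ (i s)]
    with [s] the relevant term of the frequency sequence: the two functions
    agree at the primes above [t_m], and at the smaller primes their difference
    is too small to matter on average ([log_average_close]). A monomial, encoded
    as a list of signed shifts, takes at time [n] along [n ^ (i s)] the value
    [exp (i s l(n))], where [l(n)] is the signed sum of the [ln (n + k)]. If [q]
    is the order of the first non-zero moment of the configuration, the sum of
    the [(+/-) k ^ q], then [l(n)] is about a constant times [n ^ (- q)],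
    or [ln n] when [q = 0] ([logsum_asymptotics]). Consider the range of [n] between the roots of
    order [d + 1] and [d] of [s]. If [q > d], the phase tends to [0] there and
    the monomial is close to [1]. If [q = d], the phase moves slowly but makes
    many turns, and summation by parts shows that the average tends to [0]; if
    [q < d], van der Corput differencing reduces to this case, since the
    differences of a configuration have their first non-zero moment one order
    later ([cancels_le]). In the logarithmic average up to [s ^ (1 / c)] this
    range weighs [c (1 / d - 1 / (d + 1))], with the appropriate change for the
    range cut by [c]. The limit is thus the total weight of the [d] for which
    all moments of order at most [d] vanish ([osc_limit]).

    In the model, a point of [Y_d] gives the binomial coefficients of a
    polynomial sequence of degree [d] in the torus; reading it through the
    character [exp (2 pi i x)] gives a point of the sequence space, and [S_d]
    becomes the shift, by Pascal's rule ([orbit_S]). A monomial is then a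
    character of the torus whose frequencies are the binomial moments of the
    configuration, so that its integral is [1] if all moments of order at most
    [d] vanish, and [0] otherwise. Hence the image of [nuZ] has the moments
    found above ([integral_mu_c]): it is the Furstenberg measure. The orbit map
    is injective off a null set, because a polynomial with non-zero leading
    coefficient is recovered from its values by finite differences
    ([furstenberg_isomorphic]).

    The other two properties are read off the moments. Multiplying all shifts
    by [r] multiplies the moment of order [i] by [r ^ i] and does not affect the
    vanishing, whence strong stationarity. The correlation of two distinct
    translates of a monomial does not depend on the translates
    ([total_mass_difference]); if [g] is an eigenfunction for an eigenvalue
    other than [1], then averaging over the translates and applying the
    Cauchy-Schwarz inequality shows that [g] is orthogonal to every monomial,
    because the partial sums of the powers of the eigenvalue stay bounded
    ([eigenfunction_eq0]). *)

(** * The Taylor expansion of the logarithm *)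

Lemma mvt_bound (R : realType) (f df : R -> R) (a b M : R) :
  (forall x, Num.min a b <= x <= Num.max a b -> is_derive x 1 f (df x)) ->
  (forall x, Num.min a b <= x <= Num.max a b -> `|df x| <= M) ->
  `|f b - f a| <= M * `|b - a|.
Proof.
wlog ab : a b / a <= b => [hw hf hM|].
  have [/hw|/ltW/hw] := leP a b; first exact.
  by rewrite minC maxC distrC [`|b - a|]distrC; apply.
rewrite (min_idPl ab) (max_idPr ab) => hf hM.
have [||c cab ->] := @MVT_segment R f df a b ab.
- by move=> x; rewrite in_itv/= => /andP[/ltW ax /ltW xb]; apply: hf; rewrite ax.
- apply: derivable_within_continuous => x; rewrite in_itv/= => xab.
  by have := hf x xab => -[].
by rewrite normrM ler_wpM2r// hM//; move: cab; rewrite in_itv.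
Qed.

Definition ln_taylor (R : realType) (q : nat) (x : R) : R :=
  \sum_(j < q) (-1) ^+ j * x ^+ j.+1 / j.+1%:R.

Lemma is_derive_ln_taylor (R : realType) (q : nat) (x : R) :
  is_derive x 1 (@ln_taylor R q) (\sum_(j < q) (- x) ^+ j).
Proof.
have -> : @ln_taylor R q =
    \sum_(j < q) (fun y : R => (-1) ^+ j * y ^+ j.+1 / j.+1%:R).
  by apply/funext => y; rewrite fct_sumE.
apply: is_derive_sum => i.
have := is_deriveZ ((-1) ^+ i / i.+1%:R) (is_deriveX i.+1 (is_derive_id x (1 : R))).
have -> : ((-1) ^+ i / i.+1%:R) \*: (@id R : R -> R) ^+ i.+1 =
    (fun y : R => (-1) ^+ i * y ^+ i.+1 / i.+1%:R).
  by apply/funext => y; rewrite /= exprfctE /GRing.scale /= mulrAC.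
move=> /is_derive_eq; apply.
rewrite /GRing.scale /= mulr1 [in RHS]exprNn.
by rewrite mulrA divfK ?pnatr_eq0.
Qed.

(** The error has derivative [(- x) ^ q / (1 + x)], which the factor [1 + x]
    at least [1 / 2] keeps below [2 |x| ^ q]. *)
Lemma ln1D_taylor (R : realType) (q : nat) (x : R) : `|x| <= 2^-1 ->
  `|ln (1 + x) - ln_taylor q x| <= 2 * `|x| ^+ q.+1.
Proof.
move=> x2; set h := fun y : R => ln (1 + y) - ln_taylor q y.
have h0 : h 0 = 0.
  rewrite /h addr0 ln1 /ln_taylor big1 ?subr0// => i _.
  by rewrite expr0n /= mulr0 mul0r.
have -> : ln (1 + x) - ln_taylor q x = h x - h 0 by rewrite h0 subr0.
have -> : 2 * `|x| ^+ q.+1 = (2 * `|x| ^+ q) * `|x - 0|.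
  by rewrite subr0 exprSr mulrA.
have hx y : Num.min 0 x <= y <= Num.max 0 x -> `|y| <= `|x|.
  have [x0|x0] := leP 0 x => /andP[y0 yx]; first by rewrite !ger0_norm.
  by rewrite !ler0_norm ?lerN2// ltW.
apply: (@mvt_bound _ _ (fun y => (- y) ^+ q / (1 + y))) => y /hx yx.
  have y1 : 0 < 1 + y by have := le_trans yx x2; rewrite ler_norml; lra.
  have -> : (- y) ^+ q / (1 + y) = (1 + y)^-1 * 1 - \sum_(j < q) (- y) ^+ j.
    have := subrX1 (- y) q; move: (\sum_(i < q) _) => S.
    have -> : - y - 1 = - (1 + y) by ring.
    move=> H; have -> : (- y) ^+ q = 1 - (1 + y) * S by rewrite -[LHS](subrK 1) H; ring.
    by field; rewrite gt_eqF.
  apply: is_deriveB; last exact: is_derive_ln_taylor.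
  have -> : (fun y : R => ln (1 + y)) = @ln R \o (fun y => 1 + y) by [].
  apply: is_derive1_comp; first exact: is_derive1_ln.
  by rewrite -[X in is_derive _ _ _ X]add0r; apply: is_deriveD.
rewrite normrM normrX normrN mulrC normfV.
have y1 : 2^-1 <= `|1 + y| by have := le_trans yx x2; rewrite ler_norml ler_normr; lra.
apply: ler_pM; rewrite ?invr_ge0 ?exprn_ge0//.
  by rewrite invf_ple ?posrE//; apply: lt_le_trans y1; lra.
by rewrite lerXn2r// nnegrE.
Qed.

(** * Moments of a configuration and the phase of a monomial *)

(** A pair [(k, b)] stands for the coordinate of index [k], conjugated when [b]
    holds; a configuration stands for the product of such factors. *)
Definition config : Type := seq (int * bool).

Definition moment (v : config) (i : nat) : int :=
  \sum_(p <- v) (-1) ^+ p.2 * p.1 ^+ i.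

Definition moments_vanish (q : nat) (v : config) : Prop :=
  forall i, (i < q)%N -> moment v i = 0.

Definition translate (l : nat) (v : config) : config :=
  [seq (p.1 + l%:Z, p.2) | p <- v].

Definition opposite (v : config) : config := [seq (p.1, ~~ p.2) | p <- v].

(** The monomial translated by [l] times the conjugate of its translate by [l']:
    its average is the correlation of the two translates. *)
Definition difference (l l' : nat) (v : config) : config :=
  translate l v ++ opposite (translate l' v).

(** The phase at time [n] of the monomial [v] along [n ^ (i s)], divided by [s]. *)
Definition logsum (R : realType) (v : config) (n : nat) : R :=
  \sum_(p <- v) (-1) ^+ p.2 * ln ((n%:Z + p.1)%:~R : R).

Lemma moment_cat (v w : config) i : moment (v ++ w) i = moment v i + moment w i.
Proof. by rewrite /moment big_cat. Qed.

Lemma moment_opposite (v : config) i : moment (opposite v) i = - moment v i.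
Proof.
rewrite /moment big_map raddf_sum; apply: eq_bigr => -[k b] _ /=.
by rewrite -mulNr; case: b; rewrite ?expr1 ?expr0 ?opprK.
Qed.

Lemma moment_translate l (v : config) i :
  moment (translate l v) i = \sum_(a < i.+1) l%:Z ^+ (i - a) *+ 'C(i, a) * moment v a.
Proof.
rewrite /moment big_map.
under eq_bigr do rewrite /= addrC exprDn mulr_sumr.
rewrite exchange_big; apply: eq_bigr => a _ /=.
rewrite mulr_sumr; apply: eq_bigr => p _.
by rewrite mulrCA mulrnAl.
Qed.

Lemma moment_translate_vanish q l (v : config) i : moments_vanish q v ->
  (i <= q)%N -> moment (translate l v) i = moment v i.
Proof.
move=> vq iq; rewrite moment_translate big_ord_recr/= subnn binn mul1r.
by rewrite big1 ?add0r// => a _; rewrite vq ?mulr0// (leq_trans _ iq).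
Qed.

Lemma moment_translate_next q l (v : config) : moments_vanish q v ->
  moment (translate l v) q.+1 = moment v q.+1 + (q.+1%:Z * l%:Z) * moment v q.
Proof.
move=> vq; rewrite moment_translate !big_ord_recr/= subnn binn mul1r.
rewrite big1 ?add0r => [|a _]; last by rewrite vq ?mulr0.
by rewrite addrC subSnn expr1 binSn -mulr_natl natz.
Qed.

Lemma moments_vanish_difference q l l' (v : config) :
  moments_vanish q v -> moments_vanish q.+1 (difference l l' v).
Proof.
move=> vq i; rewrite ltnS => iq; rewrite moment_cat moment_opposite.
by rewrite !(moment_translate_vanish _ vq iq) subrr.
Qed.

(** The moments of the translates are polynomials in the translation, whose
    linear term survives in the difference: the first non-zero moment moves up by
    exactly one order, which is what the differencing induction consumes. *)
Lemma moment_difference q l l' (v : config) : moments_vanish q v ->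
  moment (difference l l' v) q.+1 = q.+1%:Z * (l%:Z - l'%:Z) * moment v q.
Proof.
move=> vq; rewrite moment_cat moment_opposite !(moment_translate_next _ vq); ring.
Qed.

Section logsum.
Context {R : realType}.
Implicit Types v w : config.

Lemma logsum_cat v w n : logsum R (v ++ w) n = logsum R v n + logsum R w n.
Proof. by rewrite /logsum big_cat. Qed.

Lemma logsum_opposite v n : logsum R (opposite v) n = - logsum R v n.
Proof.
rewrite /logsum big_map raddf_sum; apply: eq_bigr => -[k b] _ /=.
by rewrite -mulNr; case: b; rewrite ?expr1 ?expr0 ?opprK.
Qed.

Lemma logsum_translate l v n : logsum R (translate l v) n = logsum R v (n + l).
Proof.
rewrite /logsum big_map; apply: eq_bigr => -[k b] _ /=.
by rewrite PoszD addrAC addrA.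
Qed.

Lemma logsum_difference l l' v n :
  logsum R (difference l l' v) n = logsum R v (n + l) - logsum R v (n + l').
Proof. by rewrite logsum_cat logsum_opposite !logsum_translate. Qed.

Definition reach v : nat := \sum_(p <- v) `|p.1|%N.

Lemma reachP v p : p \in v -> (`|p.1| <= reach v)%N.
Proof. by move=> pv; rewrite /reach (big_rem p)//= leq_addr. Qed.

Lemma intr_moment v i :
  (moment v i)%:~R = \sum_(p <- v) (-1) ^+ p.2 * (p.1)%:~R ^+ i :> R.
Proof.
rewrite /moment raddf_sum/=; apply: eq_bigr => p _.
by rewrite intrM !rmorphXn/= rmorphN1.
Qed.

(** Write [ln (n + k)] as [ln n + ln (1 + k / n)]. The vanishing of the moment of
    order [0] removes [ln n], and the other vanishing moments are the Taylor
    coefficients up to order [d]. *)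
Lemma logsum_asymptotics v d : moments_vanish d.+1 v ->
  exists C : R, 0 <= C /\ forall n, (2 * reach v < n)%N ->
  `|logsum R v n - (-1) ^+ d * (moment v d.+1)%:~R / (d.+1%:R * n%:R ^+ d.+1)|
    <= C / n%:R ^+ d.+2.
Proof.
move=> vd; exists (\sum_(p <- v) 2 * `|p.1%:~R| ^+ d.+2); split.
  by apply: sumr_ge0 => p _; rewrite mulr_ge0// exprn_ge0.
move=> n vn.
have n0 : 0 < n%:R :> R by rewrite ltr0n (leq_trans _ vn).
have small p : p \in v -> `|p.1%:~R / n%:R : R| <= 2^-1.
  move=> /reachP pv; rewrite normrM normfV (ger0_norm (ltW n0)) ler_pdivrMr//.
  rewrite -intr_norm mulrC ler_pdivlMr// -natr_absz -natrM ler_nat.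
  by apply: leq_trans (ltnW vn); rewrite mulnC leq_mul2l pv.
have lnE p : p \in v ->
    ln ((n%:Z + p.1)%:~R : R) = ln n%:R + ln (1 + p.1%:~R / n%:R).
  move=> /small pv; rewrite intrD /= -lnM ?posrE//.
    by rewrite mulrDr mulr1 mulrCA divff ?gt_eqF// mulr1.
  by move: pv; rewrite ler_norml; lra.
have -> : logsum R v n = \sum_(p <- v) (-1) ^+ p.2 * ln (1 + p.1%:~R / n%:R).
  rewrite /logsum big_seq.
  under eq_bigr => p pv do rewrite lnE// mulrDr.
  rewrite -big_seq big_split/= -mulr_suml.
  have -> : \sum_(p <- v) (-1) ^+ p.2 = 0 :> R; last by rewrite mul0r add0r.
  transitivity ((moment v 0)%:~R : R); last by rewrite vd.
  by rewrite intr_moment; apply: eq_bigr => p _; rewrite expr0 mulr1.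
have -> : (-1) ^+ d * (moment v d.+1)%:~R / (d.+1%:R * n%:R ^+ d.+1) =
    \sum_(p <- v) (-1) ^+ p.2 * ln_taylor d.+1 (p.1%:~R / n%:R : R).
  rewrite /ln_taylor; under eq_bigr do rewrite mulr_sumr.
  rewrite exchange_big big_ord_recr/= big1 ?add0r => [|i _].
    rewrite intr_moment mulr_sumr mulr_suml; apply: eq_bigr => p _.
    by rewrite expr_div_n; field; rewrite gt_eqF//= expf_neq0// gt_eqF.
  transitivity ((-1) ^+ i / (i.+1%:R * n%:R ^+ i.+1) * (moment v i.+1)%:~R : R).
    rewrite intr_moment mulr_sumr; apply: eq_bigr => p _.
    by rewrite expr_div_n; field; rewrite ?expf_neq0 ?gt_eqF// ltr0n.
  by rewrite vd ?mulr0// ltnS.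
rewrite -sumrB mulr_suml (le_trans (ler_norm_sum _ _ _))//.
rewrite big_seq [leRHS]big_seq; apply: ler_sum => p pv.
rewrite -mulrBr normrM normrX normrN1 expr1n mul1r.
apply: (le_trans (ln1D_taylor _ (small p pv))).
by rewrite normrM normfV (ger0_norm (ltW n0)) expr_div_n mulrA.
Qed.

End logsum.

(** * Cancellation in oscillating logarithmic sums *)

Section oscillation.
Context {R : realType}.
Implicit Types (v w : config) (s L beta eps K x y h : R) (A B : nat).

Definition hsum A B : R := \sum_(A <= n < B) n%:R^-1.

Definition osc v s beta A B : R :=
  \sum_(A <= n < B) cos (s * logsum R v n + beta) / n%:R.

Lemma cos_lipschitz x y : `|cos y - cos x| <= `|y - x|.
Proof.
rewrite -[leRHS]mul1r; apply: (@mvt_bound _ cos (fun z => - sin z)) => z _.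
by rewrite normrN ler_norml sin_geN1 sin_le1.
Qed.

Lemma sin_taylor1 x h : `|sin (x + h) - sin x - h * cos x| <= h ^+ 2.
Proof.
pose g := fun y : R => sin y - cos x * y.
have -> : sin (x + h) - sin x - h * cos x = g (x + h) - g x by rewrite /g; ring.
have xhE : x + h - x = h by rewrite addrC addrA addNr add0r.
have -> : h ^+ 2 = `|h| * `|x + h - x| by rewrite xhE -normrM -expr2 ger0_norm ?sqr_ge0.
apply: (@mvt_bound _ g (fun z => cos z - cos x)) => z zx.
  apply: is_deriveB.
  have := is_deriveZ (cos x) (is_derive_id z (1 : R)).
  by rewrite /GRing.scale/= mulr1.
apply: le_trans (cos_lipschitz _ _) _.
move: zx; have [h0|h0] := leP x (x + h) => /andP[zx xz].
  by rewrite !ger0_norm; lra.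
by rewrite !ler0_norm; lra.
Qed.

Lemma hsum_ge0 A B : 0 <= hsum A B.
Proof. by apply: sumr_ge0 => n _; rewrite invr_ge0. Qed.

Lemma hsum_cat A B n : (A <= B <= n)%N -> hsum A n = hsum A B + hsum B n.
Proof. by move=> /andP[AB Bn]; rewrite /hsum (big_cat_nat AB Bn). Qed.

Lemma osc_cat v s beta A B n : (A <= B <= n)%N ->
  osc v s beta A n = osc v s beta A B + osc v s beta B n.
Proof. by move=> /andP[AB Bn]; rewrite /osc (big_cat_nat AB Bn). Qed.

Lemma hsum_le_ratio A B (Q : R) : (0 < A)%N -> B%:R <= Q * A%:R -> 0 <= Q ->
  hsum A B <= Q.
Proof.
move=> A0 BQ Q0; have a0 : 0 < A%:R :> R by rewrite ltr0n.
apply: (@le_trans _ _ (\sum_(A <= n < B) A%:R^-1)).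
  rewrite /hsum big_nat [leRHS]big_nat; apply: ler_sum => n /andP[An _].
  by rewrite lef_pV2 ?posrE ?ler_nat ?ltr0n// (leq_trans A0).
rewrite sumr_const_nat -[leLHS]mulr_natl ler_pdivrMr//; apply: le_trans BQ.
by rewrite ler_nat leq_subr.
Qed.

Lemma norm_osc_le v s beta A B : `|osc v s beta A B| <= hsum A B.
Proof.
apply: le_trans (ler_norm_sum _ _ _) _; apply: ler_sum => n _.
rewrite normrM normfV normr_nat ler_piMl ?invr_ge0//.
by rewrite ler_norml cos_geN1 cos_le1.
Qed.

(** Summation by parts against a monotone weight loses only the last weight. *)
Lemma abel_bound (u S : nat -> R) A B : 0 <= u A ->
  {homo u : m n / (m <= n)%N >-> m <= n} -> (forall n, `|S n| <= 1) ->
  (A <= B)%N -> `|\sum_(A <= n < B) u n * (S n.+1 - S n)| <= 2 * u B.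
Proof.
move=> u0 um S1 AB.
have up n : (A <= n)%N -> 0 <= u n by move=> /um; apply: le_trans.
suff H : `|\sum_(A <= n < B) u n * (S n.+1 - S n) - u B * S B| <= u B.
  have := ler_normD (\sum_(A <= n < B) u n * (S n.+1 - S n) - u B * S B) (u B * S B).
  rewrite subrK => /le_trans; apply.
  rewrite mulr_natl mulr2n lerD// normrM ger0_norm ?up//.
  by rewrite ler_piMr ?up.
have base : `|u A * S A| <= u A by rewrite normrM ger0_norm// ler_piMr.
elim: B AB => [|B IHB].
  by rewrite leqn0 => /eqP A0; rewrite -A0 big_geq// sub0r normrN.
rewrite leq_eqVlt => /predU1P[<-|]; first by rewrite big_geq// sub0r normrN.
rewrite ltnS => AB; rewrite big_nat_recr//=.
have -> (X : R) : X + u B * (S B.+1 - S B) - u B.+1 * S B.+1 =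
  (X - u B * S B) + (u B - u B.+1) * S B.+1 by ring.
apply: (le_trans (ler_normD _ _)).
have : `|(u B - u B.+1) * S B.+1| <= u B.+1 - u B.
  have uB : 0 <= u B.+1 - u B by rewrite subr_ge0 um.
  by rewrite normrM distrC (ger0_norm uB) ler_piMr.
by have := IHB AB; lra.
Qed.

(** The constant [K] is a margin: the interval sits well inside the range from
    the root of order [d + 1] to the root of order [d] of [s]. The bound is relative
    to [L], a large quantity of the size of the whole logarithmic mass, because an
    interval of bounded mass need not cancel. *)
Definition cancels (d : nat) v : Prop := forall eps, 0 < eps -> exists K, 1 <= K /\
  forall A B s L beta, K <= A%:R -> (A <= B)%N ->
    K * s <= A%:R ^+ d.+1 -> K * B%:R ^+ d <= s -> K <= L -> hsum A B <= L ->
  `|osc v s beta A B| <= eps * L.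

End oscillation.

Section cancellation.
Context {R : realType}.
Implicit Types (v w : config) (s L beta eps K x y h : R) (A B : nat).

(** Here the increment of the phase at [n] is about [s * sg / n ^ (d + 1)], which
    is small, so that [cos (phase) / n] is nearly the increment of [sin (phase)]
    times the weight [n ^ d / (s * sg)]. Summation by parts against this monotone
    weight leaves [B ^ d / s], which is small. *)
Lemma cancels_base d v : moments_vanish d v -> moment v d != 0 ->
  @cancels R d v.
Proof.
move=> vd vd0.
set w := difference 1 0 v.
have [C [C0 wC]] := @logsum_asymptotics R w d (moments_vanish_difference 1 0 vd).
have [sg sgE] : exists sg : R, sg = (-1) ^+ d * (moment w d.+1)%:~R / d.+1%:R.
  by eexists.
have sg0 : 0 < `|sg|.
  rewrite normr_gt0 sgE mulf_neq0 ?invr_eq0 ?pnatr_eq0//.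
  rewrite mulf_neq0 ?signr_eq0// intr_eq0 /w moment_difference//.
  by rewrite mulf_neq0.
move=> eps eps0.
pose D : R := (`|sg| + C) ^+ 2 + C.
pose K : R := 1 + (2 * reach w).+1%:R + (D + 2) / (`|sg| * eps); exists K.
have D0 : 0 <= D by rewrite /D addr_ge0// sqr_ge0.
have q0 : 0 <= (D + 2) / (`|sg| * eps).
  by rewrite divr_ge0 ?mulr_ge0 ?(ltW eps0)//; lra.
have r0 : 0 <= (2 * reach w).+1%:R :> R by [].
split; first by rewrite /K; lra.
move=> A B s L beta KA AB KAs KBs KL HL.
have K1 : 1 <= K by rewrite /K; lra.
have K0 : 0 < K by lra.
have KD : D + 2 <= eps * (`|sg| * K).
  have : (D + 2) / (`|sg| * eps) <= K by rewrite /K; lra.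
  by rewrite ler_pdivrMr ?mulr_gt0//; lra.
have A0 : 0 < A%:R :> R by lra.
have wA : (2 * reach w < A)%N.
  by rewrite -(ler_nat R); apply: le_trans KA; rewrite /K; lra.
have B0 : 0 < B%:R :> R by apply: lt_le_trans A0 _; rewrite ler_nat.
have s0 : 0 < s by apply: lt_le_trans KBs; rewrite mulr_gt0// exprn_gt0.
pose S n : R := sin (s * logsum R v n + beta).
pose u (n : nat) : R := n%:R ^+ d.
have main : `|\sum_(A <= n < B) u n * (S n.+1 - S n)| <= 2 * B%:R ^+ d.
  apply: abel_bound => //; first by rewrite /u exprn_ge0.
    by move=> m n mn; rewrite /u lerXn2r ?nnegrE// ler_nat.
  by move=> n; rewrite ler_norml sin_geN1 sin_le1.
have termwise n : (A <= n)%N ->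
    `|cos (s * logsum R v n + beta) / n%:R - (s * sg)^-1 * (u n * (S n.+1 - S n))|
      <= D / (`|sg| * K) * n%:R^-1.
  move=> An; have n0 : 0 < n%:R :> R by apply: lt_le_trans A0 _; rewrite ler_nat.
  have Kn : K <= n%:R by apply: le_trans KA _; rewrite ler_nat.
  have Ksn : K * s <= n%:R ^+ d.+1.
    by apply: le_trans KAs _; rewrite lerXn2r ?nnegrE ?ler_nat.
  set th := s * logsum R v n + beta.
  set l := logsum R w n.
  have -> : S n.+1 = sin (th + s * l).
    by rewrite /S /th /l logsum_difference addn1 addn0; congr sin; ring.
  rewrite /S -/th /u.
  have := sin_taylor1 th (s * l); set e := sin (th + _) - _ - _ => eh.
  have -> : sin (th + s * l) - sin th = s * l * cos th + e by rewrite /e; ring.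
  have {}wC := wC n (leq_trans wA An).
  have nd0 : 0 < n%:R ^+ d :> R by rewrite exprn_gt0.
  have sgn : `|sg| != 0 by rewrite gt_eqF.
  have sgn0 : sg != 0 by rewrite -normr_eq0.
  rewrite -/l in wC.
  set N : R := n%:R ^+ d in nd0 *.
  have wC1 : `|l * n%:R * N - sg| <= C / n%:R.
    have -> : l * n%:R * N - sg = (l - (-1) ^+ d * (moment w d.+1)%:~R / (d.+1%:R * n%:R ^+ d.+1)) * (n%:R * N).
      by rewrite sgE /N exprS; field; rewrite ?gt_eqF//= nat1r pnatr_eq0.
    rewrite normrM (ger0_norm (_ : 0 <= n%:R * N)); last by rewrite mulr_ge0// ltW.
    rewrite -ler_pdivlMr ?mulr_gt0//; apply: le_trans wC _.
    by rewrite /N !exprS le_eqVlt; apply/orP; left; apply/eqP; field; rewrite !gt_eqF.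
  have CK : C / n%:R <= C / K by rewrite ler_wpM2l// lef_pV2 ?posrE.
  have CK1 : C / K <= C by rewrite ler_pdivrMr// ler_peMr.
  have lb : `|l * n%:R * N| <= `|sg| + C.
    have -> : l * n%:R * N = sg + (l * n%:R * N - sg) by ring.
    apply: le_trans (ler_normD _ _) _; lra.
  have -> : cos th / n%:R - (s * sg)^-1 * (N * (s * l * cos th + e)) =
     (- (l * n%:R * N - sg) * cos th / sg - n%:R * N * e / (s * sg)) * n%:R^-1.
    by field; rewrite sgn0 !gt_eqF.
  rewrite normrM (ger0_norm (_ : 0 <= n%:R^-1)) ?invr_ge0// ler_wpM2r ?invr_ge0//.
  have -> : D / (`|sg| * K) = C / K / `|sg| + (`|sg| + C) ^+ 2 / K / `|sg|.
    by rewrite /D; field; rewrite sgn gt_eqF.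
  apply: le_trans (ler_normB _ _) _; apply: lerD.
    rewrite !normrM normfV ler_wpM2r ?invr_ge0// normrN.
    rewrite -[leRHS]mulr1 ler_pM//; first exact: le_trans CK.
    by rewrite ler_norml cos_geN1 cos_le1.
  have -> : (`|sg| + C) ^+ 2 / K / `|sg| = ((`|sg| + C) ^+ 2 * s / K) / `|s * sg|.
    by rewrite normrM (gtr0_norm s0); field; rewrite sgn !gt_eqF.
  rewrite normrM normfV ler_wpM2r ?invr_ge0// normrM ger0_norm ?mulr_ge0 ?(ltW nd0)//.
  have e1 : `|e| * (n%:R * N) ^+ 2 <= (`|sg| + C) ^+ 2 * s ^+ 2.
    apply: (@le_trans _ _ ((s * l) ^+ 2 * (n%:R * N) ^+ 2)).
      by rewrite ler_wpM2r ?sqr_ge0.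
    have -> : (s * l) ^+ 2 * (n%:R * N) ^+ 2 = (l * n%:R * N) ^+ 2 * s ^+ 2 by ring.
    rewrite ler_wpM2r ?sqr_ge0// -[leLHS]ger0_norm ?sqr_ge0// normrX.
    by rewrite lerXn2r// nnegrE addr_ge0.
  rewrite -(ler_pM2r (_ : 0 < n%:R * N)); last by rewrite mulr_gt0.
  have -> : n%:R * N * `|e| * (n%:R * N) = `|e| * (n%:R * N) ^+ 2 by ring.
  apply: le_trans e1 _.
  have -> : (`|sg| + C) ^+ 2 * s ^+ 2 = (`|sg| + C) ^+ 2 * s / K * (K * s).
    by field; rewrite gt_eqF.
  rewrite ler_wpM2l//; last by rewrite -exprS.
  by rewrite divr_ge0 ?(ltW K0)// mulr_ge0 ?sqr_ge0// ltW.
have -> : osc v s beta A B = \sum_(A <= n < B)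
   (cos (s * logsum R v n + beta) / n%:R - (s * sg)^-1 * (u n * (S n.+1 - S n)))
   + (s * sg)^-1 * \sum_(A <= n < B) u n * (S n.+1 - S n).
  by rewrite mulr_sumr -big_split/=; apply: eq_bigr => n _; rewrite subrK.
apply: le_trans (ler_normD _ _) _.
have L1 : 1 <= L by lra.
have -> : eps * L = D / (`|sg| * K) * L + (eps - D / (`|sg| * K)) * L by ring.
apply: lerD.
  apply: le_trans (ler_norm_sum _ _ _) _.
  apply: (@le_trans _ _ (D / (`|sg| * K) * hsum A B)).
    rewrite /hsum mulr_sumr big_nat [leRHS]big_nat; apply: ler_sum => n /andP[An _].
    exact: termwise.
  by rewrite ler_wpM2l// divr_ge0// mulr_ge0// ltW.
apply: (@le_trans _ _ (2 / (`|sg| * K))).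
  rewrite normrM normfV normrM (gtr0_norm s0) mulrC ler_pdivrMr ?mulr_gt0//.
  apply: le_trans main _.
  have -> : 2 / (`|sg| * K) * (s * `|sg|) = 2 * (s / K) by field; rewrite !gt_eqF.
  by rewrite ler_wpM2l// ler_pdivlMr// mulrC.
have e2 : 2 / (`|sg| * K) <= eps - D / (`|sg| * K).
  rewrite lerBrDr -mulrDl ler_pdivrMr ?mulr_gt0//.
  by rewrite addrC.
apply: (le_trans e2); rewrite ler_peMr//.
by apply: le_trans e2; rewrite divr_ge0// mulr_ge0// ltW.
Qed.

End cancellation.

Section van_der_corput.
Context {R : realType}.
Implicit Types (v w : config) (s L beta eps K x y h : R) (A B : nat).

(** A unit shift of the index moves the variation onto the weights [1 / n], which
    telescope. *)
Lemma shift_sum_bound (a : nat -> R) A B l : (forall n, `|a n| <= 1) ->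
  (0 < A)%N ->
  `|\sum_(A <= n < B) a (n + l)%N / n%:R - \sum_(A <= n < B) a n / n%:R|
    <= (2 * l)%:R / A%:R.
Proof.
move=> a1 A0; elim: l => [|l IHl].
  under eq_bigr do rewrite addn0.
  by rewrite subrr normr0 muln0 mul0r.
suff H : `|\sum_(A <= n < B) a (n + l.+1)%N / n%:R -
           \sum_(A <= n < B) a (n + l)%N / n%:R| <= 2 / A%:R.
  rewrite mulnS natrD mulrDl; apply: le_trans (lerD H IHl).
  apply: le_trans (ler_normD _ _); rewrite le_eqVlt; apply/orP; left; apply/eqP.
  by congr `|_|; ring.
have [BA|AB] := leqP B A; first by rewrite !big_geq// subrr normr0 divr_ge0.
have a0 : 0 < A%:R :> R by rewrite ltr0n.
have wD n : (0 < n)%N -> `|a (n + l)%N / n%:R| <= n%:R^-1.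
  by move=> n0; rewrite normrM normfV normr_nat ler_piMl ?invr_ge0.
suff H : `|\sum_(A <= n < B) a (n + l.+1)%N / n%:R -
   \sum_(A <= n < B) a (n + l)%N / n%:R - a (B + l)%N / B%:R| <= 2 / A%:R - B%:R^-1.
  rewrite -[X in `|X|](subrK (a (B + l)%N / B%:R)).
  apply: le_trans (ler_normD _ _) _.
  by have := lerD H (wD B (leq_trans A0 (ltnW AB))); rewrite subrK.
move: AB => /ltnW; clear IHl; elim: B => [|B IHB]; first by rewrite leqNgt A0.
rewrite leq_eqVlt => /predU1P[<-|].
  rewrite !big_geq// subrr sub0r normrN; apply: le_trans (wD _ A0) _.
  by rewrite mulr_natl mulr2n addrK.
rewrite ltnS => AB; rewrite !big_nat_recr//=.
have B0 : (0 < B)%N := leq_trans A0 AB.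
have b0 : 0 < B%:R :> R by rewrite ltr0n.
set X := \sum_(A <= i < B) _ in IHB *; set Y := \sum_(A <= i < B) _ in IHB *.
have -> : X + a (B + l.+1)%N / B%:R - (Y + a (B + l)%N / B%:R) - a (B.+1 + l)%N / B.+1%:R
  = (X - Y - a (B + l)%N / B%:R) + a (B.+1 + l)%N * (B%:R^-1 - B.+1%:R^-1).
  by rewrite addnS addSn; ring.
apply: le_trans (ler_normD _ _) _.
have dB : 0 <= B%:R^-1 - B.+1%:R^-1 :> R.
  by rewrite subr_ge0 lef_pV2 ?posrE ?ltr0n// ler_nat.
have : `|a (B.+1 + l)%N * (B%:R^-1 - B.+1%:R^-1)| <= B%:R^-1 - B.+1%:R^-1.
  by rewrite normrM (ger0_norm dB) ler_piMl.
by move=> aB; have := lerD (IHB AB) aB; rewrite addrA subrK.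
Qed.

(** The right-hand side exceeds the left-hand side by the square of the sum of the
    sines. *)
Lemma sqr_sum_cos_le Q (t : 'I_Q -> R) :
  (\sum_i cos (t i)) ^+ 2 <= \sum_i \sum_j cos (t i - t j).
Proof.
have -> : \sum_i \sum_j cos (t i - t j) =
    (\sum_i cos (t i)) ^+ 2 + (\sum_i sin (t i)) ^+ 2.
  rewrite !expr2 !big_distrlr -big_split/=; apply: eq_bigr => i _.
  by rewrite -big_split/=; apply: eq_bigr => j _; rewrite cosB.
by rewrite lerDl sqr_ge0.
Qed.

(** The inequality behind the differencing step, in the Young form
    [2 |X| <= lam + X ^ 2 / lam] of Cauchy-Schwarz: averaging over [Q] shifts
    changes the sum by a boundary term only, and squaring the averaged phases
    leaves correlations between distinct shifts, apart from a diagonal that is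
    smaller by the factor [Q]. *)
Lemma van_der_corput (t : nat -> R) A B Q (lam L E : R) :
  (0 < A)%N -> (0 < Q)%N -> 0 < lam -> 0 <= E ->
  hsum A B <= L ->
  (forall l l', (l < Q)%N -> (l' < Q)%N -> l != l' ->
    `|\sum_(A <= n < B) cos (t (n + l)%N - t (n + l')%N) / n%:R| <= E) ->
  Q%:R * L + Q%:R ^+ 2 * E <= L * lam ^+ 2 ->
  Q%:R * `|\sum_(A <= n < B) cos (t n) / n%:R| <=
    (2 * Q ^ 2)%:R / A%:R + lam * L.
Proof.
move=> A0 Q0 lam0 E0 HL corr hlam.
pose X n : R := \sum_(l < Q) cos (t (n + l)%N).
pose T := \sum_(A <= n < B) X n / n%:R.
have cos1 x : `|cos x| <= 1 :> R by rewrite ler_norml cos_geN1 cos_le1.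
have TE : T = \sum_(l < Q) \sum_(A <= n < B) cos (t (n + l)%N) / n%:R.
  by rewrite /T exchange_big; apply: eq_bigr => n _; rewrite mulr_suml.
set S := \sum_(A <= n < B) cos (t n) / n%:R.
have TS : `|T - Q%:R * S| <= (2 * Q ^ 2)%:R / A%:R.
  have -> : Q%:R * S = \sum_(l < Q) S by rewrite sumr_const card_ord mulr_natl.
  rewrite TE -sumrB; apply: le_trans (ler_norm_sum _ _ _) _.
  have -> : (2 * Q ^ 2)%:R / A%:R = \sum_(l < Q) (2 * Q)%:R / A%:R :> R.
    by rewrite sumr_const card_ord -[RHS]mulr_natl mulrA -natrM; congr (_%:R / _); lia.
  apply: ler_sum => l _.
  apply: le_trans (@shift_sum_bound (fun n => cos (t n)) A B l _ A0) _ => //.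
  by rewrite ler_wpM2r ?invr_ge0// ler_nat leq_mul2l (ltnW (ltn_ord l)) orbT.
have P_le : \sum_(A <= n < B) X n ^+ 2 / n%:R <= L * lam ^+ 2.
  apply: le_trans hlam.
  apply: (@le_trans _ _ (\sum_(i < Q) \sum_(j < Q)
      \sum_(A <= n < B) cos (t (n + i)%N - t (n + j)%N) / n%:R)).
    have -> : \sum_(i < Q) \sum_(j < Q)
        \sum_(A <= n < B) cos (t (n + i)%N - t (n + j)%N) / n%:R =
      \sum_(A <= n < B) (\sum_(i < Q) \sum_(j < Q) cos (t (n + i)%N - t (n + j)%N)) / n%:R.
      under eq_bigr do rewrite exchange_big.
      rewrite exchange_big; apply: eq_bigr => n _ /=.
      by rewrite mulr_suml; apply: eq_bigr => i _; rewrite mulr_suml.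
    apply: ler_sum => n _; rewrite ler_wpM2r ?invr_ge0//.
    exact: sqr_sum_cos_le.
  have -> : Q%:R * L + Q%:R ^+ 2 * E = \sum_(i < Q) (L + Q%:R * E).
    by rewrite sumr_const card_ord -[RHS]mulr_natl; ring.
  apply: ler_sum => i _; rewrite (bigD1 i)//= lerD//.
    apply: le_trans HL; rewrite le_eqVlt; apply/orP; left; apply/eqP.
    by apply: eq_bigr => n _; rewrite subrr cos0 mul1r.
  apply: (@le_trans _ _ (\sum_(j < Q | j != i) E)).
    apply: ler_sum => j ji; apply: le_trans (ler_norm _) _.
    by apply: corr => //; rewrite eq_sym.
  rewrite sumr_const -[leLHS]mulr_natl.
  by rewrite ler_wpM2r// ler_nat (leq_trans (max_card _))// card_ord.
have T_le : `|T| <= lam * L.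
  apply: le_trans (ler_norm_sum _ _ _) _.
  apply: (@le_trans _ _ (\sum_(A <= n < B) (lam / 2 * n%:R^-1 + X n ^+ 2 / n%:R / (2 * lam)))).
    apply: ler_sum => n _; rewrite normrM (ger0_norm (_ : 0 <= n%:R^-1)) ?invr_ge0//.
    rewrite [X in _ + X]mulrAC -mulrDl ler_wpM2r ?invr_ge0//.
    have -> : lam / 2 + X n ^+ 2 / (2 * lam) =
      `|X n| + (lam - `|X n|) ^+ 2 / (2 * lam).
      by rewrite -(real_normK (num_real (X n))); field; rewrite gt_eqF.
    by rewrite lerDl divr_ge0 ?sqr_ge0// mulr_ge0// ltW.
  rewrite big_split/= -mulr_sumr -mulr_suml.
  have -> : lam * L = lam / 2 * L + L * lam ^+ 2 / (2 * lam).
    by field; rewrite gt_eqF.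
  rewrite lerD//; first by rewrite ler_wpM2l// divr_ge0// ltW.
  by rewrite ler_wpM2r// invr_ge0 mulr_ge0// ltW.
have -> : Q%:R * `|S| = `|Q%:R * S| by rewrite normrM normr_nat.
have -> : Q%:R * S = - (T - Q%:R * S) + T by ring.
by apply: le_trans (ler_normD _ _) _; rewrite normrN lerD.
Qed.

End van_der_corput.

Section piece.
Context {R : realType}.
Implicit Types (v w : config) (s L beta eps K x y h : R) (A B : nat).

(** Differencing: the shift differences of [v] have their first non-zero moment
    one step later, so that they cancel by hypothesis. *)
Lemma cancels_step d q v : moments_vanish q v -> moment v q != 0 ->
  (forall w, moments_vanish q.+1 w -> moment w q.+1 != 0 -> @cancels R d w) ->
  @cancels R d v.
Proof.
move=> vq vq0 IH eps eps0.
(* The diagonal terms weigh [1 / Q] relative to the square of the sum. *)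
pose Q := (Num.truncn (8 / eps ^+ 2)).+1.
have e20 : 0 < eps ^+ 2 by rewrite exprn_gt0.
have Q8 : 8 <= Q%:R * eps ^+ 2.
  rewrite -ler_pdivrMr//; apply/ltW/truncnS_gt.
have e8 : 0 < eps ^+ 2 / 8 by rewrite divr_gt0.
have /choice[Kf HKf] : forall p : nat * nat, exists K, 1 <= K /\
    (p.1 != p.2 -> forall A B s L beta, K <= A%:R -> (A <= B)%N ->
     K * s <= A%:R ^+ d.+1 -> K * B%:R ^+ d <= s -> K <= L -> hsum A B <= L ->
     `|osc (difference p.1 p.2 v) s beta A B| <= eps ^+ 2 / 8 * L).
  move=> [l l']; have [->|ll'] := eqVneq l l'; first by exists 1; split => //=; rewrite eqxx.
  have := IH (difference l l' v) (moments_vanish_difference l l' vq).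
  rewrite moment_difference// => /(_ _ _ e8)[|K [K1 HK]].
    by rewrite !mulf_neq0//= subr_eq0 eqz_nat.
  by exists K; split.
pose Ks := \sum_(l < Q) \sum_(l' < Q) Kf (l : nat, l' : nat).
have Kf0 p : 0 <= Kf p by have [] := HKf p; lra.
have KfKs l l' : (l < Q)%N -> (l' < Q)%N -> Kf (l, l') <= Ks.
  move=> lQ lQ'; rewrite /Ks (bigD1 (Ordinal lQ))//= (bigD1 (Ordinal lQ'))//=.
  by rewrite -addrA lerDl addr_ge0// ?sumr_ge0// => i _; rewrite ?sumr_ge0.
have Ks0 : 0 <= Ks by rewrite sumr_ge0// => i _; rewrite sumr_ge0.
have Q4 : 0 <= (4 * Q)%:R / eps by rewrite divr_ge0// ltW.
pose K := 1 + Ks + (4 * Q)%:R / eps.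
exists K; split; first by rewrite /K; lra.
move=> A B s L beta KA AB KAs KBs KL HL.
have KK l l' : (l < Q)%N -> (l' < Q)%N -> Kf (l, l') <= K.
  by move=> lQ lQ'; have := KfKs _ _ lQ lQ'; rewrite /K; lra.
have K1 : 1 <= K by rewrite /K; lra.
have A1 : 1 <= A%:R :> R by lra.
have A0 : (0 < A)%N by rewrite -(ltr_nat R); lra.
have s0 : 0 <= s by apply: le_trans KBs; rewrite mulr_ge0// ?exprn_ge0//; lra.
have Q0 : 0 < Q%:R :> R by rewrite ltr0n.
have L1 : 1 <= L by lra.
pose t n := s * logsum R v n + beta.
have HQ : Q%:R * `|osc v s beta A B| <=
    (2 * Q ^ 2)%:R / A%:R + Q%:R * eps / 2 * L.
  apply: (@van_der_corput R t A B Q (Q%:R * eps / 2) L (eps ^+ 2 / 8 * L)) => //.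
  - by rewrite divr_gt0// mulr_gt0.
  - by rewrite mulr_ge0// ltW//; lra.
  - move=> l l' lQ lQ' ll'.
    have [_ /(_ ll' A B s L 0)] := HKf (l, l'); rewrite /osc /=.
    under eq_bigr => n _.
      have -> : s * logsum R (difference l l' v) n + 0 = t (n + l)%N - t (n + l')%N.
        by rewrite logsum_difference /t; ring.
      over.
    have Kll := KK _ _ lQ lQ'; apply => //; try lra.
      by apply: le_trans KAs; rewrite ler_wpM2r.
    by apply: le_trans KBs; rewrite ler_wpM2r// exprn_ge0.
  - have -> : Q%:R * L + Q%:R ^+ 2 * (eps ^+ 2 / 8 * L) =
       L * (Q%:R * 8 / 8 + (Q%:R * eps) ^+ 2 / 8) by field.
    rewrite ler_wpM2l//; first by lra.
    have -> : (Q%:R * eps / 2) ^+ 2 = Q%:R * (Q%:R * eps ^+ 2) / 8 + (Q%:R * eps) ^+ 2 / 8 by field.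
    by rewrite lerD2r ler_wpM2r// ler_wpM2l// ltW.
rewrite -(ler_pM2l Q0); apply: (le_trans HQ).
have -> : Q%:R * (eps * L) = Q%:R * eps / 2 * L + Q%:R * eps / 2 * L by field.
rewrite lerD2r ler_pdivrMr; last by lra.
have KQ : (4 * Q)%:R / eps <= A%:R by apply: le_trans KA; rewrite /K lerDr addr_ge0.
have KQ' : (4 * Q)%:R <= eps * A%:R by move: KQ; rewrite ler_pdivrMr//; lra.
have -> : (2 * Q ^ 2)%:R = Q%:R / 2 * (4 * Q)%:R :> R by rewrite !natrM; field.
have -> : Q%:R * eps / 2 * L * A%:R = Q%:R / 2 * (L * (eps * A%:R)) by field.
rewrite ler_wpM2l ?divr_ge0//.
apply: (le_trans KQ'); rewrite ler_peMl// mulr_ge0//; first exact: ltW.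
Qed.

(** Descending induction on the order of the first non-zero moment, from [d] down
    by differencing. *)
Lemma cancels_le d q v : (q <= d)%N -> moments_vanish q v -> moment v q != 0 ->
  @cancels R d v.
Proof.
move=> qd; have [n] := ubnP (d - q); elim: n => // n IHn in q qd v *.
move=> dq vq vq0; move: qd; rewrite leq_eqVlt => /predU1P[qd|qd].
  by apply: cancels_base; rewrite -?qd.
apply: (cancels_step vq vq0) => w; apply: IHn => //; lia.
Qed.

Definition vanish_ind d v : R := `[< moments_vanish d v >]%:R.

Lemma vanish_ind_itv d v : 0 <= vanish_ind d v <= 1.
Proof. by rewrite /vanish_ind; case: `[< _ >]; rewrite ?lexx ler01. Qed.

(** Either some moment of order at most [d] is non-zero and the sum cancels, or
    the phase is at most a constant times [s / n ^ (d + 1)] away from [beta]. *)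
Lemma piece_margin d v eps : 0 < eps -> exists K, 1 <= K /\
  forall A B s L beta, K <= A%:R -> (A <= B)%N ->
    K * s <= A%:R ^+ d.+1 -> K * B%:R ^+ d <= s -> K <= L -> hsum A B <= L ->
  `|osc v s beta A B - vanish_ind d.+1 v * cos beta * hsum A B| <= eps * L.
Proof.
move=> eps0; rewrite /vanish_ind; case: asboolP => [vd|nvd]; last first.
  have /existsNP[q /not_implyP[qd /eqP vq0]] := nvd.
  have : exists q, (q <= d)%N && (moment v q != 0).
    by exists q; rewrite vq0 -ltnS qd.
  case/ex_minnP => q' /andP[q'd vq'] qmin.
  have [|K [K1 HK]] := @cancels_le d q' v q'd _ vq' eps eps0.
    move=> i iq; apply/eqP; apply/negPn/negP => vi.
    by have := qmin i; rewrite vi (leq_trans (ltnW iq) q'd) => /(_ isT); lia.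
  by exists K; split => // A B s L beta *; rewrite !mul0r subr0; exact: HK.
have [C [C0 vC]] := @logsum_asymptotics R v d vd.
set m := (-1) ^+ d * (moment v d.+1)%:~R in vC.
have Cm0 : 0 <= (`|m| + C) / eps by rewrite divr_ge0 ?addr_ge0// ltW.
pose K := 1 + (2 * reach v).+1%:R + (`|m| + C) / eps.
have r0 : 0 <= (2 * reach v).+1%:R :> R by [].
exists K; split; first by rewrite /K; lra.
move=> A B s L beta KA AB KAs KBs KL HL.
have K1 : 1 <= K by rewrite /K; lra.
have s0 : 0 <= s by apply: le_trans KBs; rewrite mulr_ge0// ?exprn_ge0//; lra.
have vA : (2 * reach v < A)%N.
  by rewrite -(ler_nat R); apply: le_trans KA; rewrite /K; lra.
have KC : `|m| + C <= eps * K.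
  have : (`|m| + C) / eps <= K by rewrite /K; lra.
  by rewrite ler_pdivrMr//; lra.
rewrite mul1r /hsum mulr_sumr /osc -sumrB.
apply: le_trans (ler_norm_sum _ _ _) _.
apply: (@le_trans _ _ (eps * hsum A B)); last by rewrite ler_wpM2l// ltW.
rewrite /hsum mulr_sumr big_nat [leRHS]big_nat; apply: ler_sum => n /andP[An _].
rewrite -mulrBl normrM (ger0_norm (_ : 0 <= n%:R^-1)) ?invr_ge0//.
rewrite ler_wpM2r ?invr_ge0//; apply: le_trans (cos_lipschitz _ _) _.
rewrite addrK normrM (ger0_norm s0).
have n1 : 1 <= n%:R :> R.
  by rewrite ler1n (leq_ltn_trans _ (leq_trans vA An)).
have n0 : 0 < n%:R :> R by lra.
have nd0 : 0 < n%:R ^+ d.+1 :> R by rewrite exprn_gt0.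
have Ksn : K * s <= n%:R ^+ d.+1.
  by apply: le_trans KAs _; rewrite lerXn2r ?nnegrE ?ler_nat.
have ls : `|logsum R v n| <= (`|m| + C) / n%:R ^+ d.+1.
  rewrite -[X in `|X|](subrK (m / (d.+1%:R * n%:R ^+ d.+1))).
  apply: le_trans (ler_normD _ _) _; rewrite addrC mulrDl; apply: lerD.
    rewrite normrM ler_wpM2l// normfV lef_pV2 ?posrE ?normr_gt0 ?mulf_neq0 ?pnatr_eq0 ?gt_eqF//.
    rewrite ger0_norm ?mulr_ge0 ?(ltW nd0)// ler_peMl ?(ltW nd0)//.
    by rewrite ler1n.
  apply: le_trans (vC n (leq_trans vA An)) _.
  rewrite ler_wpM2l// lef_pV2 ?posrE ?exprn_gt0// [leRHS]exprS ler_peMl// ltW.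
apply: (@le_trans _ _ (s * ((`|m| + C) / n%:R ^+ d.+1))); first by rewrite ler_wpM2l.
rewrite mulrA ler_pdivrMr//.
apply: (@le_trans _ _ (s * (eps * K))); first by rewrite ler_wpM2l.
have -> : s * (eps * K) = eps * (K * s) by ring.
by rewrite ler_wpM2l// ltW.
Qed.

Lemma norm_piece_le d v s beta A B :
  `|osc v s beta A B - vanish_ind d v * cos beta * hsum A B| <= 2 * hsum A B.
Proof.
apply: le_trans (ler_normB _ _) _; rewrite mulr_natl mulr2n.
apply: lerD; first exact: norm_osc_le.
rewrite normrM (ger0_norm (hsum_ge0 _ _)) ler_piMl ?hsum_ge0//.
have /andP[i0 i1] := vanish_ind_itv d v.
by rewrite normrM (ger0_norm i0) mulr_ile1// ler_norml cos_geN1 cos_le1.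
Qed.

(** The margins required for cancellation have bounded logarithmic size, hence
    can be absorbed. *)
Lemma piece_estimate d v eps : 0 < eps -> exists K, 1 <= K /\
  forall A B s L beta, K <= A%:R -> (A <= B)%N ->
    K <= s -> s <= A%:R ^+ d.+1 -> B.-1%:R ^+ d <= s -> K <= L -> hsum A B <= L ->
  `|osc v s beta A B - vanish_ind d.+1 v * cos beta * hsum A B| <= eps * L.
Proof.
move=> eps0; have e20 : 0 < eps / 2 by rewrite divr_gt0.
have [K [K1 HK]] := piece_margin d v e20.
have [Q [Q0 KQ]] : exists Q, (0 < Q)%N /\ K <= Q%:R.
  by exists (Num.truncn K).+1; split => //; apply/ltW/truncnS_gt.
have Q1 : 1 <= Q%:R :> R by rewrite ler1n.
have q0 : 0 <= (12 * Q ^ 2)%:R / eps by rewrite divr_ge0// ltW.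
exists (K + (12 * Q ^ 2)%:R / eps); split; first by lra.
move=> A B s L beta KA AB Ks sA Bs KL HL.
have L1 : 1 <= L by lra.
have QL : (12 * Q ^ 2)%:R <= eps * L.
  have : (12 * Q ^ 2)%:R / eps <= L by lra.
  by rewrite ler_pdivrMr// mulrC.
have A1 : (0 < A)%N by rewrite -(ltr_nat R); lra.
have Q12 : Q%:R <= (Q ^ 2)%:R :> R by rewrite ler_nat -mulnn leq_pmulr.
move: QL; rewrite natrM => QL.
(* In the interior the margins hold with the factor [Q]; the two collars have
   logarithmic length at most [Q] and [2 * Q]. *)
pose A' := (Q * A)%N; pose B' := (B.-1 %/ Q)%N.
have BQ : (B <= Q * B'.+1)%N.
  apply: leq_trans (leqSpred B) _; rewrite mulnC; exact: ltn_ceil.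
have [A'B'|B'A'] := leqP A' B'; last first.
  apply: le_trans (norm_piece_le _ _ _ _ _ _) _.
  suff : hsum A B <= (Q ^ 2)%:R :> R by have : 0 <= (Q^2)%:R :> R by []; lra.
  apply: hsum_le_ratio => //; rewrite -natrM ler_nat.
  have h : (B'.+1 <= Q * A)%N := B'A'.
  by rewrite (leq_trans BQ)// -mulnn -mulnA leq_mul2l h orbT.
have AA' : (A <= A')%N by rewrite /A' leq_pmull.
have B'B : (B' <= B)%N by rewrite (leq_trans (leq_div _ _))// leq_pred.
have -> : osc v s beta A B - vanish_ind d.+1 v * cos beta * hsum A B =
  (osc v s beta A A' - vanish_ind d.+1 v * cos beta * hsum A A') +
  (osc v s beta B' B - vanish_ind d.+1 v * cos beta * hsum B' B) +
  (osc v s beta A' B' - vanish_ind d.+1 v * cos beta * hsum A' B').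
  have ABA' : (A <= A' <= B)%N by rewrite AA' (leq_trans A'B').
  have AB'B : (A' <= B' <= B)%N by rewrite A'B'.
  by rewrite (osc_cat _ _ _ ABA') (osc_cat _ _ _ AB'B) (hsum_cat ABA') (hsum_cat AB'B); ring.
have h1 : hsum A A' <= Q%:R :> R by apply: hsum_le_ratio => //; rewrite /A' natrM.
have B'0 : (0 < B')%N by apply: leq_trans A'B'; rewrite /A' muln_gt0 Q0.
have h2 : hsum B' B <= 2 * Q%:R :> R.
  apply: hsum_le_ratio; rewrite ?mulr_ge0// -!natrM ler_nat; apply: leq_trans BQ _.
  by rewrite -mulnA [leqRHS]mulnCA leq_mul2l mul2n -addnn -addn1 leq_add2l B'0 orbT.
have h3 : hsum A' B' <= L.
  apply: le_trans HL; rewrite (hsum_cat (_ : A <= A' <= B)%N) ?AA' ?(leq_trans A'B')//.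
  rewrite (hsum_cat (_ : A' <= B' <= B)%N) ?A'B'//.
  by have := hsum_ge0 A A' : 0 <= _ :> R; have := hsum_ge0 B' B : 0 <= _ :> R; lra.
have -> : eps * L = 6 * Q%:R + (eps * L - 6 * Q%:R - eps / 2 * L) + eps / 2 * L by ring.
apply: le_trans (ler_normD _ _) _; apply: lerD; last first.
  apply: HK => //; try lra.
  - by apply: le_trans (_ : A%:R <= _); rewrite ?ler_nat//; lra.
  - rewrite /A' natrM exprMn; apply: ler_pM => //; try lra.
    by apply: le_trans KQ _; rewrite exprS ler_peMr// exprn_ege1.
  - have [->|d0] := posnP d; first by rewrite expr0 mulr1; lra.
    apply: le_trans Bs; apply: (@le_trans _ _ ((Q * B')%:R ^+ d)).
      rewrite natrM exprMn ler_wpM2r ?exprn_ge0//; apply: le_trans KQ _.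
      by rewrite -(prednK d0) exprS ler_peMr// exprn_ege1.
    by rewrite lerXn2r ?nnegrE// ler_nat mulnC leq_trunc_div.
apply: le_trans (ler_normD _ _) _.
have := norm_piece_le d.+1 v s beta A A'; have := norm_piece_le d.+1 v s beta B' B.
lra.
Qed.

End piece.

(** * Logarithmic averages up to a root of the frequency *)

Section log_average.
Context {R : realType}.
Implicit Types (v w : config) (s L beta eps K x y h : R) (A B : nat).

Lemma hsum1_bounds x : 1 <= x ->
  ln x <= hsum 1 (Num.truncn x).+1 <= 1 + ln x.
Proof.
move=> x1; have x0 : 0 < x by apply: lt_le_trans x1.
have step n : (0 < n)%N ->
    n.+1%:R^-1 <= ln (n.+1%:R : R) - ln n%:R <= n%:R^-1.
  move=> n0; have nR : 0 < n%:R :> R by rewrite ltr0n.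
  have n1R : 0 < n.+1%:R :> R by rewrite ltr0n.
  apply/andP; split.
    rewrite -opprB lerNr -ln_div ?posrE//.
    have -> : n%:R / n.+1%:R = 1 + - n.+1%:R^-1 :> R.
      by rewrite -natr1; field; rewrite natr1 gt_eqF.
    apply: le_ln1Dx; rewrite ltrN2 invf_lt1// ltr1n ltnS//.
  rewrite -ln_div ?posrE//.
  have -> : n.+1%:R / n%:R = 1 + n%:R^-1 :> R.
    by rewrite -natr1; field; rewrite gt_eqF.
  by apply: le_ln1Dx; apply: lt_trans (_ : 0 < _); rewrite ?invr_gt0// ltrN10.
have upper N : (0 < N)%N -> hsum 1 N.+1 <= 1 + ln (N%:R : R).
  elim: N => // -[|N] IHN _; first by rewrite /hsum big_nat1 invr1 ln1 addr0.
  rewrite /hsum big_nat_recr//=; have /andP[h _] := step N.+1 isT.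
  by have := IHN isT; rewrite /hsum; move: h; set X := \sum_(_ <= _ < _) _; set z := N.+2%:R^-1; lra.
have lower N : ln (N.+1%:R : R) <= hsum 1 N.+1.
  elim: N => [|N IHN]; first by rewrite ln1 /hsum big_geq.
  rewrite /hsum big_nat_recr//=; have /andP[_ h] := step N.+1 isT.
  by move: IHN h; rewrite /hsum; set X := \sum_(_ <= _ < _) _; set z := N.+1%:R^-1; lra.
have tx : (0 < Num.truncn x)%N by rewrite Num.Theory.truncn_gt0.
apply/andP; split.
  apply: le_trans (lower _); rewrite ler_ln ?posrE ?ltr0n//.
  exact/ltW/Num.Theory.truncnS_gt.
apply: le_trans (upper _ tx) _; rewrite lerD2l ler_ln ?posrE ?ltr0n//.
by rewrite Num.Theory.truncn_le ltW.
Qed.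

(** The successor is there because the sums exclude their upper bound: they run
    up to the integral part of [s ^ (1 / u)]. *)
Definition cutoff s (u : R) : nat := (Num.truncn (s `^ u^-1)).+1.

Lemma hsum_cutoff s u : 1 <= s -> 0 < u ->
  `|hsum 1 (cutoff s u) - ln s / u| <= 1.
Proof.
move=> s1 u0; have su : 1 <= s `^ u^-1.
  by rewrite -(powRr0 s) ler_powR// invr_ge0 ltW.
have := hsum1_bounds su; rewrite ln_powR mulrC -/(cutoff s u).
by rewrite ler_norml; set X := hsum _ _; set Y := ln s / u; lra.
Qed.

Lemma cutoff_le s u u' : 1 <= s -> 0 < u -> u <= u' ->
  (cutoff s u' <= cutoff s u)%N.
Proof.
move=> s1 u0 uu'; rewrite ltnS Num.Theory.le_truncn// ler_powR//.
by rewrite lef_pV2 ?posrE// (lt_le_trans u0).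
Qed.

Lemma cutoff_gt0 s u : (0 < cutoff s u)%N. Proof. by []. Qed.

Lemma cutoff_lower s (d k : nat) : 1 <= s -> (0 < d <= k)%N ->
  s <= (cutoff s d%:R)%:R ^+ k.
Proof.
move=> s1 /andP[d0 dk]; have s0 : 0 <= s by lra.
have d0R : d%:R != 0 :> R by rewrite pnatr_eq0 -lt0n.
rewrite -(subnKC dk) exprD -[leLHS]mulr1; apply: ler_pM => //; last first.
  by rewrite exprn_ege1// ler1n.
have sE : (s `^ d%:R^-1) ^+ d = s.
  by rewrite -powR_mulrn ?powR_ge0// -powRrM mulVf// powRr1.
rewrite -[leLHS]sE lerXn2r ?nnegrE ?powR_ge0//.
exact/ltW/Num.Theory.truncnS_gt.
Qed.

Lemma cutoff_upper s u (k : nat) : 1 <= s -> 0 < u -> k%:R <= u ->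
  (cutoff s u).-1%:R ^+ k <= s.
Proof.
move=> s1 u0 ku; have s0 : 0 <= s by lra.
apply: (@le_trans _ _ ((s `^ u^-1) ^+ k)).
  by rewrite lerXn2r ?nnegrE ?powR_ge0//= Num.Theory.truncn_le powR_ge0.
rewrite -powR_mulrn ?powR_ge0// -powRrM -[leRHS](powRr1 s0) ler_powR//.
by rewrite mulrC ler_pdivrMr// mul1r.
Qed.

Lemma cutoff_large u K : 0 < u -> exists S0, forall s, S0 <= s ->
  1 <= s /\ K <= hsum 1 (cutoff s u) /\ K <= (cutoff s u)%:R.
Proof.
move=> u0; exists (expR (u * (1 + `|K|))) => s sS.
have e1 : 1 <= expR (u * (1 + `|K|)).
  by rewrite -[leLHS]expR0 ler_expR mulr_ge0 ?addr_ge0// ltW.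
have s1 : 1 <= s by apply: le_trans sS.
have lns : 1 + `|K| <= ln s / u.
  rewrite ler_pdivlMr// mulrC -[leLHS]expRK ler_ln ?posrE ?expR_gt0//.
  exact: lt_le_trans s1.
have KK : K <= `|K| by exact: ler_norm.
have hK : K <= hsum 1 (cutoff s u).
  by have := hsum_cutoff s1 u0; rewrite ler_norml; set X := hsum _ _; set Y := ln s / u in lns *; lra.
split => //; split => //; apply: (le_trans hK).
by apply: hsum_le_ratio; rewrite // mulr1.
Qed.

End log_average.

Section assembly.
Context {R : realType}.
Implicit Types (v w : config) (c s L beta eps K x y h : R) (A B : nat).

Lemma hsum_cutoff_le c u s : 1 <= s -> 0 < c -> c <= u ->
  hsum 1 (cutoff s u) <= hsum 1 (cutoff s c) :> R.
Proof.
move=> s1 c0 cu; rewrite (@hsum_cat _ 1 (cutoff s u) (cutoff s c)).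
  by rewrite lerDl hsum_ge0.
by rewrite cutoff_gt0 cutoff_le.
Qed.

(** The harmonic sum up to [s ^ (1 / u)] is [ln s / u] up to a bounded error, so
    the range between two roots carries a fixed proportion of the total. The upper
    end [u] is real, as it may be [c] itself. *)
Lemma osc_between c (k d : nat) (u : R) v eps : 0 < c -> c <= u ->
  u <= k%:R -> (k <= d.+1)%N -> d%:R <= u -> 0 < eps ->
  exists S0, forall s, S0 <= s -> forall beta,
  `|osc v s beta (cutoff s k%:R) (cutoff s u) -
    c * (u^-1 - k%:R^-1) * vanish_ind d.+1 v * cos beta * hsum 1 (cutoff s c)|
   <= eps * hsum 1 (cutoff s c).
Proof.
move=> c0 cu uk kd du eps0.
have u0 : 0 < u by apply: lt_le_trans cu.
have k0 : 0 < k%:R :> R by apply: lt_le_trans uk.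
have e20 : 0 < eps / 2 by rewrite divr_gt0.
have [K [K1 HK]] := @piece_estimate R d v _ e20.
have [S1 HS1] := cutoff_large K k0.
have [S2 HS2] := cutoff_large (K + 6 / eps) c0.
have e60 : 0 <= 6 / eps by rewrite divr_ge0// ltW.
exists (`|S1| + `|S2| + K) => s sS beta.
have S1s : S1 <= s by have := ler_norm S1; have := normr_ge0 S2; lra.
have S2s : S2 <= s by have := ler_norm S2; have := normr_ge0 S1; lra.
have Ks : K <= s by have := normr_ge0 S2; have := normr_ge0 S1; lra.
have [s1 [_ KA]] := HS1 s S1s; have [_ [KL _]] := HS2 s S2s.
set L := hsum 1 (cutoff s c) in KL *.
set A := cutoff s k%:R in KA *; set B := cutoff s u.
have AB : (A <= B)%N by rewrite cutoff_le.
have hAB : hsum A B = hsum 1 B - hsum 1 A :> R.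
  by rewrite (@hsum_cat _ 1 A B) ?AB ?cutoff_gt0// addrAC subrr add0r.
have hAL : hsum A B <= L.
  rewrite hAB; have := @hsum_cutoff_le c u s s1 c0 cu.
  by have := @hsum_ge0 R 1 A; rewrite -/L -/B; lra.
have KL' : K <= L by lra.
have sA : s <= A%:R ^+ d.+1 by apply: cutoff_lower; rewrite // kd -(ltr_nat R) k0.
have Bs : B.-1%:R ^+ d <= s by apply: cutoff_upper.
have main := HK A B s L beta KA AB Ks sA Bs KL' hAL.
set W := c * (u^-1 - k%:R^-1).
have W01 : 0 <= W <= 1.
  have ku : k%:R^-1 <= u^-1 by rewrite lef_pV2 ?posrE.
  rewrite /W mulr_ge0 ?(ltW c0) ?subr_ge0//=.
  apply: (@le_trans _ _ (c / u)); last by rewrite ler_pdivrMr// mul1r.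
  by rewrite ler_wpM2l ?(ltW c0)// gerBl invr_ge0 ltW.
have hW : `|hsum A B - W * L| <= 3.
  have hA := hsum_cutoff s1 k0; have hB := hsum_cutoff s1 u0.
  have hL := hsum_cutoff s1 c0; rewrite -/A -/B -/L in hA hB hL.
  have -> : hsum A B - W * L = (hsum 1 B - ln s / u) - (hsum 1 A - ln s / k%:R)
      - W * (L - ln s / c).
    by rewrite hAB /W; field; rewrite !gt_eqF.
  apply: le_trans (ler_normB _ _) _.
  have hW : `|W * (L - ln s / c)| <= 1.
    by case/andP: W01 => W0 W1; rewrite normrM (ger0_norm W0) mulr_ile1.
  apply: (@le_trans _ _ ((1 + 1) + 1)); last by lra.
  by apply: lerD => //; apply: le_trans (ler_normB _ _) _; apply: lerD.
have -> : osc v s beta A B - W * vanish_ind d.+1 v * cos beta * L =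
  (osc v s beta A B - vanish_ind d.+1 v * cos beta * hsum A B) +
  vanish_ind d.+1 v * cos beta * (hsum A B - W * L) by ring.
apply: le_trans (ler_normD _ _) _.
have -> : eps * L = eps / 2 * L + eps / 2 * L by field.
apply: lerD => //; apply: (@le_trans _ _ (1 * 3)).
  rewrite normrM ler_pM//.
  have /andP[i0 i1] := vanish_ind_itv (R := R) d.+1 v.
  by rewrite normrM (ger0_norm i0) mulr_ile1// ler_norml cos_geN1 cos_le1.
have : 6 / eps <= L by lra.
by rewrite ler_pdivrMr// mul1r; lra.
Qed.

(** The contribution to the average of the monomial [v] of the indices above the
    root of order [D] of [s]: first the incomplete range, from the root of order
    [ceiln c] to [s ^ (1 / c)], then the complete ones. *)
Definition mass c (D : nat) v : R :=
  (1 - c / (ceiln c)%:R) * vanish_ind (floorn c).+1 v +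
  c * \sum_(ceiln c <= d < D) (d%:R^-1 - d.+1%:R^-1) * vanish_ind d.+1 v.

Lemma ceiln_gt0 c : 0 < c -> (0 < ceiln c)%N.
Proof. by move=> c0; rewrite /ceiln absz_gt0 gt_eqF// Num.Theory.ceil_gt0. Qed.

Lemma le_ceiln c : 0 < c -> c <= (ceiln c)%:R.
Proof.
move=> c0; rewrite /ceiln natr_absz ger0_norm ?Num.Theory.ceil_ge//.
by rewrite ltW// Num.Theory.ceil_gt0.
Qed.

Lemma floorn_le c : 0 < c -> (floorn c)%:R <= c.
Proof. by move=> /ltW c0; rewrite Num.Theory.truncn_le. Qed.

Lemma ceiln_le_floornS c : 0 < c -> (ceiln c <= (floorn c).+1)%N.
Proof.
move=> c0; have h : Num.ceil c <= (floorn c).+1%:Z.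
  rewrite Num.Theory.ceil_le_int; exact/ltW/Num.Theory.truncnS_gt.
by rewrite -lez_nat /ceiln gez0_abs// ltW// Num.Theory.ceil_gt0.
Qed.

Lemma osc_mass c (D : nat) v eps : 0 < c -> (ceiln c <= D)%N -> 0 < eps ->
  exists S0, forall s, S0 <= s -> forall beta,
  `|osc v s beta (cutoff s D%:R) (cutoff s c) -
    mass c D v * cos beta * hsum 1 (cutoff s c)| <= eps * hsum 1 (cutoff s c).
Proof.
move=> c0; elim: D eps => [|D IHD] eps; first by rewrite leqNgt ceiln_gt0.
rewrite leq_eqVlt => /predU1P[<-|].
  rewrite /mass big_geq// mulr0 addr0 => eps0.
  have -> : 1 - c / (ceiln c)%:R = c * (c^-1 - (ceiln c)%:R^-1).
    by field; rewrite pnatr_eq0 -lt0n ceiln_gt0//= gt_eqF.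
  by apply: osc_between; rewrite ?le_ceiln ?ceiln_le_floornS ?floorn_le.
rewrite ltnS => cD eps0; have e20 : 0 < eps / 2 by rewrite divr_gt0.
have [S1 H1] := IHD _ cD e20.
have cDR : c <= D%:R by apply: le_trans (le_ceiln c0) _; rewrite ler_nat.
have D0 : 0 < D%:R :> R by apply: lt_le_trans cDR.
have [||S2 H2] := @osc_between c D.+1 D D%:R v _ c0 cDR _ (leqnn _) _ e20.
- by rewrite ler_nat.
- by [].
exists (`|S1| + `|S2| + 1) => s sS beta.
have S1s : S1 <= s by have := ler_norm S1; have := normr_ge0 S2; lra.
have S2s : S2 <= s by have := ler_norm S2; have := normr_ge0 S1; lra.
have s1 : 1 <= s by have := normr_ge0 S2; have := normr_ge0 S1; lra.
have {}H1 := H1 s S1s beta; have {}H2 := H2 s S2s beta.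
rewrite (@osc_cat _ v s beta _ (cutoff s D%:R)); last first.
  by rewrite !cutoff_le// ler_nat.
set L := hsum 1 _ in H1 H2 *.
rewrite {1}/mass big_nat_recr//=.
have -> : eps * L = eps / 2 * L + eps / 2 * L by field.
apply: le_trans (lerD H2 H1); apply: le_trans (ler_normD _ _).
rewrite le_eqVlt; apply/orP; left; apply/eqP; congr `|_|.
by rewrite /mass; ring.
Qed.

Lemma mass_incr c v (D D' : nat) : 0 < c -> (ceiln c <= D <= D')%N ->
  0 <= mass c D' v - mass c D v <= c * (D%:R^-1 - D'%:R^-1).
Proof.
move=> c0 /andP[cD]; elim: D' => [|D' IHD'].
  by rewrite leqn0 => /eqP ->; rewrite !subrr mulr0 lexx.
rewrite leq_eqVlt => /predU1P[<-|]; first by rewrite !subrr mulr0 lexx.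
rewrite ltnS => DD'; have {IHD'} := IHD' DD'.
have massS : mass c D'.+1 v = mass c D' v +
    c * ((D'%:R^-1 - D'.+1%:R^-1) * vanish_ind D'.+1 v).
  by rewrite /mass big_nat_recr ?(leq_trans cD)//= mulrDr addrA.
have D'0 : (0 < D')%N by apply: leq_trans DD'; apply: leq_trans cD; exact: ceiln_gt0.
have dd : 0 <= D'%:R^-1 - D'.+1%:R^-1 :> R.
  by rewrite subr_ge0 lef_pV2 ?posrE ?ltr0n// ler_nat.
have /andP[i0 i1] := vanish_ind_itv (R := R) D'.+1 v.
have h0 : 0 <= c * ((D'%:R^-1 - D'.+1%:R^-1) * vanish_ind D'.+1 v).
  by rewrite mulr_ge0 ?(ltW c0)// mulr_ge0.
have h1 : c * ((D'%:R^-1 - D'.+1%:R^-1) * vanish_ind D'.+1 v) <=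
    c * (D'%:R^-1 - D'.+1%:R^-1).
  by rewrite ler_wpM2l ?(ltW c0)// ler_piMr.
rewrite massS; move: h0 h1; set z := c * (_ * vanish_ind _ _).
rewrite !mulrBr; set y2 := c / D'%:R; set y3 := c / D'.+1%:R.
set y4 := c / D%:R; set y7 := mass _ _ _; set y8 := mass _ _ _.
by move=> h0 h1 /andP[h2 h3]; apply/andP; split; lra.
Qed.

Lemma mass_cvg c v : 0 < c -> cvgn (fun D => mass c D v).
Proof.
move=> c0; have H D D' := @mass_incr c v D D' c0.
apply: (@near_nondecreasing_is_cvgn _ _ (mass c (ceiln c) v + c * (ceiln c)%:R^-1)).
  near=> m => n mn; have cm : (ceiln c <= m <= n)%N.
    by rewrite mn andbT; near: m; exact: nbhs_infty_ge.
  by have /andP[+ _] := H m n cm; rewrite subr_ge0.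
near=> n; have cn : (ceiln c <= ceiln c <= n)%N.
  by rewrite leqnn; near: n; exact: nbhs_infty_ge.
have /andP[_] := H _ _ cn.
rewrite mulrBr lerBlDl => h; apply: (le_trans h).
by rewrite lerD2l gerBl mulr_ge0 ?(ltW c0).
Unshelve. all: by end_near. Qed.

(** Both the limit of the logarithmic averages of the monomial [v] and its
    integral in the model. *)
Definition total_mass c v : R := limn (fun D => mass c D v).

Lemma total_mass_approx c v D : 0 < c -> (ceiln c <= D)%N ->
  `|total_mass c v - mass c D v| <= c / D%:R.
Proof.
move=> c0 cD.
have near_mass : \forall n \near \oo, 0 <= mass c n v - mass c D v <= c * (D%:R^-1 - n%:R^-1).
  near=> n; apply: mass_incr => //; rewrite cD /=.
  by near: n; exact: nbhs_infty_ge.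
have lo : mass c D v <= total_mass c v.
  apply: limr_ge; first exact: mass_cvg.
  near=> n; rewrite -subr_ge0.
  have /andP[//] : 0 <= mass c n v - mass c D v <= c * (D%:R^-1 - n%:R^-1).
  by near: n.
have up : total_mass c v <= mass c D v + c / D%:R.
  apply: limr_le; first exact: mass_cvg.
  near=> n; have : 0 <= mass c n v - mass c D v <= c * (D%:R^-1 - n%:R^-1).
    by near: n.
  move=> /andP[_]; rewrite mulrBr lerBlDl => h; apply: (le_trans h).
  by rewrite lerD2l gerBl mulr_ge0 ?(ltW c0).
by rewrite ger0_norm ?subr_ge0// lerBlDl.
Unshelve. all: by end_near. Qed.

End assembly.

Section osc_limit.
Context {R : realType}.

(** The whole logarithmic average: the terms below the [D]-th root of [s] carry
    a proportion at most [c / D] of the logarithmic mass. *)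
Lemma osc_limit (c : R) (v : config) (eps : R) : 0 < c -> 0 < eps ->
  exists S0, forall s, S0 <= s -> forall beta,
  `|osc v s beta 1 (cutoff s c) -
    total_mass c v * cos beta * hsum 1 (cutoff s c)| <= eps * hsum 1 (cutoff s c).
Proof.
move=> c0 eps0; have e80 : 0 < eps / 8 by rewrite divr_gt0.
have [D [cD cDe]] : exists D, (ceiln c <= D)%N /\ c / D%:R <= eps / 8.
  exists (ceiln c + (Num.truncn (c / (eps / 8))).+1)%N; split; first exact: leq_addr.
  rewrite ler_pdivrMr ?ltr0n ?addnS// mulrC -ler_pdivrMr//.
  apply: le_trans (ltW (Num.Theory.truncnS_gt _)) _.
  by rewrite ler_nat ltnS leq_addl.
have D0 : 0 < D%:R :> R by rewrite ltr0n (leq_trans (ceiln_gt0 c0)).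
have e40 : 0 < eps / 4 by rewrite divr_gt0.
have [S1 H1] := osc_mass v c0 cD e40.
have [S2 H2] := cutoff_large (8 * (1 + eps / 8) / eps) c0.
exists (`|S1| + `|S2|) => s sS beta.
have S1s : S1 <= s by have := ler_norm S1; have := normr_ge0 S2; lra.
have S2s : S2 <= s by have := ler_norm S2; have := normr_ge0 S1; lra.
have {}H1 := H1 s S1s beta; have [s1 [KL _]] := H2 s S2s.
have cDR : c <= D%:R by apply: le_trans (le_ceiln c0) _; rewrite ler_nat.
rewrite (@osc_cat _ v s beta 1 (cutoff s D%:R)); last by rewrite cutoff_gt0 cutoff_le.
have hL := hsum_cutoff s1 c0; have hD := hsum_cutoff s1 D0.
set L := hsum 1 (cutoff s c) in H1 KL hL *.
have L0 : 0 <= L by exact: hsum_ge0.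
have KL' : 1 + eps / 8 <= eps / 8 * L.
  move: KL; rewrite ler_pdivrMr//.
  by move=> h; rewrite -(ler_pM2l (_ : 0 < 8 :> R))//; apply: (le_trans h); lra.
have h1 : `|osc v s beta 1 (cutoff s D%:R)| <= eps / 4 * L.
  apply: le_trans (norm_osc_le _ _ _ _ _) _.
  have lnD : hsum 1 (cutoff s D%:R) <= 1 + ln s / D%:R.
    by move: hD; rewrite ler_norml; set X := hsum _ _; set Y := ln s / _; lra.
  have lnL : ln s <= c * (L + 1).
    by rewrite -ler_pdivrMl// mulrC; move: hL; rewrite ler_norml; set Y := ln s / _; lra.
  apply: (le_trans lnD).
  have : ln s / D%:R <= eps / 8 * (L + 1).
    apply: (@le_trans _ _ (c / D%:R * (L + 1))).
      by rewrite mulrAC ler_wpM2r ?invr_ge0// ltW.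
    by rewrite ler_wpM2r//; lra.
  by set Y := ln s / _; lra.
have h3 : `|(mass c D v - total_mass c v) * cos beta * L| <= eps / 8 * L.
  rewrite normrM (ger0_norm L0) ler_wpM2r// normrM -[leRHS]mulr1.
  apply: ler_pM => //; last by rewrite ler_norml cos_geN1 cos_le1.
  by rewrite distrC; apply: le_trans (total_mass_approx v c0 cD) _.
set o1 := osc _ _ _ _ _ in h1 *; set o2 := osc _ _ _ _ _ in H1 *.
have -> : o1 + o2 - total_mass c v * cos beta * L =
  o1 + (o2 - mass c D v * cos beta * L) + (mass c D v - total_mass c v) * cos beta * L.
  by ring.
apply: le_trans (ler_normD _ _) _; have := ler_normD o1 (o2 - mass c D v * cos beta * L).
have : 0 <= eps * L by rewrite mulr_ge0// ltW.
by move: h1 H1 h3; set x1 := `|o1|; set x2 := `|o2 - _|; set x3 := `|_ * L|; lra.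
Qed.

End osc_limit.

(** * Unimodular multiplicative functions close on primes *)

Section unimodular.
Context {R : realType}.
Implicit Types (a b : R) (z w : R[i]).

(** The modulus as an element of [R]; the norm of [R[i]] has values in [R[i]]. *)
Definition cabs z : R := complex.Re `|z|.

Lemma cabsE z : `|z| = (cabs z)%:C.
Proof. by rewrite /cabs normc_def. Qed.

Lemma cabs_ge0 z : 0 <= cabs z.
Proof. by rewrite -ler0c -cabsE normr_ge0. Qed.

Lemma cabsM z w : cabs (z * w) = cabs z * cabs w.
Proof. by apply/complexI; rewrite rmorphM/= -!cabsE normrM. Qed.

Lemma cabsD z w : cabs (z + w) <= cabs z + cabs w.
Proof. by rewrite -lecR rmorphD/= -!cabsE ler_normD. Qed.

Lemma cabs_norm1 z : `|z| = 1 -> cabs z = 1.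
Proof. by rewrite /cabs => ->. Qed.

Lemma cabs0 : cabs 0 = 0 :> R. Proof. by rewrite /cabs normr0. Qed.

Lemma cabsJ z : cabs z^* = cabs z.
Proof. by rewrite /cabs !normc_def; case: z => x y /=; rewrite sqrrN. Qed.

Lemma Re_le_cabs z : `|complex.Re z| <= cabs z.
Proof.
rewrite /cabs normc_def/= -[leLHS]sqrtr_sqr ler_sqrt ?addr_ge0 ?sqr_ge0//.
by rewrite lerDl sqr_ge0.
Qed.

Lemma Im_le_cabs z : `|complex.Im z| <= cabs z.
Proof.
rewrite /cabs normc_def/= -[leLHS]sqrtr_sqr ler_sqrt ?addr_ge0 ?sqr_ge0//.
by rewrite lerDr sqr_ge0.
Qed.

Lemma expiD a b : expi (a + b) = expi a * expi b :> R[i].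
Proof. by rewrite /expi cosD sinD; apply/eqP; rewrite eq_complex/= eqxx addrC mulrC eqxx. Qed.

Lemma expi0 : expi 0 = 1 :> R[i].
Proof. by rewrite /expi cos0 sin0. Qed.

Lemma expiJ a : (expi a)^* = expi (- a) :> R[i].
Proof. by rewrite /expi cosN sinN. Qed.

Lemma norm_expi a : `|expi a| = 1 :> R[i].
Proof. by rewrite normc_def/= cos2Dsin2 sqrtr1. Qed.

Lemma cabs_expi a : cabs (expi a) = 1.
Proof. exact/cabs_norm1/norm_expi. Qed.

Lemma npowiM (m n : nat) (s : int) : (0 < m)%N -> (0 < n)%N ->
  npowi R (m * n) s = npowi R m s * npowi R n s.
Proof.
by move=> m0 n0; rewrite /npowi -expiD -mulrDr natrM lnM// posrE ltr0n.
Qed.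

End unimodular.

Section prime_factors.
Context {R : realType}.

Lemma sum_dvdn (G : nat -> R) (p M : nat) : (0 < p)%N ->
  \sum_(1 <= n < M.+1) (if (p %| n)%N then G n else 0) =
  \sum_(1 <= m < (M %/ p).+1) G (p * m)%N.
Proof.
move=> p0; elim: M => [|M IHM]; first by rewrite div0n !big_geq.
rewrite big_nat_recr//= IHM divnS//; case: ifPn => pM; last by rewrite addr0.
rewrite add1n [RHS]big_nat_recr//=; congr (_ + G _).
by rewrite -[X in (_ * X)%N]add1n -[1%N in RHS]/(nat_of_bool true) -pM -divnS// mulnC divnK.
Qed.

(** Extracting one factor [p] from the multiples of [p] bounds the sum up to [M]
    by [1 / p] times the sum of the harmonic sum and of the same sum up to [M / p];
    as [2 / p <= 1], the bound propagates. *)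
Lemma sum_logn_le (p M : nat) : prime p ->
  \sum_(1 <= n < M.+1) (logn p n)%:R / n%:R <= hsum 1 M.+1 :> R.
Proof.
move=> pp; have p0 := prime_gt0 pp; have p1 := prime_gt1 pp.
have pR : 0 < p%:R :> R by rewrite ltr0n.
elim/ltn_ind: M => -[|M] IHM; first by rewrite /hsum !big_geq.
have -> : \sum_(1 <= n < M.+2) (logn p n)%:R / n%:R =
  \sum_(1 <= n < M.+2) (if (p %| n)%N then (logn p n)%:R / n%:R else 0 : R).
  apply: eq_bigr => n _; case: ifPn => // pn.
  by rewrite lognE (negbTE pn) !andbF mul0r.
rewrite sum_dvdn//.
have -> : \sum_(1 <= m < (M.+1 %/ p).+1) (logn p (p * m))%:R / (p * m)%:R =
   p%:R^-1 * (hsum 1 (M.+1 %/ p).+1 +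
     \sum_(1 <= m < (M.+1 %/ p).+1) (logn p m)%:R / m%:R) :> R.
  rewrite /hsum -big_split/= mulr_sumr big_nat [RHS]big_nat; apply: eq_bigr => m /andP[m0 _] /=.
  rewrite lognM// logn_prime// eqxx natrD natrM mulr1n; field.
  by rewrite !gt_eqF ?ltr0n.
rewrite ler_pdivrMl//.
have h1 : hsum 1 (M.+1 %/ p).+1 <= hsum 1 M.+2 :> R.
  rewrite (@hsum_cat _ 1 (M.+1 %/ p).+1 M.+2) ?lerDl ?hsum_ge0//=.
  by rewrite !ltnS leq_div.
have h2 := IHM (M.+1 %/ p)%N (ltn_Pdiv p1 (ltn0Sn M)).
apply: (@le_trans _ _ (2 * hsum 1 M.+2)); first by rewrite mulr_natl mulr2n lerD// (le_trans h2).
by rewrite ler_wpM2r ?hsum_ge0// ler_nat.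
Qed.

(** As both functions are unimodular, the errors at the prime factors add up, and
    the primes above [T] contribute nothing. *)
Lemma mult_close (f g : nat -> R[i]) (T P : nat) (delta : R) :
  (forall n, (0 < n)%N -> `|f n| = 1) -> (forall n, (0 < n)%N -> `|g n| = 1) ->
  completely_multiplicative f -> completely_multiplicative g -> 0 <= delta ->
  (forall p, prime p -> (T < p <= P)%N -> f p = g p) ->
  (forall p, prime p -> (p <= T)%N -> cabs (f p - g p) <= delta) ->
  forall n, (0 < n <= P)%N ->
  cabs (f n - g n) <= (\sum_(p < T.+1 | prime p) logn p n)%:R * delta.
Proof.
move=> f1 g1 fM gM d0 big small.
have one h : (forall n, (0 < n)%N -> `|h n| = 1) ->
    completely_multiplicative h -> h 1%N = 1 :> R[i].
  move=> h1 hM; have h0 : h 1%N != 0 by rewrite -normr_eq0 h1// oner_eq0.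
  by apply: (mulfI h0); rewrite mulr1 -hM.
elim/ltn_ind => n IHn /andP[n0 nP]; have [n1|n1] := leqP n 1.
  have -> : n = 1%N by lia.
  by rewrite !one// subrr cabs0 mulr_ge0.
have pp := pdiv_prime n1; set p := pdiv n in pp.
have nE : n = (p * (n %/ p))%N by rewrite mulnC divnK ?pdiv_dvd.
have m0 : (0 < n %/ p)%N by move: n0; rewrite {1}nE muln_gt0 => /andP[].
have mn : (n %/ p < n)%N by rewrite ltn_Pdiv// prime_gt1.
have p0 := prime_gt0 pp.
rewrite nE fM// gM//; move: (n %/ p)%N m0 mn => m m0 mn in nE *.
have -> : f p * f m - g p * g m = (f p - g p) * f m + g p * (f m - g m) by ring.
apply: le_trans (cabsD _ _) _; rewrite !cabsM !(cabs_norm1 (f1 _ _))// !(cabs_norm1 (g1 _ _))//.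
rewrite mul1r mulr1.
have -> : (\sum_(q < T.+1 | prime q) logn q (p * m) =
   \sum_(q < T.+1 | prime q) logn q p + \sum_(q < T.+1 | prime q) logn q m)%N.
  by rewrite -big_split; apply: eq_bigr => q _ /=; rewrite lognM.
rewrite natrD mulrDl lerD//; last by apply: IHn => //; rewrite m0 (leq_trans (ltnW mn)).
have pn : (p <= n)%N by rewrite nE leq_pmulr.
have [pT|Tp] := leqP p T; last by rewrite big ?Tp ?(leq_trans pn)// subrr cabs0 mulr_ge0.
apply: (le_trans (small p pp pT)); rewrite ler_peMl// ler1n.
have pT1 : (p < T.+1)%N by [].
by rewrite (bigD1 (Ordinal pT1))//= logn_prime// eqxx.
Qed.

(** Each of the at most [T] primes up to [T] divides an integer at most once on
    logarithmic average, and costs [T ^ (- 2)] each time. *)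
Lemma log_average_close (f g : nat -> R[i]) (T P M : nat) :
  (forall n, (0 < n)%N -> `|f n| = 1) -> (forall n, (0 < n)%N -> `|g n| = 1) ->
  completely_multiplicative f -> completely_multiplicative g -> (0 < T)%N ->
  (forall p, prime p -> (T < p <= P)%N -> f p = g p) ->
  (forall p, prime p -> (p <= T)%N -> cabs (f p - g p) <= (T ^ 2)%:R^-1) ->
  (M <= P)%N ->
  \sum_(1 <= n < M.+1) cabs (f n - g n) / n%:R <= 2 / T%:R * hsum 1 M.+1.
Proof.
move=> f1 g1 fM gM T0 big small MP.
have d0 : 0 <= (T ^ 2)%:R^-1 :> R by rewrite invr_ge0.
have close := mult_close f1 g1 fM gM d0 big small.
apply: (@le_trans _ _ (\sum_(1 <= n < M.+1)
    ((\sum_(p < T.+1 | prime p) logn p n)%:R * (T ^ 2)%:R^-1) / n%:R)).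
  rewrite big_nat [leRHS]big_nat; apply: ler_sum => n /andP[n0 nM].
  by rewrite ler_wpM2r ?invr_ge0// close// n0 /= -ltnS (leq_trans nM).
have -> : \sum_(1 <= n < M.+1) ((\sum_(p < T.+1 | prime p) logn p n)%:R * (T ^ 2)%:R^-1) / n%:R
   = (T ^ 2)%:R^-1 * \sum_(p < T.+1 | prime p) \sum_(1 <= n < M.+1) (logn p n)%:R / n%:R :> R.
  rewrite exchange_big mulr_sumr; apply: eq_bigr => n _ /=.
  by rewrite natr_sum -mulr_suml mulrAC mulrC mulrA.
apply: (@le_trans _ _ ((T ^ 2)%:R^-1 * \sum_(p < T.+1 | prime p) hsum 1 M.+1)).
  by rewrite ler_wpM2l//; apply: ler_sum => p pp; exact: sum_logn_le.
have TR : 0 < T%:R :> R by rewrite ltr0n.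
have -> : 2 / T%:R * hsum 1 M.+1 = (T ^ 2)%:R^-1 * ((2 * T)%:R * hsum 1 M.+1) :> R.
  by rewrite natrX natrM; field; rewrite gt_eqF.
rewrite ler_wpM2l// sumr_const -[leLHS]mulr_natl ler_wpM2r ?hsum_ge0// ler_nat.
by apply: leq_trans (max_card _) _; rewrite card_ord; lia.
Qed.

End prime_factors.

(** * The topology of the sequence space *)

Section topology_of_seqspace.
Context {R : realType}.
Local Notation X := (seqspace R).

Lemma continuous_complex :
  continuous (fun p : R * R => (p.1 +i* p.2 : R[i]^o)).
Proof.
move=> [a b]; apply/cvgrPdist_lt => /= e e0.
have eE : e = (complex.Re e)%:C by rewrite RRe_real// gtr0_real.
have Re0 : 0 < complex.Re e by rewrite -ltcR -eE.
have e20 : 0 < complex.Re e / 2 by rewrite divr_gt0.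
near=> p.
rewrite eE [`|_ : R[i]^o|]cabsE ltcR.
have -> : a +i* b - (p.1 +i* p.2) = (a - p.1)%:C + (b - p.2) *i.
  by apply/eqP; rewrite eq_complex/= addr0 add0r !eqxx.
apply: le_lt_trans (cabsD _ _) _.
have -> : cabs ((a - p.1)%:C) = `|a - p.1|.
  by rewrite /cabs normc_def/= expr0n/= addr0 sqrtr_sqr.
have -> : cabs ((b - p.2) *i) = `|b - p.2|.
  by rewrite /cabs normc_def/= expr0n/= add0r sqrtr_sqr.
rewrite (splitr (complex.Re e)); apply: ltrD.
- near: p; suff : p.1 @[p --> (a, b)] --> a by move=> /cvgrPdist_lt/(_ _ e20).
  exact: cvg_fst.
- near: p; suff : p.2 @[p --> (a, b)] --> b by move=> /cvgrPdist_lt/(_ _ e20).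
  exact: cvg_snd.
Unshelve. all: by end_near. Qed.

Lemma continuous_Re : continuous (fun z : R[i]^o => complex.Re z).
Proof.
move=> z.
apply/(@cvgrPdist_lt _ _ _ (nbhs (z : R[i]^o)) (nbhs_filter _)) => e e0; near=> w.
rewrite -raddfB/=; apply: le_lt_trans (Re_le_cabs _) _.
rewrite -ltcR -cabsE; near: w.
by apply: (@nbhsx_ballx _ (R[i]^o) z e%:C); rewrite ltcR.
Unshelve. all: by end_near. Qed.

Lemma continuous_Im : continuous (fun z : R[i]^o => complex.Im z).
Proof.
move=> z.
apply/(@cvgrPdist_lt _ _ _ (nbhs (z : R[i]^o)) (nbhs_filter _)) => e e0; near=> w.
rewrite -raddfB/=; apply: le_lt_trans (Im_le_cabs _) _.
rewrite -ltcR -cabsE; near: w.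
by apply: (@nbhsx_ballx _ (R[i]^o) z e%:C); rewrite ltcR.
Unshelve. all: by end_near. Qed.

Lemma unit_disc_cabs (z : R[i]^o) : unit_disc z <-> cabs z <= 1.
Proof. by rewrite /unit_disc/= -lecR -cabsE. Qed.

Lemma compact_unit_disc : compact (@unit_disc R).
Proof.
pose B := [set p : R * R | p.1 ^+ 2 + p.2 ^+ 2 <= 1].
have -> : @unit_disc R = (fun p : R * R => (p.1 +i* p.2 : R[i]^o)) @` B.
  have H (a b : R) : cabs (a +i* b) <= 1 <-> a ^+ 2 + b ^+ 2 <= 1.
    rewrite /cabs normc_def/=; split => [h|h].
      rewrite -(sqr_sqrtr (_ : 0 <= a ^+ 2 + b ^+ 2)) ?addr_ge0 ?sqr_ge0//.
      by rewrite expr_le1// sqrtr_ge0.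
    by rewrite -[leRHS]sqrtr1 ler_wsqrtr.
  apply/seteqP; split => [[a b] /unit_disc_cabs/H h|_ [[a b] h <-]].
    by exists (a, b).
  exact/unit_disc_cabs/H.
apply: continuous_compact.
  by apply: continuous_subspaceT; exact: continuous_complex.
have box : compact ((`[-1, 1]%classic `*` `[-1, 1]%classic) : set (R * R)).
  by apply: compact_setX; exact: segment_compact.
apply: (subclosed_compact _ box).
- rewrite (_ : B = (fun p : R * R => p.1 * p.1 + p.2 * p.2) @^-1` [set x | x <= 1]); last first.
    by apply/funext => p; rewrite /B/= !expr2.
  apply: closed_comp; last exact: closed_le.
  by move=> p _; apply: cvgD; apply: cvgM; (exact: cvg_fst || exact: cvg_snd).
- move=> [a b] /= ab; rewrite /B/= in ab; rewrite !in_itv/= -!ler_norml.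
  have a0 := sqr_ge0 a; have b0 := sqr_ge0 b.
  by split; rewrite -(@expr_le1 _ 2)// real_normK ?num_real//; lra.
Qed.

Lemma compact_set_type_unit_disc : compact [set: set_type (@unit_disc R)].
Proof.
move=> F FF _; pose G := (set_val : _ -> R[i]^o) @ F.
have GD : G (@unit_disc R).
  apply: (@filterS _ F _ setT); last exact: filterT.
  by move=> [z zD] _; exact: set_mem.
have [z [Dz Gz]] := compact_unit_disc _ GD.
exists (exist _ z (mem_set Dz)); split => // A B FA.
rewrite nbhsE/=; case=> O [ [V oV <-] Vz] OB.
have [_ [ [w Aw <-] Vw]] : (((set_val : _ -> R[i]^o) @` A) `&` V) !=set0.
  apply: Gz; last exact: open_nbhs_nbhs.
  by apply: (@filterS _ F _ A) => // w Aw; exists w.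
by exists w; split => //; exact: OB.
Qed.

Lemma compact_seqspace : compact [set: X].
Proof.
have := @tychonoff int (fun=> set_type (@unit_disc R)) (fun=> setT)
  (fun=> compact_set_type_unit_disc).
by congr compact; apply/seteqP; split.
Qed.

End topology_of_seqspace.

Lemma continuous_dist1 (R : realType) (T : topologicalType) (a b : R)
    (f g : T -> R) : continuous f -> continuous g ->
  continuous (fun y => `|a - f y| + `|b - g y|).
Proof.
move=> cf cg y; apply: cvgD; apply: cvg_norm; apply: cvgB; (exact: cvg_cst ||
  exact: cf || exact: cg).
Qed.

Section windows.
Context {R : realType}.
Local Notation X := (seqspace R).
Implicit Types (x y : X) (k : int) (L : nat).

Definition re_coord k x : R := complex.Re (seq_coord x k).
Definition im_coord k x : R := complex.Im (seq_coord x k).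

Lemma continuous_seq_coord k : continuous (fun x : X => seq_coord x k : R[i]^o).
Proof.
have h : continuous (fun x : X => (x k : set_type (@unit_disc R))).
  exact: (@proj_continuous int (fun=> set_type (@unit_disc R)) k).
move=> x; apply: (@continuous_comp X (set_type (@unit_disc R)) (R[i]^o)
  (fun x : X => x k) set_val x); first exact: h.
exact: initial_continuous.
Qed.

Lemma continuous_re_coord k : continuous (re_coord k).
Proof.
move=> x; apply: (@continuous_comp X (R[i]^o) R (fun x : X => seq_coord x k)
  (fun z => complex.Re z) x); first exact: continuous_seq_coord.
exact: continuous_Re.
Qed.

Lemma continuous_im_coord k : continuous (im_coord k).
Proof.
move=> x; apply: (@continuous_comp X (R[i]^o) R (fun x : X => seq_coord x k)
  (fun z => complex.Im z) x); first exact: continuous_seq_coord.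
exact: continuous_Im.
Qed.

Lemma coordP x y : (forall k, re_coord k x = re_coord k y) ->
  (forall k, im_coord k x = im_coord k y) -> x = y.
Proof.
move=> hre him; apply/funext => k; apply/val_inj.
apply/eqP; rewrite (eq_complex (seq_coord x k) (seq_coord y k)).
by rewrite [_ == _](introT eqP (hre k)) [_ == _](introT eqP (him k)).
Qed.

Definition window_term x y k : R :=
  `|re_coord k x - re_coord k y| + `|im_coord k x - im_coord k y|.

Definition window_dist L x y : R :=
  \sum_(i < (2 * L).+1) window_term x y (i%:Z - L%:Z).

Lemma window_term_ge0 x y k : 0 <= window_term x y k.
Proof. by rewrite addr_ge0. Qed.

Lemma window_dist_ge0 L x y : 0 <= window_dist L x y.
Proof. by apply: sumr_ge0 => i _; exact: window_term_ge0. Qed.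

Lemma window_dist_refl L x : window_dist L x x = 0.
Proof. by apply: big1 => i _; rewrite /window_term !subrr normr0 addr0. Qed.

Lemma window_dist_sym L x y : window_dist L x y = window_dist L y x.
Proof.
by apply: eq_bigr => i _; rewrite /window_term distrC [X in _ + X]distrC.
Qed.

Lemma window_dist_triangle L x y z :
  window_dist L x z <= window_dist L x y + window_dist L y z.
Proof.
rewrite -big_split; apply: ler_sum => i _; rewrite /window_term /=.
rewrite [leRHS]addrACA; apply: lerD.
  by apply: le_trans (ler_normD _ _); rewrite addrA subrK.
by apply: le_trans (ler_normD _ _); rewrite addrA subrK.
Qed.

Lemma window_term_le L x y k : (`|k| <= L)%N ->
  window_term x y k <= window_dist L x y.
Proof.
move=> kL; have h : (`|(k + L%:Z)%R| < (2 * L).+1)%N by lia.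
rewrite /window_dist (bigD1 (Ordinal h))//= gez0_abs; last by lia.
by rewrite addrK lerDl sumr_ge0// => i _; exact: window_term_ge0.
Qed.

Lemma window_dist_mono L L' x y : (L <= L')%N ->
  window_dist L x y <= window_dist L' x y.
Proof.
move=> LL'; rewrite /window_dist.
pose h i := window_term x y (i%:Z - L'%:Z).
rewrite -(big_mkord predT (fun i => window_term x y (i%:Z - L%:Z))).
rewrite -(big_mkord predT h) /=.
have -> : \sum_(0 <= i < (2 * L).+1) window_term x y (i%:Z - L%:Z) =
    \sum_(L' - L <= i < (L' - L) + (2 * L).+1) h i.
  rewrite -{1}[(L' - L)%N]add0n big_addn addnC addnK; apply: eq_bigr => i _.
  by rewrite /h; congr window_term; lia.
rewrite [leRHS](@big_cat_nat _ _ _ (L' - L))//=; last by lia.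
rewrite [X in _ + X](@big_cat_nat _ _ _ ((L' - L) + (2 * L).+1))/=; try lia.
rewrite -[leLHS]add0r lerD ?sumr_ge0// => [i _|]; first exact: window_term_ge0.
by rewrite lerDl sumr_ge0// => i _; exact: window_term_ge0.
Qed.

Lemma continuous_window_dist L x : continuous (window_dist L x).
Proof.
have -> : window_dist L x = fun y =>
    \sum_(i < (2 * L).+1) window_term x y (i%:Z - L%:Z) by [].
apply: continuous_big => [|i _]; first exact: add_continuous.
by apply: continuous_dist1; [exact: continuous_re_coord|exact: continuous_im_coord].
Qed.

(** By compactness, neighbourhoods in the product topology are controlled by
    finitely many coordinates. *)
Lemma window_nbhs (U : set X) x : open U -> U x ->
  exists L, exists2 e, 0 < e & forall y, window_dist L x y < e -> U y.
Proof.
move=> oU Ux; apply: contrapT => H.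
have /choice[u Hu] : forall n : nat, exists y,
    window_dist n x y < n.+1%:R^-1 /\ ~ U y.
  move=> n; apply: contrapT => Hn; apply: H; exists n, n.+1%:R^-1.
    by rewrite invr_gt0 ltr0n.
  by move=> y yn; apply: contrapT => Uy; apply: Hn; exists y.
have [y [_ yu]] := @compact_seqspace R (u @ \oo) _ filterT.
have u_close L e : 0 < e -> \forall n \near \oo, window_dist L x (u n) <= e.
  move=> e0; near=> n; have [un _] := Hu n.
  apply: le_trans (window_dist_mono _ _ (_ : (L <= n)%N)) _.
    by near: n; exact: nbhs_infty_ge.
  apply/ltW/(lt_trans un); near: n; exact: near_infty_natSinv_lt (PosNum e0).
have close L e : 0 < e -> window_dist L x y <= e.
  move=> e0; rewrite leNgt; apply/negP => ey.
  have [z [/= ze]] : ([set z | window_dist L x z <= e] `&`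
     [set z | e < window_dist L x z]) !=set0; last by rewrite ltNge ze.
  apply: yu; first exact: u_close.
  by have := @continuous_window_dist L x y _ (lt_nbhsr ey).
have xy : x = y.
  have z k : window_term x y k = 0.
    apply/eqP; rewrite eq_le window_term_ge0 andbT; apply/ler_addgt0Pr => e e0; rewrite add0r.
    exact: le_trans (window_term_le _ _ (leqnn _)) (close _ _ e0).
  apply: coordP => k; have := z k; rewrite /window_term => /eqP.
    by rewrite paddr_eq0// => /andP[/eqP/normr0P/eqP/subr0_eq].
  by rewrite paddr_eq0// => /andP[_ /eqP/normr0P/eqP/subr0_eq].
have [z [/= Uz nUz]] : (~` U `&` U) !=set0; last by [].
apply: yu; last by rewrite -xy; exact: open_nbhs_nbhs.
by exists 0%N => // n _ /=; have [] := Hu n.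
Unshelve. all: by end_near. Qed.

End windows.

(** * Uniform approximation by trigonometric polynomials *)

Section polynomials.
Context {R : realType}.
Local Notation X := (seqspace R).
Implicit Types (x y : X) (v w : config) (g h : X -> R).

Definition coord_factor x (p : int * bool) : R[i] :=
  if p.2 then (seq_coord x p.1)^* else seq_coord x p.1.

Definition monomial v x : R[i] := \prod_(p <- v) coord_factor x p.

Definition trig_poly : Type := seq (R[i] * config).

Definition tp_eval (s : trig_poly) x : R[i] :=
  \sum_(q <- s) q.1 * monomial q.2 x.

Definition tp_conj (s : trig_poly) : trig_poly :=
  [seq (q.1^*, opposite q.2) | q <- s].

Definition tp_mul (s t : trig_poly) : trig_poly :=
  [seq (q.1 * r.1, q.2 ++ r.2) | q <- s, r <- t].

Lemma monomial_cat v w x : monomial (v ++ w) x = monomial v x * monomial w x.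
Proof. by rewrite /monomial big_cat. Qed.

Lemma monomial_opposite v x : monomial (opposite v) x = (monomial v x)^*.
Proof.
rewrite /monomial big_map rmorph_prod; apply: eq_bigr => -[k b] _.
by rewrite /coord_factor/=; case: b; rewrite /= ?conjcK.
Qed.

Lemma tp_eval_cat s t x : tp_eval (s ++ t) x = tp_eval s x + tp_eval t x.
Proof. by rewrite /tp_eval big_cat. Qed.

Lemma tp_eval_conj s x : tp_eval (tp_conj s) x = (tp_eval s x)^*.
Proof.
rewrite /tp_eval big_map rmorph_sum; apply: eq_bigr => q _.
by rewrite /= monomial_opposite rmorphM.
Qed.

Lemma tp_eval_mul s t x : tp_eval (tp_mul s t) x = tp_eval s x * tp_eval t x.
Proof.
rewrite /tp_eval /tp_mul big_allpairs_dep big_distrl/=; apply: eq_bigr => q _.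
by rewrite big_distrr; apply: eq_bigr => r _; rewrite monomial_cat mulrACA.
Qed.

Lemma seq_coord_cabs x k : cabs (seq_coord x k) <= 1.
Proof. by apply/unit_disc_cabs; have := set_mem (valP (x k)). Qed.

Lemma monomial_cabs v x : cabs (monomial v x) <= 1.
Proof.
rewrite /monomial; elim: v => [|p v IHv].
  by rewrite big_nil /cabs normr1.
rewrite big_cons cabsM mulr_ile1 ?cabs_ge0//.
by rewrite /coord_factor; case: p.2; rewrite ?cabsJ seq_coord_cabs.
Qed.

Lemma tp_eval_bounded s : exists M, forall x, cabs (tp_eval s x) <= M.
Proof.
exists (\sum_(q <- s) cabs q.1) => x; rewrite /tp_eval.
elim: s => [|q s IHs]; first by rewrite !big_nil cabs0.
rewrite !big_cons; apply: le_trans (cabsD _ _) _; rewrite lerD// cabsM.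
by rewrite ler_piMr ?cabs_ge0// monomial_cabs.
Qed.

Definition approximable g : Prop := forall eps, 0 < eps ->
  exists s, forall x, `|g x - complex.Re (tp_eval s x)| <= eps.

Lemma approximable_bounded g : approximable g ->
  exists2 M, 0 < M & forall x, `|g x| <= M.
Proof.
move=> /(_ 1 ltr01)[s Hs]; have [M HM] := tp_eval_bounded s.
exists (1 + `|M|); first by rewrite ltr_pwDl.
move=> x; rewrite -(subrK (complex.Re (tp_eval s x)) (g x)).
apply: le_trans (ler_normD _ _) _; rewrite lerD//.
by apply: le_trans (Re_le_cabs _) _; apply: le_trans (HM x) (ler_norm _).
Qed.

Lemma approximable_limit g : (forall eps, 0 < eps -> exists h,
  approximable h /\ forall x, `|g x - h x| <= eps) -> approximable g.
Proof.
move=> H eps eps0; have e20 : 0 < eps / 2 by rewrite divr_gt0.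
have [h [/(_ _ e20)[s Hs] gh]] := H _ e20; exists s => x.
rewrite -(subrK (h x) (g x)) -addrA (splitr eps).
by apply: le_trans (ler_normD _ _) _; rewrite lerD.
Qed.

Lemma approximable_cst (r : R) : approximable (fun=> r).
Proof.
move=> eps eps0; exists [:: (r%:C, [::])] => x.
by rewrite /tp_eval big_seq1 /monomial big_nil mulr1 subrr normr0 ltW.
Qed.

Lemma approximable_add g h : approximable g -> approximable h ->
  approximable (fun x => g x + h x).
Proof.
move=> ag ah eps eps0; have e20 : 0 < eps / 2 by rewrite divr_gt0.
have [s Hs] := ag _ e20; have [t Ht] := ah _ e20.
exists (s ++ t) => x; rewrite tp_eval_cat raddfD/= opprD addrACA (splitr eps).
by apply: le_trans (ler_normD _ _) _; rewrite lerD.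
Qed.

(** The product of two real parts is the real part of [z * (w + conj w) / 2],
    which is a trigonometric polynomial when [z] and [w] are. *)
Lemma approximable_mul g h : approximable g -> approximable h ->
  approximable (fun x => g x * h x).
Proof.
move=> ag ah eps eps0.
have [M M0 HM] := approximable_bounded ag.
have [N N0 HN] := approximable_bounded ah.
pose d := Num.min 1 (eps / (M + N + 1)).
have MN : 0 < M + N + 1 by lra.
have d0 : 0 < d by rewrite lt_min ltr01 divr_gt0.
have d1 : d <= 1 by rewrite ge_min lexx.
have dE : d * (M + N + 1) <= eps.
  by rewrite -ler_pdivlMr// ge_min lexx orbT.
have [s Hs] := ag _ d0; have [t Ht] := ah _ d0.
pose half : trig_poly := [:: ((2^-1)%:C, [::])].
exists (tp_mul half (tp_mul s (t ++ tp_conj t))) => x.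
have -> : complex.Re (tp_eval (tp_mul half (tp_mul s (t ++ tp_conj t))) x) =
    complex.Re (tp_eval s x) * complex.Re (tp_eval t x).
  rewrite !tp_eval_mul tp_eval_cat tp_eval_conj {1}/tp_eval big_seq1 /monomial big_nil.
  rewrite mulr1; case: (tp_eval s x) => a b; case: (tp_eval t x) => a' b' /=.
  by field.
set a := complex.Re _; set b := complex.Re _.
have ha : `|g x - a| <= d by exact: Hs.
have hb : `|h x - b| <= d by exact: Ht.
have -> : g x * h x - a * b = (g x - a) * h x + (g x - (g x - a)) * (h x - b) by ring.
apply: le_trans dE; apply: le_trans (ler_normD _ _) _; rewrite !normrM.
have h1 : `|g x - a| * `|h x| <= d * N by rewrite ler_pM.
have h2 : `|g x - (g x - a)| * `|h x - b| <= (M + 1) * d.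
  rewrite ler_pM//; apply: le_trans (ler_normB _ _) _.
  by rewrite lerD// (le_trans ha).
by lra.
Qed.

Lemma approximable_scale (r : R) g : approximable g ->
  approximable (fun x => r * g x).
Proof. by apply: approximable_mul; exact: approximable_cst. Qed.

Lemma approximable_sub g h : approximable g -> approximable h ->
  approximable (fun x => g x - h x).
Proof.
move=> ag ah; rewrite (_ : (fun x => _) = fun x => g x + (-1) * h x).
  by apply: approximable_add => //; exact: approximable_scale.
by apply/funext => x; rewrite mulN1r.
Qed.

Lemma approximable_sum (I : Type) (r : seq I) (F : I -> X -> R) :
  (forall i, approximable (F i)) -> approximable (fun x => \sum_(i <- r) F i x).
Proof.
move=> aF; elim: r => [|i r IHr].
  rewrite (_ : (fun x => _) = fun=> 0); first exact: approximable_cst.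
  by apply/funext => x; rewrite big_nil.
rewrite (_ : (fun x => _) = fun x => F i x + \sum_(j <- r) F j x).
  exact: approximable_add.
by apply/funext => x; rewrite big_cons.
Qed.

Lemma approximable_re_coord k : approximable (re_coord k).
Proof.
move=> eps eps0; exists [:: (1, [:: (k, false)])] => x.
by rewrite /tp_eval big_seq1 /monomial big_seq1 mul1r subrr normr0 ltW.
Qed.

Lemma approximable_im_coord k : approximable (im_coord k).
Proof.
move=> eps eps0; exists [:: (0 -i* 1, [:: (k, false)])] => x.
rewrite /tp_eval big_seq1 /monomial big_seq1 /coord_factor /= /im_coord.
by case: (seq_coord x k) => a b /=; rewrite mul0r mulN1r opprK add0r subrr normr0 ltW.
Qed.

(** Polynomials in [u ^ 2] converging to [|u|] uniformly on [[-1, 1]]: Newton's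
    iteration for the square root. *)
Fixpoint abs_iter (n : nat) (u : R) : R :=
  if n is m.+1 then abs_iter m u + (u ^+ 2 - abs_iter m u ^+ 2) / 2 else 0.

Lemma abs_iterP n u : `|u| <= 1 ->
  0 <= abs_iter n u <= `|u| /\ `|u| - abs_iter n u <= 2 / n.+2%:R.
Proof.
move=> u1; have u0 := normr_ge0 u.
elim: n => [|n [/andP[p0 pu] IH]] /=; first by split; rewrite ?lexx ?u0//; lra.
rewrite -(real_normK (num_real u)); set a := `|u| in u0 u1 pu IH *.
set p := abs_iter n u in p0 pu IH *.
have E : a - (p + (a ^+ 2 - p ^+ 2) / 2) = (a - p) * (1 - (a + p) / 2) by field.
have e0 : 0 <= a - p by lra.
have f0 : 0 <= 1 - (a + p) / 2 by lra.
split.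
  rewrite -subr_ge0 -[X in _ && X]subr_ge0 subr0 E mulr_ge0// andbT addr_ge0// divr_ge0//.
  by rewrite subr_ge0 lerXn2r.
rewrite E; set e := a - p in e0 IH *.
apply: (@le_trans _ _ (e * (1 - e / 2))).
  by rewrite ler_wpM2l// /e; lra.
have n2 : 0 < n.+2%:R :> R by rewrite ltr0n.
have n3 : 0 < n.+3%:R :> R by rewrite ltr0n.
apply: (@le_trans _ _ (2 / n.+2%:R * (1 - 2 / n.+2%:R / 2))).
  rewrite -subr_ge0.
  have -> : 2 / n.+2%:R * (1 - 2 / n.+2%:R / 2) - e * (1 - e / 2) =
    (2 / n.+2%:R - e) * (1 - (2 / n.+2%:R + e) / 2) by field; rewrite gt_eqF.
  rewrite mulr_ge0 ?subr_ge0//.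
  have : 2 / n.+2%:R <= 1 :> R by rewrite ler_pdivrMr// mul1r ler_nat.
  by move: IH; set y := 2 / _; lra.
have -> : 2 / n.+2%:R * (1 - 2 / n.+2%:R / 2) = 2 * n.+1%:R / (n.+2%:R ^+ 2) :> R.
  have n2E : n.+2%:R = n.+1%:R + 1 :> R by rewrite natr1.
  have n0 : 0 <= n%:R :> R by [].
  by rewrite n2E; field; rewrite gt_eqF//; lra.
rewrite ler_pdivrMr ?exprn_gt0// mulrAC ler_pdivlMr// -!natrX -!natrM ler_nat.
by rewrite -!mulnA leq_mul2l /= expnS expn1; nia.
Qed.

Lemma approximable_abs g : approximable g -> approximable (fun x => `|g x|).
Proof.
move=> ag; have [M M0 HM] := approximable_bounded ag.
have Mn0 : M != 0 by rewrite gt_eqF.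
pose u x := M^-1 * g x.
have au : approximable u by exact: approximable_scale.
have u1 x : `|u x| <= 1.
  by rewrite normrM normfV (gtr0_norm M0) ler_pdivrMl// mulr1.
have ap n : approximable (fun x => abs_iter n (u x)).
  elim: n => [|n IHn] /=; first exact: approximable_cst.
  apply: approximable_add => //.
  rewrite (_ : (fun x => _) = fun x =>
    2^-1 * (u x * u x - abs_iter n (u x) * abs_iter n (u x))).
    by apply: approximable_scale; apply: approximable_sub; apply: approximable_mul.
  by apply/funext => x; rewrite mulrC !expr2.
apply: approximable_limit => eps eps0.
pose n := Num.truncn (2 * M / eps).
exists (fun x => M * abs_iter n (u x)); split; first exact: approximable_scale.
move=> x; have [/andP[p0 pu] pe] := abs_iterP n (u1 x).
have -> : `|g x| = M * `|u x| by rewrite normrM normfV (gtr0_norm M0) mulVKf.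
rewrite -mulrBr normrM (gtr0_norm M0) ger0_norm ?subr_ge0//.
apply: (@le_trans _ _ (M * (2 / n.+2%:R))); first by rewrite ler_wpM2l// ltW.
rewrite mulrA ler_pdivrMr ?ltr0n// -ler_pdivrMl// mulrC [M * 2]mulrC.
apply: le_trans (ltW (Num.Theory.truncnS_gt _)) _.
by rewrite ler_nat.
Qed.

Lemma approximable_max g h : approximable g -> approximable h ->
  approximable (fun x => Num.max (g x) (h x)).
Proof.
move=> ag ah.
rewrite (_ : (fun x => _) = fun x => 2^-1 * (g x + h x + `|g x - h x|)).
  apply: approximable_scale; apply: approximable_add; first exact: approximable_add.
  by apply: approximable_abs; exact: approximable_sub.
by apply/funext => x; rewrite maxr_absE mulrC.
Qed.

Lemma approximable_window_dist L x : approximable (window_dist L x).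
Proof.
apply: approximable_sum => i.
by apply: approximable_add; apply: approximable_abs; apply: approximable_sub;
  (exact: approximable_cst || exact: approximable_re_coord ||
   exact: approximable_im_coord).
Qed.

(** A continuous function is, up to [eps], the maximum of finitely many cones
    with vertices on its graph, each steep enough to stay below the function
    outside of the window where the function varies little. *)
Lemma continuous_approximable (phi : X -> R) : continuous phi -> approximable phi.
Proof.
move=> cphi; apply: approximable_limit => eps eps0.
have e20 : 0 < eps / 2 by rewrite divr_gt0.
have local x : exists p : nat * R, 0 < p.2 /\
    forall y, window_dist p.1 x y < p.2 -> `|phi x - phi y| < eps / 2.
  have oU : open (phi @^-1` ball (phi x) (eps / 2)).
    by apply: open_comp; [move=> y _; exact: cphi|exact: ball_open].
  have [L [e e0 He]] := window_nbhs oU (ballxx (phi x) e20).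
  by exists (L, e).
have /choice[W HW] := local.
have [B [B0 HB]] : exists B, 0 < B /\ forall x, `|phi x| <= B.
  have /compact_bounded[B [_ HB]] : compact (phi @` [set: X]).
    by apply: continuous_compact; [exact: continuous_subspaceT|exact: compact_seqspace].
  exists (`|B| + 1); split; first by rewrite ltr_wpDl.
  move=> x; apply: (HB (`|B| + 1)); last by exists x.
  by rewrite (le_lt_trans (ler_norm B))// ltrDl.
pose M := 2 * B; have M0 : 0 < M by rewrite mulr_gt0.
pose del := Num.min 1 (eps / 2 / M).
have del0 : 0 < del by rewrite lt_min ltr01 !divr_gt0.
have del1 : del <= 1 by rewrite ge_min lexx.
have delM : M * del <= eps / 2 by rewrite mulrC -ler_pdivlMr// ge_min lexx orbT.
pose d x y := window_dist (W x).1 x y / (W x).2.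
have W0 x : 0 < (W x).2 by have [] := HW x.
have := compact_seqspace (R := R); rewrite compact_cover.
move=> /(_ (X : choiceType) setT (fun x => [set y | d x y < del])).
case=> [x _|x _|D _ cov].
- have -> : [set y | d x y < del] =
      window_dist (W x).1 x @^-1` [set r | r < del * (W x).2].
    by apply/funext => y; rewrite /d/= ltr_pdivrMr.
  by apply: open_comp; [move=> y _; exact: continuous_window_dist|exact: open_lt].
- by exists x => //=; rewrite /d window_dist_refl mul0r.
pose cone x y := phi x - M * d x y.
have acone x : approximable (cone x).
  apply: approximable_sub; first exact: approximable_cst.
  apply: approximable_scale.
  rewrite (_ : d x = fun y => (W x).2^-1 * window_dist (W x).1 x y).
    by apply: approximable_scale; exact: approximable_window_dist.
  by apply/funext => y; rewrite /d mulrC.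
have cone_le x y : cone x y <= phi y + eps / 2.
  rewrite /cone; have [dxy|dxy] := ltP (window_dist (W x).1 x y) (W x).2.
    have [_ /(_ _ dxy)] := HW x; rewrite ltr_norml => /andP[_ h].
    have : 0 <= M * d x y.
      by rewrite mulr_ge0 ?(ltW M0)// divr_ge0 ?window_dist_ge0 ?(ltW (W0 _)).
    by set z := M * _; lra.
  have : M * 1 <= M * d x y by rewrite ler_wpM2l ?(ltW M0)// ler_pdivlMr// mul1r.
  have := HB x; have := HB y; rewrite !ler_norml /M.
  by set z := _ * d x y; lra.
pose s := finmap.enum_fset D.
pose h y := \big[Num.max/(- B - eps / 2)]_(x <- s) cone x y.
exists h; split.
  rewrite /h; elim: (s) => [|x r IHr].
    rewrite (_ : (fun y => _) = fun=> (- B - eps / 2)); first exact: approximable_cst.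
    by apply/funext => y; rewrite big_nil.
  rewrite (_ : (fun y => _) = fun y => Num.max (cone x y)
     (\big[Num.max/(- B - eps / 2)]_(x <- r) cone x y)).
    exact: approximable_max.
  by apply/funext => y; rewrite big_cons.
move=> y; rewrite ler_norml; apply/andP; split.
  suff : h y <= phi y + eps / 2 by lra.
  rewrite /h; elim: (s) => [|x r IHr].
    by rewrite big_nil; have := HB y; rewrite ler_norml; lra.
  by rewrite big_cons ge_max cone_le.
have [x /= xD dxy] := cov y Logic.I.
have : cone x y <= h y.
  have : x \in s by exact: xD.
  rewrite /h; elim: (s) => // z r IHr; rewrite inE big_cons le_max => /orP[/eqP->|/IHr->].
    by rewrite lexx.
  by rewrite orbT.
have Md : M * d x y <= eps / 2.
  by apply: le_trans delM; rewrite ler_wpM2l ?(ltW M0)// ltW.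
have : `|phi x - phi y| < eps / 2.
  by have [_ ->//] := HW x; have := lt_le_trans dxy del1; rewrite /d ltr_pdivrMr// mul1r.
by rewrite ltr_norml /cone; set z := M * _ in Md *; lra.
Qed.

End polynomials.

(** * Measures on the sequence space *)

Lemma cvg_dominated_dist (R : realType) (T : topologicalType) (g : T -> R)
    (x : T) (w : T -> R) : {for x, continuous w} -> w x = 0 ->
  (forall y, `|g x - g y| <= w y) -> {for x, continuous g}.
Proof.
move=> cw w0 gw; apply/cvgrPdist_lt => e e0; near=> y.
apply: le_lt_trans (gw y) _; apply: le_lt_trans (ler_norm _) _.
rewrite -[w y]opprK normrN -[- w y]sub0r -w0.
by near: y; move/cvgrPdist_lt : cw; apply.
Unshelve. all: by end_near. Qed.

Lemma continuous_min1 (R : realType) (T : topologicalType) (a : R) (g : T -> R) :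
  continuous g -> continuous (fun x => Num.min 1 (a * g x)).
Proof.
move=> cg x; apply: (@continuous_min _ _ (fun=> 1) (fun x => a * g x)).
  exact: cvg_cst.
by apply: cvgM; [exact: cvg_cst|exact: cg].
Qed.

Section moments_determine.
Context {R : realType}.
Local Notation X := (seqspace R).
Implicit Types (x y : X) (U : set X) (h : X -> R) (mu : probability X R).

Lemma open_measurable_seqspace U : open U -> measurable U.
Proof. by move=> oU; exact: sub_sigma_algebra. Qed.

Lemma continuous_measurable_seqspace h : continuous h -> measurable_fun setT h.
Proof.
move=> ch; apply: (measurability _ (measurable_realfun.RGenOpens.measurableE R)).
move=> _ /= -[_ [a [b ->]] <-].
rewrite setTI; apply: open_measurable_seqspace.
by apply: open_comp; [move=> x _; exact: ch|exact: itv_open].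
Qed.

(** * Indicators of open sets as limits of continuous functions *)

(** The distance from the complement of [U] seen through a window; the value [1]
    keeps the infimum meaningful when the complement is empty. *)
Definition outer_dist L U x : R :=
  inf ([set 1] `|` [set window_dist L x y | y in ~` U]).

Lemma outer_dist_has_inf L U x :
  has_inf ([set 1] `|` [set window_dist L x y | y in ~` U]).
Proof.
split; first by exists 1; left.
exists 0 => _ [->//|[y _ <-]]; exact: window_dist_ge0.
Qed.

Lemma outer_dist_ge0 L U x : 0 <= outer_dist L U x.
Proof.
apply: lb_le_inf; first by exists 1; left.
by move=> _ [->//|[y _ <-]]; exact: window_dist_ge0.
Qed.

Lemma outer_dist_out L U x : ~ U x -> outer_dist L U x = 0.
Proof.
move=> Ux; apply/eqP; rewrite eq_le outer_dist_ge0 andbT.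
apply: ge_inf; first by have [] := outer_dist_has_inf L U x.
by right; exists x => //; rewrite window_dist_refl.
Qed.

Lemma outer_dist_ge L U x e : e <= 1 ->
  (forall y, ~ U y -> e <= window_dist L x y) -> e <= outer_dist L U x.
Proof.
move=> e1 eU; apply: lb_le_inf; first by exists 1; left.
by move=> _ [->//|[y Uy <-]]; exact: eU.
Qed.

Lemma outer_dist_lipschitz L U x y :
  outer_dist L U x <= outer_dist L U y + window_dist L x y.
Proof.
rewrite -lerBlDr; apply: lb_le_inf; first by exists 1; left.
have [_ lb] := outer_dist_has_inf L U x.
move=> _ [->|[z Uz <-]]; rewrite lerBlDr.
  apply: (@le_trans _ _ 1); first by apply: ge_inf => //; left.
  by rewrite lerDl window_dist_ge0.
apply: (@le_trans _ _ (window_dist L x z)).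
  by apply: ge_inf => //; right; exists z.
by rewrite addrC window_dist_triangle.
Qed.

Lemma continuous_outer_dist L U : continuous (outer_dist L U).
Proof.
move=> x; apply: (@cvg_dominated_dist _ _ _ _ (window_dist L x)).
- exact: continuous_window_dist.
- exact: window_dist_refl.
move=> y; rewrite ler_norml.
have := outer_dist_lipschitz L U x y; have := outer_dist_lipschitz L U y x.
by rewrite (window_dist_sym L y x); lra.
Qed.

Definition open_bump n U x : R := Num.min 1 (n%:R * outer_dist n U x).

Lemma open_bump_itv n U x : 0 <= open_bump n U x <= 1.
Proof. by rewrite /open_bump ge_min lexx le_min ler01 mulr_ge0// outer_dist_ge0. Qed.

Lemma continuous_open_bump n U : continuous (open_bump n U).
Proof.
apply: continuous_min1; exact: continuous_outer_dist.
Qed.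

(** The window and the slope grow together; any point of the open set has a
    neighbourhood inside it that depends on a finite window. *)
Lemma open_bump_cvg U x : open U -> open_bump n U x @[n --> \oo] --> (\1_U x : R).
Proof.
move=> oU; rewrite indicE; case: (boolP (x \in U)) => [|/negP] xU; last first.
  have -> : (fun n => open_bump n U x) = fun=> 0; last exact: cvg_cst.
  apply/funext => n; rewrite /open_bump outer_dist_out ?mulr0.
    by apply/min_idPr; exact: ler01.
  by move=> Ux; apply: xU; rewrite inE.
rewrite inE in xU; have [L [e e0 He]] := window_nbhs oU xU.
pose d := Num.min 1 e; have d0 : 0 < d by rewrite lt_min ltr01.
apply/cvgrPdist_lt => z z0; near=> n.
suff -> : open_bump n U x = 1 by rewrite subrr normr0.
apply/min_idPl; have Ln : (L <= n)%N by near: n; exact: nbhs_infty_ge.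
apply: (@le_trans _ _ (n%:R * d)).
  rewrite -(ler_pdivrMr _ _ d0) mul1r; near: n; exact: nbhs_infty_ger.
rewrite ler_wpM2l//; apply: outer_dist_ge; first by rewrite ge_min lexx.
move=> y Uy; apply: le_trans (window_dist_mono _ _ Ln).
rewrite leNgt; apply/negP => h; apply/Uy/He; apply: lt_le_trans h _.
by rewrite ge_min lexx orbT.
Unshelve. all: by end_near. Qed.

Lemma integral_bump_cvg mu (G : X -> R) U : mu.-integrable setT (EFin \o G) ->
  open U ->
  (\int[mu]_x (G x * open_bump n U x)%:E @[n --> \oo] --> \int[mu]_(x in U) (G x)%:E)%E.
Proof.
move=> iG oU; have mU := open_measurable_seqspace oU.
have mG : measurable_fun setT G by apply/measurable_EFinP; case/integrableP: iG.
have -> : (\int[mu]_(x in U) (G x)%:E = \int[mu]_x (G x * \1_U x)%:E)%E.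
  rewrite integral_mkcond; apply: eq_integral => x _.
  by rewrite patchE indicE; case: (x \in U); rewrite ?mulr1 ?mulr0.
have [//| | | | |_ _] := @dominated_convergence _ X R mu setT measurableT
  (fun n x => (G x * open_bump n U x)%:E) (fun x => (G x * \1_U x)%:E)
  (fun x => `|G x|%:E).
- move=> n; apply/measurable_EFinP; apply: measurable_funM => //.
  by apply: continuous_measurable_seqspace; exact: continuous_open_bump.
- by apply/measurable_EFinP; apply: measurable_funM.
- apply: aeW => x _; apply: cvg_EFin; first by near=> n.
  by apply: cvgM; [exact: cvg_cst|exact: open_bump_cvg].
- exact: integrable_abse iG.
- apply: aeW => x n _; rewrite lee_fin normrM ler_piMr//.
  by have /andP[b0 b1] := open_bump_itv n U x; rewrite ger0_norm.
exact.
Unshelve. all: by end_near. Qed.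

(** * Monomials determine integrals *)

Definition bounded_measurable h : Prop :=
  measurable_fun setT h /\ exists M, forall x, `|h x| <= M.

Lemma bounded_measurable_integrable mu h : bounded_measurable h ->
  mu.-integrable setT (EFin \o h).
Proof.
move=> [mh [M HM]]; apply: measurable_bounded_integrable => //.
  by apply: fin_num_fun_lty; exact: fin_num_measure.
exists M; split; first exact: num_real.
by move=> N MN x _; apply: le_trans (HM x) (ltW MN).
Qed.

Lemma integrable_mul_bounded mu (G : X -> R) h : mu.-integrable setT (EFin \o G) ->
  bounded_measurable h -> mu.-integrable setT (EFin \o (fun x => G x * h x)).
Proof.
move=> iG [mh [M HM]]; apply: (@integrableMl _ _ _ mu setT measurableT (EFin \o G) h) => //.
exists M; split; first exact: num_real.
by move=> N MN x _; apply: le_trans (HM x) (ltW MN).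
Qed.

End moments_determine.

Section uniqueness.
Context {R : realType}.
Local Notation X := (seqspace R).
Implicit Types (x y : X) (U : set X) (h : X -> R) (mu : probability X R).

Lemma bounded_measurable_continuous h : continuous h -> bounded_measurable h.
Proof.
move=> ch; split; first exact: continuous_measurable_seqspace.
by have [M _ HM] := approximable_bounded (continuous_approximable ch); exists M.
Qed.

Lemma bounded_measurable_mul g h : bounded_measurable g -> bounded_measurable h ->
  bounded_measurable (fun x : X => g x * h x : R).
Proof.
move=> [mg [M HM]] [mh [N HN]]; split; first exact: measurable_funM.
by exists (M * N) => x; rewrite normrM ler_pM.
Qed.

Lemma bounded_measurable_add g h : bounded_measurable g -> bounded_measurable h ->
  bounded_measurable (fun x : X => g x + h x : R).
Proof.
move=> [mg [M HM]] [mh [N HN]]; split; first exact: measurable_funD.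
by exists (M + N) => x; apply: le_trans (ler_normD _ _) _; rewrite lerD.
Qed.

Lemma bounded_measurable_opp g : bounded_measurable g ->
  bounded_measurable (fun x : X => - g x : R).
Proof.
move=> [mg [M HM]]; split; first exact: measurableT_comp.
by exists M => x; rewrite normrN.
Qed.

Lemma bounded_measurable_cst (r : R) : bounded_measurable (fun _ : X => r).
Proof. by split; [exact: measurable_cst|exists `|r|]. Qed.

Lemma bounded_measurable_monomial (v : config) :
  bounded_measurable (fun x : X => complex.Re (monomial v x)) /\
  bounded_measurable (fun x : X => complex.Im (monomial v x)).
Proof.
elim: v => [|[k b] v [IHr IHi]].
  split.
  - rewrite (_ : (fun x => _) = cst 1); first exact: bounded_measurable_cst.
    by apply/funext => x; rewrite /monomial big_nil.
  - rewrite (_ : (fun x => _) = cst 0); first exact: bounded_measurable_cst.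
    by apply/funext => x; rewrite /monomial big_nil.
have hr := bounded_measurable_continuous (@continuous_re_coord R k).
have hi := bounded_measurable_continuous (@continuous_im_coord R k).
pose e : R := if b then -1 else 1.
have he : bounded_measurable (fun x : X => e * im_coord k x).
  by apply: bounded_measurable_mul => //; exact: bounded_measurable_cst.
have E x : monomial ((k, b) :: v) x = (re_coord k x +i* (e * im_coord k x)) * monomial v x.
  rewrite /monomial big_cons; congr (_ * _).
  rewrite /coord_factor /re_coord /im_coord /e; rewrite /=.
  by case: (b); case: (seq_coord x k) => a a' /=; rewrite ?mulN1r ?mul1r.
split.
- rewrite (_ : (fun x => _) = fun x => re_coord k x * complex.Re (monomial v x) +
     - (e * im_coord k x * complex.Im (monomial v x))).
    apply: bounded_measurable_add; first exact: bounded_measurable_mul.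
    by apply: bounded_measurable_opp; exact: bounded_measurable_mul.
  by apply/funext => x; rewrite E; case: (monomial v x) => ? ? /=; ring.
- rewrite (_ : (fun x => _) = fun x => re_coord k x * complex.Im (monomial v x) +
     e * im_coord k x * complex.Re (monomial v x)).
    by apply: bounded_measurable_add; exact: bounded_measurable_mul.
  by apply/funext => x; rewrite E; case: (monomial v x) => ? ? /=; ring.
Qed.

Lemma bounded_measurable_tp (s : trig_poly (R := R)) :
  bounded_measurable (fun x : X => complex.Re (tp_eval s x)).
Proof.
elim: s => [|[a v] s IHs].
  rewrite (_ : (fun x => _) = cst 0); first exact: bounded_measurable_cst.
  by apply/funext => x; rewrite /tp_eval big_nil.
have [hr hi] := bounded_measurable_monomial v.
rewrite (_ : (fun x => _) = fun x => (complex.Re a * complex.Re (monomial v x) +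
   - (complex.Im a * complex.Im (monomial v x))) + complex.Re (tp_eval s x)).
  apply: bounded_measurable_add => //; apply: bounded_measurable_add.
    by apply: bounded_measurable_mul => //; exact: bounded_measurable_cst.
  apply: bounded_measurable_opp.
  by apply: bounded_measurable_mul => //; exact: bounded_measurable_cst.
apply/funext => x; rewrite /tp_eval big_cons raddfD/=; congr (_ + _).
by case: a => ? ?; case: (monomial v x) => ? ? /=; ring.
Qed.

(** Two weighted probability measures with the same integrals of monomials
    coincide: monomials reach continuous functions by uniform approximation,
    these reach indicators of open sets by dominated convergence, and open sets
    form a pi-system. *)
Lemma moments_determine (mu1 mu2 : probability X R) (G1 G2 : X -> R) :
  mu1.-integrable setT (EFin \o G1) -> mu2.-integrable setT (EFin \o G2) ->
  (forall v, (\int[mu1]_x (G1 x * complex.Re (monomial v x)) =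
              \int[mu2]_x (G2 x * complex.Re (monomial v x)))%R /\
             (\int[mu1]_x (G1 x * complex.Im (monomial v x)) =
              \int[mu2]_x (G2 x * complex.Im (monomial v x)))%R) ->
  forall C, measurable C ->
  (\int[mu1]_(x in C) (G1 x)%:E = \int[mu2]_(x in C) (G2 x)%:E)%E.
Proof.
move=> i1 i2 H.
have tp s : (\int[mu1]_x (G1 x * complex.Re (tp_eval s x)) =
             \int[mu2]_x (G2 x * complex.Re (tp_eval s x)))%R.
  elim: s => [|[a v] s IHs].
    by rewrite !(@eq_Rintegral _ _ _ _ _ (cst 0)) ?Rintegral_cst ?mul0r// => x _;
      rewrite /tp_eval big_nil mulr0.
  have [hr hi] := bounded_measurable_monomial v; have hs := bounded_measurable_tp s.
  have E (mu : probability X R) G : mu.-integrable setT (EFin \o G) ->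
    (\int[mu]_x (G x * complex.Re (tp_eval ((a, v) :: s) x)) =
     complex.Re a * \int[mu]_x (G x * complex.Re (monomial v x)) -
     complex.Im a * \int[mu]_x (G x * complex.Im (monomial v x)) +
     \int[mu]_x (G x * complex.Re (tp_eval s x)))%R.
    move=> iG; have Ir := integrable_mul_bounded iG hr.
    have Ii := integrable_mul_bounded iG hi; have Is := integrable_mul_bounded iG hs.
    rewrite -!RintegralZl// -RintegralB//; first last.
    - exact: (integrableZl measurableT (complex.Im a) Ii).
    - exact: (integrableZl measurableT (complex.Re a) Ir).
    rewrite -RintegralD//; last first.
      apply: (integrableB measurableT (integrableZl measurableT (complex.Re a) Ir)
        (integrableZl measurableT (complex.Im a) Ii)).
    apply: eq_Rintegral => x _; rewrite /tp_eval big_cons raddfD/=.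
    by case: a => a a'; case: (monomial v x) => b b' /=; ring.
  by rewrite (E mu1)// (E mu2)//; have [-> ->] := H v; rewrite IHs.
have cont phi : continuous phi ->
    (\int[mu1]_x (G1 x * phi x) = \int[mu2]_x (G2 x * phi x))%R.
  move=> cphi; have hphi := bounded_measurable_continuous cphi.
  have near_eq (mu : probability X R) G s e : mu.-integrable setT (EFin \o G) ->
    (forall x, `|phi x - complex.Re (tp_eval s x)| <= e) ->
    `|(\int[mu]_x (G x * phi x) - \int[mu]_x (G x * complex.Re (tp_eval s x)))%R| <=
      e * (\int[mu]_x `|G x|)%R.
    move=> iG He; have I1 := integrable_mul_bounded iG hphi.
    have I2 := integrable_mul_bounded iG (bounded_measurable_tp s).
    have iG' : mu.-integrable setT (EFin \o (fun x => `|G x|)).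
      exact: integrable_abse iG.
    rewrite -RintegralB// -RintegralZl//.
    have I3 : mu.-integrable setT
        (EFin \o (fun x => G x * phi x - G x * complex.Re (tp_eval s x))).
      exact: (integrableB measurableT I1 I2).
    apply: (le_trans (le_normr_Rintegral measurableT I3)).
    apply: le_Rintegral => //.
    - exact: integrable_abse I3.
    - exact: (integrableZl measurableT e iG').
    by move=> x _; rewrite -mulrBr normrM mulrC ler_wpM2r.
  apply/eqP; rewrite -subr_eq0 -normr_le0; apply/ler_addgt0Pr => e e0; rewrite add0r.
  pose K := (\int[mu1]_x `|G1 x| + \int[mu2]_x `|G2 x| + 1)%R.
  have j1 : (0 <= \int[mu1]_x `|G1 x|)%R by apply: Rintegral_ge0.
  have j2 : (0 <= \int[mu2]_x `|G2 x|)%R by apply: Rintegral_ge0.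
  have K0 : 0 < K by rewrite /K; lra.
  have eK : 0 < e / K by rewrite divr_gt0.
  have [s Hs] := continuous_approximable cphi eK.
  have := near_eq mu1 G1 s _ i1 Hs; have := near_eq mu2 G2 s _ i2 Hs; rewrite tp.
  set a := (\int[mu1]_x (G1 x * phi x))%R; set b := (\int[mu2]_x (G2 x * phi x))%R.
  set z := (\int[mu2]_x (G2 x * complex.Re (tp_eval s x)))%R => hb ha.
  have -> : a - b = (a - z) - (b - z) by ring.
  apply: le_trans (ler_normB _ _) _; apply: le_trans (lerD ha hb) _.
  rewrite -mulrDr mulrAC ler_pdivrMr// ler_wpM2l ?(ltW e0)//.
  by rewrite /K lerDl.
have opens U : open U ->
    (\int[mu1]_(x in U) (G1 x)%:E = \int[mu2]_(x in U) (G2 x)%:E)%E.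
  move=> oU; have l1 := integral_bump_cvg i1 oU; have l2 := integral_bump_cvg i2 oU.
  move: l1; rewrite (_ : (fun n => _) =
    fun n => (\int[mu2]_x (G2 x * open_bump n U x)%:E)%E); last first.
    apply/funext => n; have hb := bounded_measurable_continuous (@continuous_open_bump R n U).
    rewrite -[LHS]fineK ?(integrable_fin_num measurableT (integrable_mul_bounded i1 hb))//.
    rewrite -[RHS]fineK ?(integrable_fin_num measurableT (integrable_mul_bounded i2 hb))//.
    by congr EFin; apply: cont; exact: continuous_open_bump.
  by move=> l1; apply: (cvg_unique _ l1 l2); exact: ereal_hausdorff.
have sub (mu : probability X R) G C : mu.-integrable setT (EFin \o G) ->
  measurable C -> mu.-integrable C (EFin \o G).
  by move=> iG mC; apply: (@integrableS _ _ _ mu setT C).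
move=> C mC; apply: (@dynkin_induction _ X (@open X)
  (fun C => (\int[mu1]_(x in C) (G1 x)%:E = \int[mu2]_(x in C) (G2 x)%:E)%E)) => //.
- by move=> A B; exact: openI.
- by apply: opens; exact: openT.
- move=> S mS HS.
  have compl (mu : probability X R) G : mu.-integrable setT (EFin \o G) ->
    (\int[mu]_(x in ~` S) (G x)%:E = \int[mu]_x (G x)%:E - \int[mu]_(x in S) (G x)%:E)%E.
    move=> iG; rewrite -(setUv S) integral_setU//; last 3 first.
    + exact: measurableC.
    + by rewrite setUv; case/integrableP: iG.
    + by apply/disj_set2P; rewrite setICr.
    rewrite [X in (X - _)%E]addeC addeK//.
    exact: (integrable_fin_num mS (sub _ _ _ iG mS)).
  by rewrite (compl _ _ i1) (compl _ _ i2) HS (opens setT)//; exact: openT.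
- move=> F mF tF HF.
  rewrite !integral_bigcup//; last 2 first.
  + by apply: sub => //; exact: bigcup_measurable.
  + by apply: sub => //; exact: bigcup_measurable.
  by apply: eq_eseriesr => n _; exact: HF.
Qed.

Lemma ae_eq0_of_moments mu (G : X -> R) : mu.-integrable setT (EFin \o G) ->
  (forall v, (\int[mu]_x (G x * complex.Re (monomial v x)) = 0)%R /\
             (\int[mu]_x (G x * complex.Im (monomial v x)) = 0)%R) ->
  {ae mu, forall x, G x = 0}.
Proof.
move=> iG H; have i0 : mu.-integrable setT (EFin \o (fun _ : X => 0 : R)).
  exact: integrable0.
have := @integral_ae_eq _ X R mu setT measurableT (cst 0%E) (EFin \o G) iG.
case.
- exact: measurable_cst.
- move=> E _ mE; rewrite (@moments_determine mu mu G (fun=> 0) iG i0)//.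
  by move=> v; have [-> ->] := H v; split; rewrite (@eq_Rintegral _ _ _ _ _ (cst 0))
    ?Rintegral_cst ?mul0r// => x _; rewrite mul0r.
move=> N [mN N0 sub]; exists N; split => // x /= Gx; apply: sub => /=.
by move=> /(_ Logic.I) [].
Qed.

Lemma probability_of_moments (mu1 mu2 : probability X R) :
  (forall v, (\int[mu1]_x complex.Re (monomial v x) =
              \int[mu2]_x complex.Re (monomial v x))%R /\
             (\int[mu1]_x complex.Im (monomial v x) =
              \int[mu2]_x complex.Im (monomial v x))%R) ->
  forall C, measurable C -> mu1 C = mu2 C.
Proof.
move=> H C mC.
have i1 (mu : probability X R) : mu.-integrable setT (EFin \o (fun _ : X => 1 : R)).
  by apply: bounded_measurable_integrable; exact: bounded_measurable_cst.
have := @moments_determine mu1 mu2 (fun=> 1) (fun=> 1) (i1 _) (i1 _) _ C mC.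
rewrite !integral_cst// !mul1e; apply => v; have [h1 h2] := H v.
by split; [under eq_Rintegral do rewrite mul1r; rewrite h1
          |under eq_Rintegral do rewrite mul1r; rewrite h2];
   apply: eq_Rintegral => x _; rewrite mul1r.
Qed.

End uniqueness.

(** * Characters of the torus *)

Section characters.
Context {R : realType}.
Implicit Types (a b : R) (k : int) (x y : torus R).

Lemma expiX a n : expi (a *+ n) = expi a ^+ n :> R[i].
Proof.
elim: n => [|n IHn]; first by rewrite mulr0n expi0 expr0.
by rewrite mulrS expiD IHn exprS.
Qed.

Lemma expi_2pi_int k : expi (2 * pi * k%:~R) = 1 :> R[i].
Proof.
have nat n : expi (2 * pi * n%:R) = 1 :> R[i].
  rewrite mulr_natr expiX.
  by rewrite /expi mulr_natl cos2pi sin2pi expr1n.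
case: k => n; first exact: nat.
by rewrite NegzE mulrNz mulrN -expiJ nat conjc1.
Qed.

Lemma expi_2pi_eq1 a : expi (2 * pi * a) = 1 -> a \is a Num.int.
Proof.
move=> a1; pose r := a - (Num.floor a)%:~R.
have [r0 r1] : 0 <= r /\ r < 1.
  by rewrite /r subr_ge0 Num.Theory.floor_le ltrBlDl -intrD1 Num.Theory.floorD1_gt.
have {a1} r_eq : cos (2 * pi * r) = 1.
  have : expi (2 * pi * r) = 1 :> R[i].
    rewrite /r mulrBr expiD a1 mul1r -mulrN -mulrNz; exact: expi_2pi_int.
  by rewrite /expi => /eqP; rewrite eq_complex/= => /andP[/eqP].
have pi0 := @pi_gt0 R.
have inj (u : R) : 0 <= u <= 2^-1 -> cos (2 * pi * u) = 1 -> u = 0.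
  move=> /andP[u0 u1] cu.
  have h1 : 0 <= 2 * pi * u by rewrite !mulr_ge0// ?pi_ge0.
  have h2 : 2 * pi * u <= pi.
    by rewrite mulrAC ler_piMl ?pi_ge0//; lra.
  have : 2 * pi * u = 0.
    have i1 : 2 * pi * u \in `[0, pi] by rewrite in_itv/= h1 h2.
    have i2 : (0 : R) \in `[0, pi : R] by rewrite in_itv/= lexx pi_ge0.
    by have := @cos_inj R _ _ i1 i2; rewrite cos0 cu; apply.
  move/eqP; rewrite !mulf_eq0 pnatr_eq0/= gt_eqF//=.
  by move/eqP.
have r00 : r = 0.
  have [rh|rh] := leP r 2^-1; first by apply: inj => //; rewrite r0.
  suff : 1 - r = 0 by move: r1; lra.
  apply: inj; first by apply/andP; split; lra.
  by rewrite mulrBr mulr1 -cosN opprB mulr_natl cosB cos2pi sin2pi mulr0 mulr1 addr0 -mulr_natl.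
by move: r00; rewrite /r => /subr0_eq ->; exact: rpred_int_num.
Qed.

Definition repr_torus x : R := generic_quotient.repr x.

Lemma torus_piK x : torus_pi (repr_torus x) = x.
Proof. by rewrite /torus_pi /repr_torus generic_quotient.reprK. Qed.

Lemma torus_pi_eq a b : torus_pi a = torus_pi b <-> a - b \is a Num.int.
Proof.
have -> : (a - b \is a Num.int) = (a - b \in @integers R) by [].
rewrite Quotient.idealrBE; split => [h|/eqP h]; first exact/eqP.
exact: h.
Qed.

Lemma torus_piD a b : torus_pi (a + b) = torus_pi a + torus_pi b.
Proof. exact: Quotient.pi_add. Qed.

Lemma torus_pi0 : torus_pi 0 = 0 :> torus R.
Proof. by apply: (addrI (torus_pi 0)); rewrite -torus_piD !addr0. Qed.

Lemma torus_piN a : torus_pi (- a) = - torus_pi a.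
Proof. by apply: (addrI (torus_pi a)); rewrite -torus_piD !subrr torus_pi0. Qed.

Lemma torus_pi_mulz a k : torus_pi (a *~ k) = torus_pi a *~ k.
Proof.
have nat n : torus_pi (a *+ n) = torus_pi a *+ n.
  elim: n => [|n IHn]; first by rewrite !mulr0n torus_pi0.
  by rewrite !mulrS torus_piD IHn.
case: k => n; first exact: nat.
by rewrite NegzE !mulrNz torus_piN -[in LHS]pmulrn nat.
Qed.

Definition chi x : R[i] := expi (2 * pi * repr_torus x).

Lemma chi_pi a : chi (torus_pi a) = expi (2 * pi * a).
Proof.
have /torus_pi_eq := torus_piK (torus_pi a).
move=> /intrP[k hk]; rewrite /chi -(subrK a (repr_torus _)) hk mulrDr expiD.
by rewrite expi_2pi_int mul1r.
Qed.

Lemma chiD x y : chi (x + y) = chi x * chi y.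
Proof.
by rewrite -(torus_piK x) -(torus_piK y) -torus_piD !chi_pi mulrDr expiD.
Qed.

Lemma chi0 : chi 0 = 1.
Proof. by rewrite -torus_pi0 chi_pi mulr0 expi0. Qed.

Lemma chiN x : chi (- x) = (chi x)^*.
Proof. by rewrite -(torus_piK x) -torus_piN !chi_pi mulrN expiJ. Qed.

Lemma chi_sum (I : Type) (r : seq I) (F : I -> torus R) :
  chi (\sum_(i <- r) F i) = \prod_(i <- r) chi (F i).
Proof.
elim: r => [|i r IHr]; first by rewrite !big_nil chi0.
by rewrite !big_cons chiD IHr.
Qed.

Lemma chi_eq1 x : chi x = 1 -> x = 0.
Proof.
move=> /expi_2pi_eq1 h; rewrite -(torus_piK x) -torus_pi0; apply/torus_pi_eq.
by rewrite subr0.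
Qed.

Lemma cabs_chi x : cabs (chi x) = 1. Proof. exact: cabs_expi. Qed.

Lemma chi_inj : injective chi.
Proof.
move=> x y xy; apply/subr0_eq/chi_eq1; rewrite chiD chiN xy.
by rewrite /chi expiJ -expiD subrr expi0.
Qed.

(** * Complex-valued measurable functions, through their two components *)

Definition measurable_complex d (T : measurableType d) (g : T -> R[i]) : Prop :=
  measurable_fun setT (fun w => complex.Re (g w)) /\
  measurable_fun setT (fun w => complex.Im (g w)).

Lemma measurable_complex_mul d (T : measurableType d) (g h : T -> R[i]) :
  measurable_complex g -> measurable_complex h ->
  measurable_complex (fun w => g w * h w).
Proof.
move=> [gr gi] [hr hi]; split.
- rewrite (_ : (fun w => _) = fun w => complex.Re (g w) * complex.Re (h w) -
      complex.Im (g w) * complex.Im (h w)).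
    by apply: measurable_funB; exact: measurable_funM.
  by apply/funext => w; case: (g w) => ? ?; case: (h w).
- rewrite (_ : (fun w => _) = fun w => complex.Re (g w) * complex.Im (h w) +
      complex.Im (g w) * complex.Re (h w)).
    by apply: measurable_funD; exact: measurable_funM.
  by apply/funext => w; case: (g w) => ? ?; case: (h w).
Qed.

Lemma measurable_complex_cst d (T : measurableType d) (z : R[i]) :
  measurable_complex (fun _ : T => z).
Proof. by split; exact: measurable_cst. Qed.

Lemma measurable_complex_prod d (T : measurableType d) (I : Type) (r : seq I)
    (F : I -> T -> R[i]) : (forall i, measurable_complex (F i)) ->
  measurable_complex (fun w => \prod_(i <- r) F i w).
Proof.
move=> mF; elim: r => [|i r IHr].
  rewrite (_ : (fun w => _) = fun=> 1); first exact: measurable_complex_cst.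
  by apply/funext => w; rewrite big_nil.
rewrite (_ : (fun w => _) = fun w => F i w * \prod_(j <- r) F j w).
  exact: measurable_complex_mul.
by apply/funext => w; rewrite big_cons.
Qed.

Lemma measurable_complex_comp d d' (S : measurableType d) (T : measurableType d')
    (g : T -> R[i]) (u : S -> T) : measurable_fun setT u ->
  measurable_complex g -> measurable_complex (fun w => g (u w)).
Proof. by move=> mu [gr gi]; split; [exact: (measurableT_comp gr)|exact: (measurableT_comp gi)]. Qed.

Lemma measurable_from_torus (g : torus R -> R) :
  measurable_fun setT (fun a => g (torus_pi a)) -> measurable_fun setT g.
Proof.
move=> mg _ A mA; rewrite setTI.
have := mg measurableT A mA; rewrite setTI; exact.
Qed.

Lemma measurable_cos_affine (a b : R) : measurable_fun setT (fun t : R => cos (a * t + b)).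
Proof.
apply: continuous_measurable_fun => t.
apply: (@continuous_comp _ _ _ (fun t => a * t + b) cos); last exact: continuous_cos.
by apply: cvgD; [apply: cvgM; [exact: cvg_cst|exact: cvg_id]|exact: cvg_cst].
Qed.

Lemma measurable_chi_mulz k : measurable_complex (fun x => chi (x *~ k)).
Proof.
have E a : chi (torus_pi a *~ k) = expi (2 * pi * k%:~R * a).
  by rewrite -torus_pi_mulz chi_pi -mulrzr mulrA mulrAC.
split; apply: measurable_from_torus.
- rewrite (_ : (fun a => _) = fun a => cos (2 * pi * k%:~R * a + 0)).
    exact: measurable_cos_affine.
  by apply/funext => a; rewrite E addr0.
- rewrite (_ : (fun a => _) = fun a => cos (2 * pi * k%:~R * a + (- (pi / 2)))).
    exact: measurable_cos_affine.
  by apply/funext => a; rewrite E cosBpihalf.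
Qed.

End characters.

(** * Integrals of characters *)

Section haar_one.
Context {R : realType}.

Lemma haar1_uniform (A : set (torus R)) : measurable A ->
  haar1 A = uniform_prob (@ltr01 R) (@torus_pi R @^-1` A).
Proof.
move=> mA; have mB : measurable (@torus_pi R @^-1` A) by [].
rewrite /haar1 /uniform_prob integral_uniform_pdf.
set B := _ @^-1` _ in mB *.
pose I : set R := `[0, 1]%classic.
rewrite -/I (eq_integral (cst 1%E)) => [|x]; last first.
  by rewrite inE /I => -[_]; rewrite /= in_itv/= => h; rewrite /uniform_pdf h subr0 invr1.
have mI : measurable (B `&` I) by apply: measurableI => //; exact: measurable_itv.
rewrite integral_cst// mul1e.
have -> : B `&` I = (B `&` `[0, 1[%classic) `|` (B `&` [set 1]).
  rewrite -setIUr /I; congr (_ `&` _); apply/seteqP; split => x /=; rewrite !in_itv/=.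
    by move=> /andP[->]; rewrite le_eqVlt => /predU1P[->|->]; [right|left].
  by move=> [/andP[-> /ltW->]//|->]; rewrite ler01 lexx.
rewrite measureU0//; [exact: measurableI|exact: measurableI|].
apply: (@subset_measure0 _ _ _ lebesgue_measure _ [set 1]) => //.
- exact: measurableI.
- exact: lebesgue_measure_set1.
Qed.

(** The constant [1] keeps the integrand non-negative, so that the integral can be
    carried along an image measure without an integrability condition. *)
Lemma integral_cos_affine (k : int) (b : R) : k != 0 ->
  (\int[lebesgue_measure]_(t in `[0%R, 1%R]) (1 + cos (2 * pi * k%:~R * t + b))%:E
    = 1)%E.
Proof.
move=> k0; pose w : R := 2 * pi * k%:~R.
have w0 : w != 0 by rewrite !mulf_neq0// ?pnatr_eq0 ?intr_eq0// gt_eqF// pi_gt0.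
pose F t := t + w^-1 * sin (w * t + b).
have dF (t : R) : is_derive t 1 F (1 + cos (w * t + b)).
  have h : is_derive t 1 (fun t : R => sin (w * t + b)) (cos (w * t + b) * w).
    apply: (@is_derive1_comp _ sin (fun t => w * t + b)).
    have := is_deriveZ w (is_derive_id t (1 : R)).
    rewrite /GRing.scale/= mulr1 => h.
    by have := is_deriveD h (is_derive_cst b t 1); rewrite addr0.
  have := is_deriveD (is_derive_id t (1 : R)) (is_deriveZ w^-1 h).
  by rewrite /GRing.scale/= mulrCA mulVf// mulr1.
have cF : continuous F.
  by move=> t; apply: differentiable_continuous; apply/derivable1_diffP; have [] := dF t.
rewrite (@continuous_FTC2 _ _ F)//.
- rewrite -EFinB; congr EFin; rewrite /F !mulr0 add0r mulr1 add0r.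
  have : expi (w + b) = expi b by rewrite expiD expi_2pi_int mul1r.
  by rewrite /expi => /eqP; rewrite eq_complex/= => /andP[_ /eqP ->]; ring.
- apply: continuous_subspaceT => t; apply: cvgD; first exact: cvg_cst.
  apply: (@continuous_comp _ _ _ (fun t => w * t + b) cos); last exact: continuous_cos.
  by apply: cvgD; [apply: cvgM; [exact: cvg_cst|exact: cvg_id]|exact: cvg_cst].
- split; first by move=> t _; have [] := dF t.
  + by apply: cvg_at_right_filter; exact: cF.
  + by apply: cvg_at_left_filter; exact: cF.
- by move=> t _; rewrite derive1E; have [_ ->] := dF t.
Qed.

(** Letting the angle [b] vary treats the real and the imaginary part as one
    family of real functions, stable under multiplication by a phase. *)
Definition tcos (b : R) (z : R[i]) : R := complex.Re (z * expi b).

Lemma tcos_expi (a b : R) : tcos b (expi a) = cos (a + b).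
Proof. by rewrite /tcos -expiD. Qed.

Lemma tcos_le1 b (z : R[i]) : cabs z <= 1 -> `|tcos b z| <= 1.
Proof.
by move=> z1; apply: le_trans (Re_le_cabs _) _; rewrite cabsM cabs_expi mulr1.
Qed.

Lemma measurable_tcos d (T : measurableType d) (b : R) (g : T -> R[i]) :
  measurable_complex g -> measurable_fun setT (fun t => tcos b (g t)).
Proof.
move=> mg; have mc := measurable_complex_cst T (expi b : R[i]).
by have [] := measurable_complex_mul mg mc.
Qed.

Lemma bounded_integrable d (T : measurableType d) (P : probability T R) (g : T -> R) :
  measurable_fun setT g -> (forall x, `|g x| <= 1) ->
  P.-integrable setT (EFin \o g).
Proof.
move=> mg g1; apply: measurable_bounded_integrable => //.
  by apply: fin_num_fun_lty; exact: fin_num_measure.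
by exists 1; split; [exact: num_real|move=> N N1 x _; exact: le_trans (g1 x) (ltW N1)].
Qed.

Lemma integral_haar1_chi (k : int) (b : R) : k != 0 ->
  (\int[@haar1 R]_x (tcos b (chi (x *~ k)))%:E = 0)%E.
Proof.
move=> k0; pose g (x : torus R) := tcos b (chi (x *~ k)).
have mg : measurable_fun setT g by apply: measurable_tcos; exact: measurable_chi_mulz.
have g1 x : `|g x| <= 1 by apply: tcos_le1; rewrite cabs_chi.
have ig := bounded_integrable (@haar1 R) mg g1.
have i1 : (@haar1 R).-integrable setT (EFin \o (fun=> 1 : R)).
  by apply: bounded_integrable => // x; rewrite normr1.
have H : (\int[@haar1 R]_x (1 + g x)%:E = 1)%E.
  have m1g : measurable_fun setT (fun x => (1 + g x)%:E : \bar R).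
    by apply/measurable_EFinP; apply: measurable_funD => //; exact: measurable_cst.
  have g0 x : (0 <= (1 + g x)%:E)%E.
    by rewrite lee_fin; have := g1 x; rewrite ler_norml; lra.
  rewrite (@eq_measure_integral _ _ _ _
    (pushforward (uniform_prob (@ltr01 R)) (@torus_pi R))); last first.
    by move=> mpi A mA _; exact: haar1_uniform mA.
  move=> mpi; rewrite ge0_integral_pushforward//.
  rewrite /= integral_uniform//.
  rewrite subr0 invr1 mul1e -(integral_cos_affine b k0).
  apply: eq_integral => t _ /=; congr (1 + _)%:E.
  by rewrite /g -torus_pi_mulz chi_pi tcos_expi -mulrzr mulrA mulrAC.
  exact: measurable_torus_pi.
move: H; under eq_integral do rewrite EFinD.
rewrite integralD//.
rewrite integral_cst//.
have -> : (@haar1 R : {measure set _ -> \bar R}) setT = 1%E by exact: (@probability_setT _ _ _ (@haar1 R)).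
rewrite mule1.
have fg := integrable_fin_num measurableT ig.
rewrite -/g -[X in (_ + X)%E](fineK fg) -EFinD => -[] /eqP.
rewrite -subr_eq0 addrAC subrr add0r => /eqP e0.
by rewrite -(fineK fg) e0.
Qed.

End haar_one.

Section haar_characters.
Context {R : realType}.
Implicit Types (n : nat) (h : nat -> int) (b : R).

Definition torus_lin n h (xs : n.-tuple (torus R)) : torus R :=
  \sum_(i < n) tnth xs i *~ h i.

Lemma torus_lin_cons n h (x : torus R) (xs : n.-tuple (torus R)) :
  torus_lin h (tuple_cons (x, xs)) = x *~ h 0%N + torus_lin (fun i => h i.+1) xs.
Proof.
rewrite /torus_lin big_ord_recl; congr (_ + _).
by apply: eq_bigr => i _; rewrite tnthS.
Qed.

Lemma measurable_chi_torus_lin n h :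
  measurable_complex (fun xs : n.-tuple (torus R) => chi (torus_lin h xs)).
Proof.
rewrite (_ : (fun xs => _) = fun xs : n.-tuple (torus R) =>
   \prod_(i < n) chi (tnth xs i *~ h i)).
  apply: measurable_complex_prod => i.
  exact: (measurable_complex_comp (measurable_tnth i) (measurable_chi_mulz (h i))).
by apply/funext => xs; rewrite chi_sum.
Qed.

(** The integral over the last coordinates is independent of the first one, so
    that the integral of a character vanishes as soon as one of its frequencies
    is non-zero. *)
Lemma integral_haar_chi n h b :
  (\int[haar R n]_xs (tcos b (chi (torus_lin h xs)))%:E =
   (`[< forall i, (i < n)%N -> h i = 0 >]%:R * cos b)%:E)%E.
Proof.
elim: n h b => [|n IHn] h b.
  have mf : measurable_fun setT (fun xs : 0.-tuple (torus R) =>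
      (tcos b (chi (torus_lin h xs)))%:E).
    by apply/measurable_EFinP; apply: measurable_tcos; exact: measurable_chi_torus_lin.
  rewrite [LHS]integral_dirac// diracT mul1e /torus_lin big_ord0 chi0.
  rewrite -expi0 tcos_expi add0r asboolT ?mul1r//.
have mg := measurable_tcos b (measurable_chi_torus_lin n.+1 h).
have g1 (xs : n.+1.-tuple (torus R)) : `|tcos b (chi (torus_lin h xs))| <= 1.
  by apply: tcos_le1; rewrite cabs_chi.
pose u : torus R * n.-tuple (torus R) -> n.+1.-tuple (torus R) := @tuple_cons _ (torus R) n.
have mu_ : measurable_fun setT u by exact: measurable_funPT.
pose f (z : torus R * n.-tuple (torus R)) : \bar R := (tcos b (chi (torus_lin h (u z))))%:E.
have mf : measurable_fun setT (fun z => tcos b (chi (torus_lin h (u z)))).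
  exact: (measurableT_comp mg).
have If : (@haar1 R \x haar R n)%E.-integrable setT f.
  exact: (bounded_integrable (prod_prob (@haar1 R) (haar R n)) mf (fun z => g1 (u z))).
transitivity (\int[(@haar1 R \x haar R n)%E]_z f z)%E.
  rewrite [LHS](integral_distribution (P := prod_prob (@haar1 R) (haar R n))
    (X := @tuple_cons _ (torus R) n))//.
  exact/measurable_EFinP.
rewrite -integral12_prod_meas1// /fubini_F /f.
have inner x : (\int[haar R n]_y (tcos b (chi (torus_lin h (u (x, y)))))%:E =
    (`[< forall i, (i < n)%N -> h i.+1 = 0 >]%:R * tcos b (chi (x *~ h 0%N)))%:E)%E.
  have E y : tcos b (chi (torus_lin h (u (x, y)))) =
     tcos (2 * pi * repr_torus (x *~ h 0%N) + b) (chi (torus_lin (fun i => h i.+1) y)).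
    rewrite torus_lin_cons chiD /tcos expiD [chi (x *~ _)]/chi; congr complex.Re; ring.
  under eq_integral do rewrite E.
  by rewrite IHn /chi tcos_expi.
under eq_integral do rewrite inner.
case: (asboolP (forall i, (i < n)%N -> h i.+1 = 0)) => [h0|h0]; last first.
  under eq_integral do rewrite mul0r.
  rewrite integral0 asboolF ?mul0r// => H; apply: h0 => i iN; exact: H.
under eq_integral do rewrite mul1r.
have [h00|h00] := eqVneq (h 0%N) 0; last first.
  rewrite integral_haar1_chi// asboolF ?mul0r// => H.
  by move/eqP: h00; apply; exact: H.
rewrite h00 (eq_integral (cst (cos b)%:E)) => [|x _]; last first.
  by rewrite mulr0z chi0 -expi0 tcos_expi add0r.
rewrite integral_cst//.
have -> : (@haar1 R : {measure set _ -> \bar R}) setT = 1%E.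
  exact: (@probability_setT _ _ _ (@haar1 R)).
rewrite mule1 asboolT ?mul1r// => -[|i] iN //; exact: h0.
Qed.

End haar_characters.

(** * Polynomial orbits *)

(** The polynomial [k (k - 1) ... (k - j + 1) / j!] in the integer [k], of any
    sign. *)
Definition zbinom (k : int) (j : nat) : int :=
  match k with
  | Posz n => 'C(n, j)%:Z
  | Negz n => (-1) ^+ j * 'C(n + j, j)%:Z
  end.

Lemma zbinom0 k : zbinom k 0 = 1.
Proof. by case: k => n; rewrite /= bin0. Qed.

Lemma zbinomS k j : zbinom (k + 1) j.+1 = zbinom k j.+1 + zbinom k j.
Proof.
case: k => [n|[|n]].
- by rewrite -PoszD addn1 /= binS PoszD.
- have -> : Negz 0 + 1 = 0 by [].
  by rewrite /= !add0n !binn exprS bin_small// !mulr1 mulN1r addNr.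
- have -> : Negz n.+1 + 1 = Negz n by rewrite !NegzE; lia.
  rewrite /= !addnS !addSn [in RHS]binS exprS !PoszD; ring.
Qed.

Lemma zbinom_rec k j : (k - j%:Z) * zbinom k j = j.+1%:Z * zbinom k j.+1.
Proof.
case: k => n /=.
- rewrite -[RHS]/((j.+1 * 'C(n, j.+1))%N%:Z) mul_bin_left.
  have [nj|jn] := ltnP n j; first by rewrite bin_small// muln0 mulr0.
  by rewrite PoszM -subzn.
- have := mul_bin_diag (n + j).+1 j; rewrite addnS /= => /(congr1 Posz).
  rewrite !PoszM NegzE exprS => h.
  transitivity ((-1) ^+ j.+1 * ((n + j).+1%:Z * 'C(n + j, j)%:Z)).
    by rewrite exprS -addSn PoszD; ring.
  by rewrite h exprS; ring.
Qed.

Lemma power_zbinom i : exists c : nat -> int, c i = i`!%:Z /\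
  forall k, k ^+ i = \sum_(j < i.+1) c j * zbinom k j.
Proof.
elim: i => [|i [c [ci IHi]]].
  exists (fun=> 1); split => // k; by rewrite big_ord_recl big_ord0 zbinom0 addr0 mulr1.
exists (fun j => (if j is j'.+1 then c j' * j%:Z else 0) +
                 (if (j <= i)%N then c j * j%:Z else 0)).
split; first by rewrite ltnn addr0 ci factS PoszM mulrC.
move=> k; rewrite exprS IHi mulr_sumr.
under [RHS]eq_bigr do rewrite mulrDl.
rewrite big_split/= [X in X + _]big_ord_recl mul0r add0r [X in _ + X]big_ord_recr/=.
rewrite ltnn mul0r addr0 -big_split; apply: eq_bigr => j _ /=.
rewrite -ltnS ltn_ord.
have h := zbinom_rec k j; have -> : c j * bump 0 j * zbinom k (bump 0 j) =
  c j * (j.+1%:Z * zbinom k j.+1) by rewrite /bump/= add1n mulrA.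
by rewrite -h; ring.
Qed.

Definition bin_moment (v : config) (j : nat) : int :=
  \sum_(p <- v) (-1) ^+ p.2 * zbinom p.1 j.

Lemma moment_bin_moment (v : config) i : exists c : nat -> int, c i = i`!%:Z /\
  moment v i = \sum_(j < i.+1) c j * bin_moment v j.
Proof.
have [c [ci H]] := power_zbinom i; exists c; split => //.
rewrite /moment; under eq_bigr do rewrite H mulr_sumr.
rewrite exchange_big; apply: eq_bigr => j _ /=.
by rewrite mulr_sumr; apply: eq_bigr => p _; rewrite mulrCA.
Qed.

(** The power and the binomial moments are related by a triangular system with
    non-zero diagonal. *)
Lemma moments_vanish_bin q (v : config) :
  moments_vanish q v <-> forall j, (j < q)%N -> bin_moment v j = 0.
Proof.
split => H.
  elim/ltn_ind => j IHj jq; have [c [cj]] := moment_bin_moment v j.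
  rewrite H// big_ord_recr/= big1 => [|l _]; last first.
    by rewrite IHj ?mulr0// (ltn_trans _ jq).
  rewrite add0r cj => /esym/eqP; rewrite mulf_eq0 => /orP[|/eqP//].
  by rewrite eqz_nat gtn_eqF// fact_gt0.
move=> i iq; have [c [_ ->]] := moment_bin_moment v i.
by apply: big1 => j _; rewrite H ?mulr0// (leq_trans (ltn_ord j)).
Qed.

Section orbits.
Context {R : realType}.
Local Notation X := (seqspace R).

(** The [k]-th value of the polynomial sequence with binomial coefficients [y],
    the leading one first. *)
Definition orbit_pt d (y : Yd R d) (k : int) : torus R :=
  torus_lin (fun i => zbinom k (d - i)) y.

Lemma chi_unit_disc (x : torus R) : (chi x : R[i]^o) \in @unit_disc R.
Proof. by apply/mem_set/unit_disc_cabs; rewrite cabs_chi. Qed.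

Definition poly_orbit d (y : Yd R d) : X :=
  fun k => exist _ (chi (orbit_pt y k) : R[i]^o) (chi_unit_disc (orbit_pt y k)).

Lemma seq_coord_orbit d (y : Yd R d) k : seq_coord (poly_orbit y) k = chi (orbit_pt y k).
Proof. by []. Qed.

(** Pascal's rule, applied to each coefficient. *)
Lemma orbit_pt_S d (y : Yd R d) k : orbit_pt (S_d y) k = orbit_pt y (k + 1).
Proof.
rewrite /orbit_pt /torus_lin.
pose z i : torus R := if i is i'.+1 then tnth y (inord i') else 0.
transitivity (\sum_(i < d.+1) (tnth y i + z i) *~ zbinom k (d - i)).
  apply: eq_bigr => i _; rewrite tnth_mktuple; congr (_ *~ _).
  by case: i => -[|i] iN /=; rewrite ?addr0.
under eq_bigr do rewrite mulrzDl.
rewrite big_split/= [X in X + _]big_ord_recr [RHS]big_ord_recr /=.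
rewrite [X in _ + _ + X]big_ord_recl /= mul0rz add0r subnn !zbinom0.
rewrite addrAC -big_split; congr (_ + _); apply: eq_bigr => i _ /=.
have -> : tnth y (inord i) = tnth y (widen_ord (leqnSn d) i).
  by congr tnth; apply/val_inj; rewrite /= inordK// ltnS ltnW.
rewrite -mulrzDr; congr (_ *~ _).
have iN := ltn_ord i.
have -> : (d - i = (d - bump 0 i).+1)%N by rewrite /bump/=; lia.
by rewrite zbinomS.
Qed.

Lemma orbit_S d (y : Yd R d) : poly_orbit (S_d y) = seq_shift (poly_orbit y).
Proof.
apply/funext => k; apply/val_inj => /=.
by rewrite orbit_pt_S.
Qed.

Lemma monomial_orbit (v : config) d (y : Yd R d) :
  monomial v (poly_orbit y) = chi (torus_lin (fun i => bin_moment v (d - i)) y).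
Proof.
have -> : torus_lin (fun i => bin_moment v (d - i)) y =
    \sum_(p <- v) orbit_pt y p.1 *~ ((-1) ^+ p.2).
  rewrite /torus_lin /bin_moment.
  under eq_bigr do rewrite mulrz_sumr.
  rewrite exchange_big; apply: eq_bigr => p _ /=.
  rewrite /orbit_pt /torus_lin mulrz_suml; apply: eq_bigr => i _.
  by rewrite -mulrzA mulrC.
rewrite chi_sum /monomial; apply: eq_bigr => -[k b] _.
by rewrite /coord_factor/=; case: b => /=; rewrite ?expr1 ?expr0 ?mulrN1z ?mulr1z ?chiN.
Qed.

Lemma integral_orbit_monomial (v : config) d (b : R) :
  (\int[nu_d R d]_y (tcos b (monomial v (poly_orbit y)))%:E =
   (vanish_ind d.+1 v * cos b)%:E)%E.
Proof.
under eq_integral do rewrite monomial_orbit.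
rewrite /nu_d [LHS]integral_haar_chi /vanish_ind; congr ((nat_of_bool _)%:R * _)%:E.
apply: asbool_equiv_eq; rewrite moments_vanish_bin; split => H j jd.
  by have := H (d - j)%N; rewrite subKn//; apply; rewrite ltnS leq_subr.
by apply: H; rewrite ltnS leq_subr.
Qed.

(** * Measurability of maps into the sequence space *)

(** The indicator of an open set is a limit of continuous functions, which are
    limits of trigonometric polynomials; monomials are therefore enough to test
    measurability. *)
Lemma measurable_into_seqspace d (T : measurableType d) (u : T -> X) :
  (forall v, measurable_complex (fun t => monomial v (u t))) ->
  measurable_fun setT u.
Proof.
move=> mu_.
have mtp (s : trig_poly (R := R)) : measurable_complex (fun t => tp_eval s (u t)).
  elim: s => [|[a v] s [IHr IHi]].
    rewrite (_ : (fun t => _) = fun=> 0); first exact: measurable_complex_cst.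
    by apply/funext => t; rewrite /tp_eval big_nil.
  have [mr mi] := measurable_complex_mul (measurable_complex_cst T a) (mu_ v).
  split.
  - rewrite (_ : (fun t => _) = fun t => complex.Re (a * monomial v (u t)) +
       complex.Re (tp_eval s (u t))); first exact: measurable_funD.
    by apply/funext => t; rewrite /tp_eval big_cons raddfD.
  - rewrite (_ : (fun t => _) = fun t => complex.Im (a * monomial v (u t)) +
       complex.Im (tp_eval s (u t))); first exact: measurable_funD.
    by apply/funext => t; rewrite /tp_eval big_cons raddfD.
have mcont phi : continuous phi -> measurable_fun setT (fun t => phi (u t) : R).
  move=> /continuous_approximable aphi.
  have /choice[s Hs] : forall n : nat, exists s, forall x,
      `|phi x - complex.Re (tp_eval s x)| <= n.+1%:R^-1.
    by move=> n; apply: aphi; rewrite invr_gt0 ltr0n.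
  apply: (@measurable_fun_cvg _ _ _ _ (fun n t => complex.Re (tp_eval (s n) (u t)))).
    by move=> n; have [] := mtp (s n).
  move=> t _; apply/cvgrPdist_le => e e0; near=> n.
  apply: le_trans (Hs n (u t)) _; apply: ltW.
  by near: n; exact: near_infty_natSinv_lt (PosNum e0).
apply: (@measurability _ _ _ _ setT u (@open X)) => //.
move=> _ [U oU <-]; rewrite setTI.
have -> : u @^-1` U = \bigcup_n ((fun t => open_bump n U (u t)) @^-1` [set r | 0 < r]).
  apply/seteqP; split => [t Ut|t [n _ /= tn]].
    have := open_bump_cvg (x := u t) oU.
    rewrite indicE mem_set// => /cvgrPdist_lt/(_ 1 ltr01)[n _ /(_ n (leqnn n))] h.
    by exists n => //=; move: h; rewrite ltr_norml /=; lra.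
  apply: contrapT => Ut; move: tn.
  by rewrite /open_bump outer_dist_out// mulr0 lt_min ltxx andbF.
apply: bigcup_measurable => n _.
have := mcont _ (@continuous_open_bump R n U) measurableT [set r | 0 < r].
rewrite setTI; apply; rewrite (_ : [set r | 0 < r] = `]0, +oo[%classic).
  exact: measurable_itv.
by apply/seteqP; split => r /=; rewrite in_itv/= andbT.
Unshelve. all: by end_near. Qed.

Lemma measurable_orbit d : measurable_fun setT (@poly_orbit d).
Proof.
apply: measurable_into_seqspace => v.
under [X in measurable_complex X]eq_fun do rewrite monomial_orbit.
exact: measurable_chi_torus_lin.
Qed.

End orbits.

(** * The law of a random polynomial orbit *)

Section furstenberg_measure.
Context {R : realType}.
Local Notation X := (seqspace R).
Variables (c : R) (hc : 0 < c).

Definition zorbit (z : Zc c) : X := poly_orbit (projT2 z).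

Lemma zorbit_Rc (z : Zc c) : zorbit (Rc z) = seq_shift (zorbit z).
Proof. by rewrite /zorbit /= orbit_S. Qed.

Lemma measurable_zorbit : measurable_fun setT zorbit.
Proof.
move=> _ A mA; rewrite setTI.
have H : du_measurable (T := @Zfam R c) (zorbit @^-1` A).
  by move=> i; have := @measurable_orbit R (val i) measurableT A mA; rewrite setTI.
exact: H.
Qed.

HB.instance Definition _ := isMeasurableFun.Build _ _ (Zc c) X zorbit measurable_zorbit.

Definition mu_c : probability X R := distribution (nuZ hc) zorbit.

Let weight (d : nat) : {nonneg R} :=
  if (ceiln c <= d)%N then `|d%:R^-1 - d.+1%:R^-1 : R|%:nng else 0%:nng.

Let weightE d : (ceiln c <= d)%N -> (weight d)%:num = d%:R^-1 - d.+1%:R^-1.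
Proof.
move=> cd; rewrite /weight cd /= ger0_norm// subr_ge0.
have d0 : (0 < d)%N := leq_trans (ceiln_gt0 hc) cd.
by rewrite lef_pV2 ?posrE ?ltr0n// ler_nat.
Qed.

Let weightE0 d : ~~ (ceiln c <= d)%N -> (weight d)%:num = 0.
Proof. by rewrite /weight => /negbTE ->. Qed.

Let weight0_ge0 : 0 <= 1 - c / (ceiln c)%:R.
Proof. by rewrite subr_ge0 ler_pdivrMr ?mul1r ?le_ceiln// ltr0n ceiln_gt0. Qed.

(** The same weighted sum, built from operations on measures, for which the
    integral is known to be additive. *)
Let mixture : {measure set (Zc c) -> \bar R} :=
  measure_add (mscale (NngNum weight0_ge0) (@nu_piece R c (floorn c)))
    (mscale (NngNum (ltW hc))
      (mseries (fun d => mscale (weight d) (@nu_piece R c d)) 0)).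

Let nuZ_mixture A : nuZ hc A = mixture A.
Proof.
rewrite /nuZ [RHS]measure_addE; congr (_ + _ * _)%E.
rewrite eseries_cond eseries_mkcond; apply: eq_eseriesr => d _.
transitivity (((weight d)%:num)%:E * @nu_piece R c d A)%E; last by [].
case: ifPn => cd; first by rewrite weightE.
by rewrite weightE0// mul0e.
Qed.

Lemma integral_nuZ (g : Zc c -> \bar R) : measurable_fun setT g ->
  (forall z, 0 <= g z)%E ->
  (\int[nuZ hc]_z g z = (1 - c / (ceiln c)%:R)%:E * \int[@nu_piece R c (floorn c)]_z g z +
   c%:E * \sum_(ceiln c <= d <oo) (d%:R^-1 - d.+1%:R^-1)%:E * \int[@nu_piece R c d]_z g z)%E.
Proof.
move=> mg g0.
rewrite (eq_measure_integral mixture); last by move=> A _ _; exact: nuZ_mixture.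
rewrite ge0_integral_measure_add// ge0_integral_mscale// ge0_integral_mscale//.
congr (_ + _ * _)%E; rewrite ge0_integral_measure_series// [RHS]eseries_cond [RHS]eseries_mkcond.
apply: eq_eseriesr => d _; rewrite ge0_integral_mscale//.
by case: ifPn => cd; [rewrite weightE|rewrite weightE0// mul0e].
Qed.

End furstenberg_measure.

Section moments_of_mu.
Context {R : realType}.
Local Notation X := (seqspace R).
Variables (c : R) (hc : 0 < c).

(** Adding [1] makes the integrand non-negative, as the formula for integrals
    against [nuZ] requires. *)
Let shifted (b : R) (v : config) (x : X) : \bar R := (1 + tcos b (monomial v x))%:E.

Let shifted_ge0 b v x : (0 <= shifted b v x)%E.
Proof.
rewrite lee_fin; have := tcos_le1 b (monomial_cabs v x).
by rewrite ler_norml; lra.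
Qed.

Lemma measurable_complex_monomial (v : config) :
  measurable_complex (@monomial R v).
Proof. by have [[hr _] [hi _]] := bounded_measurable_monomial (R := R) v. Qed.

Let measurable_shifted b v : measurable_fun setT (shifted b v).
Proof.
apply/measurable_EFinP; apply: measurable_funD; first exact: measurable_cst.
by apply: measurable_tcos; exact: measurable_complex_monomial.
Qed.

Lemma integral_nu_piece (d : nat) b v : (floorn c <= d)%N ->
  (\int[@nu_piece R c d]_z shifted b v (zorbit z) =
   (1 + vanish_ind d.+1 v * cos b)%:E)%E.
Proof.
move=> cd; pose i : Zindex c := insubd (point : Zindex c) d.
have iE : val i = d by rewrite /i insubdK.
have msz : measurable_fun setT (fun z : Zc c => shifted b v (zorbit z)).
  by apply: measurableT_comp; [exact: measurable_shifted|exact: measurable_zorbit].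
transitivity (\int[nu_d R (val i)]_y shifted b v (poly_orbit y))%E.
  by rewrite [LHS](@ge0_integral_pushforward _ _ _ _ _ (inj_piece i : Zfam i -> Zc c))//.
have mt : measurable_fun setT (fun y : Yd R (val i) => tcos b (monomial v (poly_orbit y))).
  apply: measurable_tcos.
  exact: (measurable_complex_comp (@measurable_orbit R (val i)) (measurable_complex_monomial v)).
have t1 (y : Yd R (val i)) : `|tcos b (monomial v (poly_orbit y))| <= 1.
  by apply: tcos_le1; exact: monomial_cabs.
under eq_integral do rewrite /shifted EFinD.
rewrite integralD//; last 2 first.
- by apply: (bounded_integrable (nu_d R (val i))) => // y; rewrite normr1.
- exact: (bounded_integrable (nu_d R (val i)) mt t1).
rewrite integral_orbit_monomial integral_cst// [X in (1 * X + _)%E](_ : _ = 1%E).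
  by rewrite mule1 -EFinD iE.
exact: (@probability_setT _ _ _ (nu_d R (val i))).
Qed.

Let telescope D : (ceiln c <= D)%N ->
  \sum_(ceiln c <= d < D) (d%:R^-1 - d.+1%:R^-1) = (ceiln c)%:R^-1 - D%:R^-1 :> R.
Proof.
move=> cD; have := @telescope_sumr R (ceiln c) D (fun k => - k%:R^-1) cD.
rewrite opprK addrC => <-; apply: eq_bigr => d _; rewrite opprK addrC //.
Qed.

Lemma floorn_le_ceiln : (floorn c <= ceiln c)%N.
Proof.
by rewrite -(ler_nat R); apply: le_trans (floorn_le hc) (le_ceiln hc).
Qed.

Lemma integral_mu_c b v :
  (\int[mu_c hc]_x tcos b (monomial v x))%R = total_mass c v * cos b.
Proof.
have mt : measurable_fun setT (fun x : X => tcos b (monomial v x)).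
  by apply: measurable_tcos; exact: measurable_complex_monomial.
have It := bounded_integrable (mu_c hc) mt (fun x => tcos_le1 b (monomial_cabs v x)).
have key : (\int[mu_c hc]_x shifted b v x = (1 + total_mass c v * cos b)%:E)%E.
  have msz : measurable_fun setT (fun z : Zc c => shifted b v (zorbit z)).
    by apply: measurableT_comp; [exact: measurable_shifted|exact: measurable_zorbit].
  transitivity (\int[nuZ hc]_z shifted b v (zorbit z))%E.
    by rewrite [LHS](@ge0_integral_pushforward _ _ _ _ _ (@zorbit R c)).
  transitivity ((1 - c / (ceiln c)%:R)%:E * (1 + vanish_ind (floorn c).+1 v * cos b)%:E +
    c%:E * \sum_(ceiln c <= d <oo)
      ((d%:R^-1 - d.+1%:R^-1) * (1 + vanish_ind d.+1 v * cos b))%:E)%E.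
    rewrite (integral_nuZ hc msz (fun z => shifted_ge0 b v (zorbit z))).
    congr (_ * _ + _ * _)%E; first exact: integral_nu_piece.
    rewrite eseries_cond [RHS]eseries_cond; apply: eq_eseriesr => d /= cd.
    rewrite EFinM; congr (_ * _)%E; apply: integral_nu_piece.
    exact: leq_trans floorn_le_ceiln cd.
  pose S D : R := \sum_(ceiln c <= d < D) (d%:R^-1 - d.+1%:R^-1) * (1 + vanish_ind d.+1 v * cos b).
  have ES D : (ceiln c <= D)%N -> c * S D =
      c / (ceiln c)%:R - c / D%:R + (mass c D v - (1 - c / (ceiln c)%:R) * vanish_ind (floorn c).+1 v) * cos b.
    move=> cD; rewrite /mass [X in _ + X * cos b]addrAC subrr add0r -mulrA -mulrBr -telescope// -mulrDr.
    congr (_ * _); rewrite /S mulr_suml -big_split; apply: eq_bigr => d _ /=; ring.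
  pose l : R := c / (ceiln c)%:R + (total_mass c v - (1 - c / (ceiln c)%:R) * vanish_ind (floorn c).+1 v) * cos b.
  have cS : c * S D @[D --> \oo] --> l.
    apply: cvg_trans (_ : c / (ceiln c)%:R - c * D%:R^-1 + (mass c D v - (1 - c / (ceiln c)%:R) * vanish_ind (floorn c).+1 v) * cos b @[D --> \oo] --> l).
      apply: near_eq_cvg; near=> D; apply/esym/ES; near: D; exact: nbhs_infty_ge.
    apply: cvgD.
      rewrite -[X in _ --> X]subr0 -[X in _ - X](mulr0 c).
      apply: cvgB; first exact: cvg_cst.
      apply: cvgM; first exact: cvg_cst.
      apply/gtr0_cvgV0; last exact: cvgr_idn.
      by near=> n; rewrite ltr0n; near: n; exact: nbhs_infty_gt.
    apply: cvgM; last exact: cvg_cst.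
    by apply: cvgB; [exact: mass_cvg|exact: cvg_cst].
  have cS' : S D @[D --> \oo] --> c^-1 * l.
    rewrite (_ : (fun D => S D) = fun D => c^-1 * (c * S D)).
      by apply: cvgM => //; exact: cvg_cst.
    by apply/funext => D; rewrite mulKf// gt_eqF.
  rewrite (@cvg_lim _ _ _ _ _ _ (c^-1 * l)%:E)//; last first.
    rewrite (_ : (fun n => _) = EFin \o S); last first.
      by apply/funext => D; rewrite sumEFin.
    by apply: cvg_EFin; [near=> n|].
  rewrite -!EFinM -EFinD mulVKf ?gt_eqF// /l; congr EFin; ring.
move: key; under eq_integral do rewrite /shifted EFinD.
rewrite integralD//; last first.
  by apply: (bounded_integrable (mu_c hc)) => // y; rewrite normr1.
rewrite integral_cst// [X in (1 * X + _)%E](_ : _ = 1%E); last first.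
  exact: (@probability_setT _ _ _ (mu_c hc)).
rewrite mule1 -[X in (_ + X)%E](fineK (integrable_fin_num measurableT It)) -EFinD.
by move=> [] /addrI.
Unshelve. all: by end_near. Qed.

Lemma integral_mu_c_Re v :
  (\int[mu_c hc]_x complex.Re (monomial v x))%R = total_mass c v.
Proof.
rewrite -[RHS]mulr1 -cos0 -integral_mu_c; apply: eq_Rintegral => x _.
by rewrite /tcos expi0 mulr1.
Qed.

Lemma integral_mu_c_Im v :
  (\int[mu_c hc]_x complex.Im (monomial v x))%R = 0.
Proof.
rewrite -[RHS](mulr0 (total_mass c v)) -(cos_pihalf R) -cosN -integral_mu_c.
apply: eq_Rintegral => x _; rewrite /tcos /expi cosN cos_pihalf sinN sin_pihalf.
by case: (monomial v x) => ? ? /=; ring.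
Qed.

End moments_of_mu.

(** * A Borel argument *)

Section argument.
Context {R : realType}.

(** The half-angle formula gives a Borel determination of the argument in full
    turns, valid on the whole unit circle. *)
Definition turn (z : R[i]) : R :=
  if complex.Re z == -1 then 2^-1
  else (2 * atan (complex.Im z / (1 + complex.Re z))) / (2 * pi).

Lemma expi_turn (z : R[i]) : `|z| = 1 -> expi (2 * pi * turn z) = z.
Proof.
have pi0 : 2 * pi != 0 :> R by rewrite mulf_neq0 ?pnatr_eq0// gt_eqF// pi_gt0.
move=> z1; have : complex.Re z ^+ 2 + complex.Im z ^+ 2 = 1.
  by have := add_Re2_Im2 z; rewrite z1 expr1n => -[].
rewrite /turn; case: z z1 => u v /= _ uv.
case: eqP => [u1|/eqP u1].
  have v0 : v = 0.
    by apply/eqP; rewrite -sqrf_eq0; apply/eqP; move: uv; rewrite u1 sqrrN expr1n; lra.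
  have -> : 2 * pi / 2 = pi :> R by field.
  by rewrite /expi cospi sinpi u1 v0.
have u10 : 1 + u != 0 by rewrite addrC addr_eq0.
rewrite mulrCA divff// mulr1; set t := v / (1 + u); set a := atan t.
have c0 : cos a != 0.
  by rewrite gt_eqF// cos_gt0_pihalf// atan_gtNpi2 atan_ltpi2.
have ta : sin a = t * cos a.
  by have := atanK t; rewrite -/a /tan => <-; rewrite divfK.
have ca : cos a ^+ 2 * 2 = 1 + u.
  have h := cos2Dsin2 a; rewrite ta in h.
  have ht : (1 + t ^+ 2) * (1 + u) = 2.
    have -> : (1 + t ^+ 2) * (1 + u) = ((1 + u) ^+ 2 + v ^+ 2) / (1 + u).
      by rewrite /t; field.
    apply: (mulIf u10); rewrite divfK//; move: uv; rewrite !expr2; lra.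
  have -> : 2 = (1 + t ^+ 2) * (1 + u) by [].
  rewrite mulrA; have -> : cos a ^+ 2 * (1 + t ^+ 2) = cos a ^+ 2 + (t * cos a) ^+ 2 by ring.
  by rewrite h mul1r.
apply/eqP; rewrite eq_complex/= mulr_natl mulr2n cosD sinD ta; apply/andP; split; apply/eqP.
  have -> : cos a * cos a - t * cos a * (t * cos a) = cos a ^+ 2 * 2 - (cos a ^+ 2 + (t * cos a) ^+ 2) by ring.
  by rewrite -ta cos2Dsin2 ca addrC addKr.
have -> : t * cos a * cos a + cos a * (t * cos a) = t * (cos a ^+ 2 * 2) by ring.
by rewrite ca /t divfK.
Qed.

Lemma torus_pi_turn (x : torus R) : torus_pi (turn (chi x)) = x.
Proof. by apply: chi_inj; rewrite chi_pi expi_turn// norm_expi. Qed.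

Lemma measurable_inv_real : measurable_fun setT (fun x : R => x^-1).
Proof.
have -> : [set: R] = [set x | x != 0] `|` [set 0].
  by apply/seteqP; split => // x _ /=; have [->|] := eqVneq x 0; [right|left].
have oD : open [set x : R | x != 0] by exact: open_neq.
apply/measurable_funU; [exact: open_measurable|exact: measurable_set1|split].
  apply: open_continuous_measurable_fun => // x; rewrite inE => x0.
  exact: inv_continuous.
exact: measurable_fun_set1.
Qed.

Lemma measurable_turn d (T : measurableType d) (g : T -> R[i]) :
  measurable_complex g -> measurable_fun setT (fun t => turn (g t)).
Proof.
move=> [gr gi]; apply: measurable_fun_if => //.
- apply: (measurable_fun_bool true); rewrite setTI.
  rewrite (_ : _ @^-1` _ = (fun t => complex.Re (g t)) @^-1` [set -1]).
    by have := gr measurableT [set -1] (measurable_set1 _); rewrite setTI.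
  by apply/seteqP; split => t /= /eqP.
- apply: (measurable_funS measurableT) => //.
  apply: measurable_funM; last exact: measurable_cst.
  apply: measurable_funM; first exact: measurable_cst.
  apply: (measurableT_comp (f := @atan R)).
    by apply: continuous_measurable_fun => t; exact: continuous_atan.
  apply: measurable_funM => //; apply: (measurableT_comp measurable_inv_real).
  by apply: measurable_funD => //; exact: measurable_cst.
Qed.

End argument.

(** * Recovering a polynomial from its orbit *)

Section recovery.
Context {R : realType}.
Local Notation X := (seqspace R).

Lemma measurable_into_torus d (T : measurableType d) (u : T -> torus R) :
  measurable_complex (fun t => chi (u t)) -> measurable_fun setT u.
Proof.
move=> /measurable_turn mu_.
rewrite (_ : u = @torus_pi R \o (fun t => turn (chi (u t)))).
  by apply: measurableT_comp; [exact: measurable_torus_pi|].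
by apply/funext => t /=; rewrite torus_pi_turn.
Qed.

Lemma measurable_chi d (T : measurableType d) (u : T -> torus R) :
  measurable_fun setT u -> measurable_complex (fun t => chi (u t)).
Proof.
move=> mu_; have := measurable_complex_comp mu_ (measurable_chi_mulz 1).
exact.
Qed.

Lemma measurable_torus_sub d (T : measurableType d) (u w : T -> torus R) :
  measurable_fun setT u -> measurable_fun setT w ->
  measurable_fun setT (fun t => u t - w t).
Proof.
move=> mu_ mw; apply: measurable_into_torus.
under [X in measurable_complex X]eq_fun do rewrite chiD.
apply: measurable_complex_mul; first exact: measurable_chi.
exact: (measurable_complex_comp mw (measurable_chi_mulz (-1))).
Qed.

Lemma measurable_torus0 : measurable [set 0 : torus R].
Proof.
rewrite (_ : [set _] = ((fun t => complex.Re (chi t)) @^-1` [set 1]) `&`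
                       ((fun t => complex.Im (chi t)) @^-1` [set 0])).
  have [mr mi] := measurable_chi (@measurable_id _ (torus R) setT).
  apply: measurableI.
    by have := mr measurableT [set 1] (measurable_set1 _); rewrite setTI.
  by have := mi measurableT [set 0] (measurable_set1 _); rewrite setTI.
apply/seteqP; split => [t ->|t [r i]]; first by split; rewrite /preimage /mkset chi0.
by apply: chi_eq1; move: r i; rewrite /preimage /mkset; case: (chi t) => a b /= -> ->.
Qed.

Definition forward_diff (u : int -> torus R) : int -> torus R :=
  fun k => u (k + 1) - u k.

Definition seq_arg (x : X) (k : int) : torus R := torus_pi (turn (seq_coord x k)).

(** Iterated differences at the origin of the arguments of a sequence: on a
    polynomial orbit they are the binomial coefficients of the polynomial. *)
Definition recover d (x : X) : Yd R d :=
  [tuple iter (d - i) forward_diff (seq_arg x) 0 | i < d.+1].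

Lemma seq_arg_orbit d (y : Yd R d) : seq_arg (poly_orbit y) = orbit_pt y.
Proof. by apply/funext => k; rewrite /seq_arg seq_coord_orbit torus_pi_turn. Qed.

Lemma iter_diff_orbit d (y : Yd R d) j k : iter j forward_diff (orbit_pt y) k =
  \sum_(i < d.+1) if (j <= d - i)%N then tnth y i *~ zbinom k (d - i - j) else 0.
Proof.
elim: j k => [|j IHj] k.
  by apply: eq_bigr => i _; rewrite subn0.
rewrite iterS /forward_diff -/forward_diff !IHj -sumrB; apply: eq_bigr => i _.
have [h|h|h] := ltngtP j (d - i)%N; last 2 first.
- by rewrite subr0.
- by rewrite h subnn !zbinom0 subrr.
rewrite -mulrzBr; congr (_ *~ _).
have -> : (d - i - j = (d - i - j.+1).+1)%N by lia.
by rewrite zbinomS addrAC subrr add0r.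
Qed.

(** At the origin, the differences of order [j] of the binomial polynomials
    vanish except in degree [j]. *)
Lemma recover_orbit d (y : Yd R d) : recover d (poly_orbit y) = y.
Proof.
apply: eq_from_tnth => i0; rewrite tnth_mktuple seq_arg_orbit iter_diff_orbit.
rewrite (bigD1 i0)//= leqnn subnn mulr1z big1 ?addr0// => i ne.
case: ifPn => // h; rewrite bin0n; case: eqP => // e.
have := ltn_ord i; have := ltn_ord i0.
by move: ne; rewrite -val_eqE /= => /eqP ne; lia.
Qed.

(** A polynomial of degree [d] cannot pass for one of higher degree with a
    non-zero leading coefficient; this separates the pieces of the model. *)
Lemma recover_orbit_higher d d' (y : Yd R d) : (d < d')%N ->
  tnth (recover d' (poly_orbit y)) ord0 = 0.
Proof.
move=> dd'; rewrite tnth_mktuple seq_arg_orbit iter_diff_orbit big1// => i _.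
by rewrite ifF//; apply/negbTE; rewrite -ltnNge/= subn0; lia.
Qed.

Lemma measurable_recover d : measurable_fun setT (recover d).
Proof.
apply/measurable_fun_tnthP => i.
rewrite (_ : _ \o _ = fun x => iter (d - i) forward_diff (seq_arg x) 0); last first.
  by apply/funext => x /=; rewrite tnth_mktuple.
move: (d - i)%N 0 => j; elim: j => [|j IHj] k /=; last first.
  by apply: measurable_torus_sub; exact: IHj.
apply: measurableT_comp; first exact: measurable_torus_pi.
apply: measurable_turn; have := measurable_complex_monomial (R := R) [:: (k, false)].
rewrite (_ : monomial _ = fun x : X => seq_coord x k)//.
by apply/funext => x; rewrite /monomial big_seq1.
Qed.

Lemma measurable_fixed_points (h : X -> X) : measurable_fun setT h ->
  measurable [set x | h x = x].
Proof.
move=> mh.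
have mt k : measurable [set x | window_term (h x) x k = 0].
  have mre : measurable_fun setT (@re_coord R k).
    by apply: continuous_measurable_seqspace; exact: continuous_re_coord.
  have mim : measurable_fun setT (@im_coord R k).
    by apply: continuous_measurable_seqspace; exact: continuous_im_coord.
  have mw : measurable_fun setT (fun x => window_term (h x) x k).
    apply: measurable_funD; apply: measurableT_comp => //; apply: measurable_funB => //.
      exact: (measurableT_comp mre mh).
    exact: (measurableT_comp mim mh).
  by have := mw measurableT [set 0] (measurable_set1 _); rewrite setTI.
rewrite (_ : [set _ | _] = (\bigcap_n [set x | window_term (h x) x (Posz n) = 0]) `&`
                           (\bigcap_n [set x | window_term (h x) x (Negz n) = 0])).
  by apply: measurableI; apply: bigcap_measurable => // n _; exact: mt.
apply/seteqP; split => [x /= xE|x [hp hn] /=].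
  by split => n _ /=; rewrite xE /window_term !subrr normr0 addr0.
have H k : window_term (h x) x k = 0 by case: k => n; [exact: hp|exact: hn].
apply: coordP => k; apply/eqP; have /eqP := H k;
  by rewrite /window_term paddr_eq0// !normr_eq0 !subr_eq0 => /andP[].
Qed.

End recovery.

(** * The isomorphism *)

Section isomorphism.
Context {R : realType}.
Local Notation X := (seqspace R).
Variables (c : R) (hc : 0 < c).

Definition leading d (y : Yd R d) : torus R := tnth y ord0.

Lemma leading_S d (y : Yd R d) : leading (S_d y) = leading y.
Proof. by rewrite /leading tnth_mktuple. Qed.

Lemma haar1_singleton0 : haar1 [set 0 : torus R] = 0%E.
Proof.
apply: (@subset_measure0 _ _ _ lebesgue_measure _ [set 0]).
- by apply: measurableI; [exact: measurable_torus0|exact: measurable_itv].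
- exact: measurable_set1.
- move=> x [] /=; rewrite -torus_pi0 => /torus_pi_eq; rewrite subr0 in_itv/=.
  by move=> /intrP[k ->]; rewrite ler0z ltrz1 => ?; have -> : k = 0 by lia.
- exact: lebesgue_measure_set1.
Qed.

Lemma measurable_leading0 d : measurable [set y : Yd R d | leading y = 0].
Proof.
have := @measurable_tnth _ (torus R) d.+1 ord0 measurableT [set 0] measurable_torus0.
by rewrite setTI.
Qed.

Lemma nu_leading0 d : nu_d R d [set y | leading y = 0] = 0%E.
Proof.
rewrite [LHS](_ : _ = (@haar1 R \x haar R d)%E ([set 0] `*` setT)).
  rewrite product_measure1E//; last exact: measurable_torus0.
  by rewrite [X in (X * _)%E](haar1_singleton0) mul0e.
rewrite /nu_d /= /distribution /pushforward /=; congr (_ _).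
apply/seteqP; split => [[x xs] /=|[x xs] [/= -> _]].
  by rewrite /leading /tnth /= => ->.
by rewrite /leading /tnth.
Qed.

(** The polynomials whose degree is exactly the index of their piece. *)
Definition generic : set (Zc c) := 
  [set z | leading (d := val (projT1 z)) (projT2 z) != 0].

Lemma measurable_generic : measurable generic.
Proof.
have H : du_measurable (T := @Zfam R c) generic.
  move=> i; rewrite (_ : _ @^-1` _ = ~` [set y | leading y = 0]).
    by apply: measurableC; exact: measurable_leading0.
  by apply/seteqP; split => y /= /eqP.
exact: H.
Qed.

Lemma generic_Rc (z : Zc c) : generic z -> generic (Rc z).
Proof. by rewrite /generic /= leading_S. Qed.

(** The leading coefficient is uniformly distributed on the torus, hence almost
    surely non-zero. *)
Lemma nuZ_not_generic : nuZ hc (~` generic) = 0%E.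
Proof.
have H d : @nu_piece R c d (~` generic) = 0%E.
  rewrite -[RHS](@nu_leading0 (val (insubd (point : Zindex c) d))).
  rewrite /nu_piece /= /distribution /pushforward; congr (_ _).
  apply/seteqP; split => y /=; rewrite /generic /= => h; last by rewrite h eqxx.
  by apply/eqP/negPn/negP.
rewrite /nuZ H mule0 add0e eseries0 ?mule0// => d _ _.
by rewrite [X in (_ * X)%E]H mule0.
Qed.

Lemma zorbit_inj (z z' : Zc c) : generic z -> generic z' ->
  zorbit z = zorbit z' -> z = z'.
Proof.
case: z z' => [i y] [i' y']; rewrite /generic /zorbit /= => g g' e.
have [h|h|/val_inj ii'] := ltngtP (val i) (val i').
- by move/negP: g'; case; have := recover_orbit_higher y h; rewrite e recover_orbit => <-.
- by move/negP: g; case; have := recover_orbit_higher y' h; rewrite -e recover_orbit => <-.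
move: y' g' e; rewrite -ii' => y' g' e.
by rewrite -(recover_orbit y) e recover_orbit.
Qed.

(** The image of a Borel set by an injective Borel map; it is shown to be Borel
    directly, as the union over [d] of the fixed points of the recovery followed by
    the orbit map. *)
Definition generic_orbits : set X := @zorbit R c @` generic.

Let idx (d : nat) : Zindex c := insubd (point : Zindex c) d.

Let piece_orbits (d : nat) : set X :=
  [set x | poly_orbit (recover (val (idx d)) x) = x] `&`
  [set x | leading (recover (val (idx d)) x) <> 0].

Let measurable_piece_orbits d : measurable (piece_orbits d).
Proof.
rewrite /piece_orbits; apply: measurableI.
  apply: measurable_fixed_points; apply: measurableT_comp; first exact: measurable_orbit.
  exact: measurable_recover.
have := @measurable_recover R (val (idx d)) measurableT
  _ (measurableC (@measurable_leading0 (val (idx d)))).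
by rewrite setTI.
Qed.

Let piece_orbitsP d x : piece_orbits d x ->
  let z : Zc c := inj_piece (idx d) (recover _ x) in
  generic z /\ zorbit z = x.
Proof. by move=> [h1 h2]; split => //=; rewrite /generic/=; apply/eqP. Qed.

Let piece_orbits_zorbit (z : Zc c) : generic z -> piece_orbits (val (projT1 z)) (zorbit z).
Proof.
case: z => i y g; rewrite /piece_orbits /idx /= valKd /zorbit /= recover_orbit.
by split => //=; exact/eqP.
Qed.

Let generic_orbitsE : generic_orbits = \bigcup_d piece_orbits d.
Proof.
apply/seteqP; split => [_ [z g <-]|x [d _ /piece_orbitsP[g e]]].
  by exists (val (projT1 z)) => //; exact: piece_orbits_zorbit.
by rewrite /generic_orbits -e; eexists; [exact: g|].
Qed.

Lemma measurable_generic_orbits : measurable generic_orbits.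
Proof. by rewrite generic_orbitsE; apply: bigcup_measurable => d _; exact: measurable_piece_orbits. Qed.

Definition zcode (x : X) : Zc c := get [set z | generic z /\ zorbit z = x].

Lemma zorbitK (z : Zc c) : generic z -> zcode (zorbit z) = z.
Proof.
move=> g; have [g' e] : [set z' | generic z' /\ zorbit z' = zorbit z] (zcode (zorbit z)).
  by apply: getPex; exists z.
exact: zorbit_inj.
Qed.

Lemma measurable_zcode : measurable_fun generic_orbits zcode.
Proof.
move=> _ C mC.
have mi i : measurable ((inj_piece i : Zfam i -> Zc c) @^-1` C) by exact: mC.
rewrite (_ : _ `&` _ = \bigcup_d (piece_orbits d `&`
  recover (val (idx d)) @^-1`
    ((inj_piece (idx d) : Zfam _ -> Zc c) @^-1` C))).
  apply: bigcup_measurable => d _; apply: measurableI => //.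
  have := @measurable_recover R (val (idx d)) measurableT _ (mi _).
  by rewrite setTI.
rewrite generic_orbitsE setI_bigcupl; apply: eq_bigcupr => d _.
apply/seteqP; split => x [h] /=; have [g e] := piece_orbitsP h.
  by rewrite -{1}e zorbitK.
by move=> Cz; split => //=; rewrite -e zorbitK.
Qed.

Lemma nuZ_eq_generic (E F : set (Zc c)) : measurable E -> measurable F ->
  E `&` generic = F `&` generic -> nuZ hc E = nuZ hc F.
Proof.
move=> mE mF EF.
have H G : measurable G -> nuZ hc G = nuZ hc (G `&` generic).
  move=> mG; have mg := measurable_generic.
  rewrite (measureDI (nuZ hc) mG mg) [X in (X + _)%E](_ : _ = 0%E) ?add0e//.
  apply: (@subset_measure0 _ _ _ (nuZ hc) _ (~` generic)); last exact: nuZ_not_generic.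
  - exact: measurableD.
  - exact: measurableC.
  - by move=> z [].
by rewrite (H _ mE) (H _ mF) EF.
Qed.

Lemma furstenberg_isomorphic :
  isomorphic_systems (mu_c hc) (@seq_shift R) (nuZ hc) (@Rc R c).
Proof.
have preA : generic `<=` @zorbit R c @^-1` generic_orbits by move=> z g; exists z.
have mpre A : measurable A -> measurable (@zorbit R c @^-1` A).
  by move=> mA; have := @measurable_zorbit R c measurableT A mA; rewrite setTI.
exists generic_orbits, generic, zcode, (@zorbit R c); split.
- split; first exact: measurable_generic_orbits.
    apply: (@subset_measure0 _ _ _ (nuZ hc) _ (~` generic)).
    + by apply: mpre; apply: measurableC; exact: measurable_generic_orbits.
    + by apply: measurableC; exact: measurable_generic.
    + by move=> z /= h g; apply: h; exact: preA.
    + exact: nuZ_not_generic.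
  move=> _ [_ [z g <-] <-]; exists (Rc z); first exact: generic_Rc.
  exact: zorbit_Rc.
- split; [exact: measurable_generic|exact: nuZ_not_generic|].
  by move=> _ [z g <-]; exact: generic_Rc.
- split; first exact: measurable_zcode.
    by move=> _ [_ [z g <-] <-]; rewrite zorbitK.
  by move=> _ [z g <-]; rewrite zorbitK.
- split.
  + by apply: measurable_funTS; exact: measurable_zorbit.
  + by move=> _ [z g <-]; exact: preA.
  + by move=> z g; rewrite zorbitK.
- split.
    move=> C mC; apply: nuZ_eq_generic => //.
      apply: mpre; apply: measurable_zcode => //; exact: measurable_generic_orbits.
    apply/seteqP; split => z [].
      by move=> [_ /=] + g; rewrite zorbitK.
    by move=> Cz g; split => //; split; [exact: preA|rewrite /= zorbitK].
  by move=> _ [z g <-]; rewrite -zorbit_Rc !zorbitK//; exact: generic_Rc.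
Qed.

End isomorphism.

(** * Invariance and correlations *)

Section monomial_translate.
Context {R : realType}.
Local Notation X := (seqspace R).
Implicit Types (v w : config) (c : R).

Lemma moments_vanish_translate q l v :
  moments_vanish q (translate l v) <-> moments_vanish q v.
Proof.
split => H.
  elim/ltn_ind => i IHi iq.
  rewrite -(@moment_translate_vanish i l)//; first exact: H.
  by move=> j ji; apply: IHi => //; exact: ltn_trans iq.
by move=> i iq; rewrite (moment_translate_vanish _ H) ?H// ltnW.
Qed.

Lemma moments_vanish_differenceP q l l' v : l != l' ->
  moments_vanish q.+1 (difference l l' v) <-> moments_vanish q v.
Proof.
move=> ll'; split; last exact: moments_vanish_difference.
move=> H; elim/ltn_ind => i IHi iq.
have vi : moments_vanish i v.
  by move=> j ji; apply: IHi => //; exact: ltn_trans iq.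
have := moment_difference l l' vi; rewrite H// => /esym/eqP.
by rewrite !mulf_eq0 /= subr_eq0 eqz_nat (negbTE ll') => /eqP.
Qed.

Lemma total_mass_ext c v w :
  (forall d, moments_vanish d.+1 v <-> moments_vanish d.+1 w) ->
  total_mass c v = total_mass c w.
Proof.
move=> vw; have e d : vanish_ind d.+1 v = vanish_ind d.+1 w :> R.
  by rewrite /vanish_ind (asbool_equiv_eq (vw d)).
rewrite /total_mass; congr (limn _); apply/funext => D.
by rewrite /mass e; under eq_bigr do rewrite e.
Qed.

Lemma total_mass_translate c l v : total_mass c (translate l v) = total_mass c v.
Proof. by apply: total_mass_ext => d; exact: moments_vanish_translate. Qed.

(** A difference at a non-zero distance vanishes to order [d + 1] exactly when the
    configuration does to order [d], whatever the distance. *)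
Lemma total_mass_difference c l l' v : l != l' ->
  total_mass c (difference l l' v) = total_mass c (difference 1 0 v).
Proof.
move=> ll'; apply: total_mass_ext => d; rewrite moments_vanish_differenceP//.
by rewrite moments_vanish_differenceP.
Qed.

Lemma monomial_iter n v (x : X) :
  monomial v (iter n (@seq_shift R) x) = monomial (translate n v) x.
Proof.
by rewrite -shiftz_iter /monomial big_map; apply: eq_bigr => -[k b] _.
Qed.

Lemma translateD m n v : translate m (translate n v) = translate (n + m) v.
Proof.
rewrite /translate -map_comp; apply: eq_map => -[k b] /=.
by rewrite PoszD addrA.
Qed.

Lemma translate0 v : translate 0 v = v.
Proof. by rewrite -[RHS]map_id; apply: eq_map => -[k b]; rewrite addr0. Qed.

Lemma measurable_seq_shift : measurable_fun setT (@seq_shift R).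
Proof.
apply: measurable_into_seqspace => v.
rewrite (_ : (fun t => _) = monomial (translate 1 v)).
  exact: measurable_complex_monomial.
by apply/funext => x; rewrite -(monomial_iter 1).
Qed.

HB.instance Definition _ :=
  isMeasurableFun.Build _ _ X X (@seq_shift R) measurable_seq_shift.

End monomial_translate.

Section shift_invariance.
Context {R : realType}.
Local Notation X := (seqspace R).
Variables (c : R) (hc : 0 < c).
Local Notation mu := (mu_c hc).

(** A translation of the configuration does not change which initial moments
    vanish. *)
Lemma mu_c_shift (C : set X) : measurable C -> mu (@seq_shift R @^-1` C) = mu C.
Proof.
move=> mC.
pose T : {mfun X >-> X} := @seq_shift R.
have H b v : (\int[distribution mu T]_x tcos b (monomial v x))%R = (\int[mu]_x tcos b (monomial v x))%R.
  have mt : measurable_fun setT (fun x : X => tcos b (monomial v x)).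
    by apply: measurable_tcos; exact: measurable_complex_monomial.
  have It : mu.-integrable setT (EFin \o (fun x => tcos b (monomial v (seq_shift x)))).
    apply: (bounded_integrable mu (measurableT_comp mt (@measurable_seq_shift R))) => x.
    by apply: tcos_le1; exact: monomial_cabs.
  have E := @integral_distribution _ _ _ _ _ mu T _ (iffRL (measurable_EFinP _ _) mt) It.
  transitivity (\int[mu]_x tcos b (monomial (translate 1 v) x))%R; last first.
    by rewrite [LHS]integral_mu_c total_mass_translate -(integral_mu_c hc).
  apply: (congr1 fine); rewrite [LHS]E; apply: eq_integral => x _ /=.
  by rewrite -(monomial_iter 1).
have := @probability_of_moments R (distribution mu T) mu _ C mC; apply => v; split.
- have := H 0 v; rewrite /tcos; under eq_Rintegral do rewrite expi0 mulr1.
  by move=> ->; under eq_Rintegral do rewrite expi0 mulr1.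
- have := H (- (pi / 2)) v. 
  have E z : tcos (- (pi / 2)) z = complex.Im z :> R.
    rewrite /tcos /expi cosN cos_pihalf sinN sin_pihalf.
    by case: z => ? ? /=; ring.
  by under eq_Rintegral do rewrite E; move=> ->; under eq_Rintegral do rewrite E.
Qed.

End shift_invariance.

(** * Eigenfunctions *)

Lemma integral_invariant (R : realType) d (Y : measurableType d)
    (P : probability Y R) (T : {mfun Y >-> Y}) (h : Y -> R) :
  (forall C, measurable C -> P (T @^-1` C) = P C) ->
  P.-integrable setT (EFin \o h) ->
  P.-integrable setT (EFin \o (h \o T)) /\
  (\int[P]_x h (T x) = \int[P]_x h x)%R.
Proof.
move=> PT ih; have [mh hfin] := integrableP _ _ _ ih.
have E (u : Y -> \bar R) : (\int[distribution P T]_x u x = \int[P]_x u x)%E.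
  by apply: eq_measure_integral => C mC _; exact: PT.
have ihT : P.-integrable setT (EFin \o (h \o T)).
  apply/integrableP; split; first exact: (measurableT_comp mh (@measurable_funPT _ _ _ _ T)).
  apply: le_lt_trans hfin; rewrite -[leRHS]E.
  rewrite (@ge0_integral_distribution _ _ _ _ _ P T (fun x => `|(EFin \o h) x|%E))//.
  exact: measurableT_comp.
split => //; apply: (congr1 fine).
by rewrite -[RHS]E [RHS](@integral_distribution _ _ _ _ _ P T (EFin \o h) mh ihT).
Qed.

Section spectrum.
Context {R : realType}.
Local Notation X := (seqspace R).

Lemma cabs_sum_sqr N (a : nat -> R[i]) : cabs (\sum_(n < N) a n) ^+ 2 =
  \sum_(n < N) \sum_(m < N) complex.Re (a n * (a m)^*%C).
Proof.
have sqr z : cabs z ^+ 2 = complex.Re (z * z^*%C) :> R.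
  by rewrite -normCK cabsE -rmorphXn.
rewrite sqr rmorph_sum mulr_suml raddf_sum; apply: eq_bigr => n _.
by rewrite mulr_sumr raddf_sum.
Qed.

(** The double sum is the square modulus of a geometric sum with ratio different
    from [1]. *)
Lemma geometric_sum_bounded (theta : R) : expi theta != 1 -> exists K : R,
  forall N, `|\sum_(n < N) \sum_(m < N) cos (n%:R * theta - m%:R * theta)| <= K.
Proof.
move=> h1; set q := expi theta in h1.
have q1 : 0 < cabs (q - 1).
  rewrite lt_neqAle cabs_ge0 andbT eq_sym; apply/negP => /eqP q0.
  move/eqP: h1; apply; apply/subr0_eq/normr0_eq0; by rewrite cabsE q0.
exists ((2 / cabs (q - 1)) ^+ 2) => N.
set S := \sum_(n < N) expi (n%:R * theta).
have -> : \sum_(n < N) \sum_(m < N) cos (n%:R * theta - m%:R * theta) = cabs S ^+ 2.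
  rewrite /S (cabs_sum_sqr N (fun n => expi (n%:R * theta))); apply: eq_bigr => n _; apply: eq_bigr => m _.
  by rewrite expiJ -expiD.
have : cabs S * cabs (q - 1) <= 2.
  rewrite -cabsM mulrC (_ : (q - 1) * S = q ^+ N - 1); last first.
    rewrite subrX1; congr (_ * _); apply: eq_bigr => n _.
    by rewrite mulr_natl expiX.
  apply: le_trans (cabsD _ _) _; rewrite -expiX cabs_expi.
  by rewrite [cabs (- 1)](_ : _ = 1)// /cabs normrN1.
rewrite ger0_norm ?sqr_ge0//.
move=> h; rewrite lerXn2r ?nnegrE ?cabs_ge0 ?divr_ge0 ?cabs_ge0// ler_pdivlMr//.
Qed.

Lemma weak_AM_GM (delta : R) (z w : R[i]) : 0 < delta ->
  complex.Re (z * w) <= delta * cabs z ^+ 2 + delta^-1 * cabs w ^+ 2.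
Proof.
move=> d0; apply: le_trans (ler_norm _) _; apply: le_trans (Re_le_cabs _) _.
rewrite cabsM; have := cabs_ge0 z; have := cabs_ge0 w.
move: (cabs z) (cabs w) => a b b0 a0.
have -> : delta * a ^+ 2 + delta^-1 * b ^+ 2 = delta^-1 * ((delta * a) ^+ 2 + b ^+ 2).
  by rewrite mulrDr exprMn [delta ^+ 2]expr2 !mulrA mulVf ?mul1r// gt_eqF.
rewrite -(ler_pM2l d0) mulVKf ?gt_eqF//.
have := sqr_ge0 (delta * a - b); have : 0 <= delta * a by rewrite mulr_ge0// ltW.
rewrite mulrA; move: (delta * a) => e e0 h; have eb : 0 <= e * b by rewrite mulr_ge0.
by move: h eb; rewrite sqrrB mulr2n; lra.
Qed.

Lemma tcos_mul b (z w : R[i]) : tcos b (z * w) =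
  complex.Re z * tcos b w + complex.Im z * tcos (b + pi / 2) w.
Proof.
rewrite /tcos /expi cosDpihalf sinDpihalf.
by case: z w => [? ?] [? ?] /=; ring.
Qed.

Lemma bounded_measurable_tcos b v :
  bounded_measurable (fun x : X => tcos b (monomial v x)).
Proof.
split; first by apply: measurable_tcos; exact: measurable_complex_monomial.
by exists 1 => x; apply: tcos_le1; exact: monomial_cabs.
Qed.

Lemma Rintegral_sum (P : probability X R) (I : Type) (s : seq I) (F : I -> X -> R) :
  (forall i, P.-integrable setT (EFin \o F i)) ->
  P.-integrable setT (EFin \o (fun x => \sum_(i <- s) F i x)) /\
  (\int[P]_x \sum_(i <- s) F i x = \sum_(i <- s) \int[P]_x F i x)%R.
Proof.
move=> iF; elim: s => [|i s [is_ IHs]].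
  split; last first.
    rewrite big_nil -[RHS](mul0r (fine (P setT))) -Rintegral_cst//.
    by apply: eq_Rintegral => x _; rewrite big_nil.
  by under eq_fun do rewrite big_nil; exact: integrable0.
split; last first.
  rewrite big_cons -IHs -RintegralD//.
  by apply: eq_Rintegral => x _; rewrite big_cons.
have := integrableD measurableT (iF i) is_.
by apply: eq_integrable => // x _; rewrite /= big_cons EFinD.
Qed.

End spectrum.

Section eigenfunctions.
Context {R : realType}.
Local Notation X := (seqspace R).
Variables (P : probability X R) (M : config -> R).
Hypothesis P_shift : forall C, measurable C -> P (@seq_shift R @^-1` C) = P C.
Hypothesis P_moment : forall b v, (\int[P]_x tcos b (monomial v x))%R = M v * cos b.
Hypothesis M_difference : forall l l' v, l != l' ->
  M (difference l l' v) = M (difference 1 0 v).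

Let integrable_tcos b v : P.-integrable setT (EFin \o (fun x => tcos b (monomial v x))).
Proof. by apply: bounded_measurable_integrable; exact: bounded_measurable_tcos. Qed.

Let M_norm v : `|M v| <= 1.
Proof.
have i1 : P.-integrable setT (EFin \o (fun=> 1 : R)).
  by apply: bounded_measurable_integrable; exact: bounded_measurable_cst.
have h b : M v * cos b <= 1.
  rewrite -P_moment; apply: (@le_trans _ _ (\int[P]_x (1 : R))%R).
    apply: le_Rintegral => // x _; apply: le_trans (ler_norm _) _.
    by apply: tcos_le1; exact: monomial_cabs.
  by rewrite Rintegral_cst// mul1r [X in fine X](@probability_setT _ _ _ P).
have := h 0; have := h pi; rewrite cos0 cospi ler_norml; lra.
Qed.

Variables (theta : R) (g : X -> R[i]).
Hypothesis theta1 : expi theta != 1.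
Hypothesis g2 : is_L2 P g.
Hypothesis g_eigen : {ae P, forall x, g (seq_shift x) = expi theta * g x}.

Let integrable_Re : P.-integrable setT (EFin \o (fun x => complex.Re (g x))).
Proof.
apply/Lfun1_integrable; apply: Lfun_subset12; first exact: fin_num_measure.
by have [] := g2.
Qed.

Let integrable_Im : P.-integrable setT (EFin \o (fun x => complex.Im (g x))).
Proof.
apply/Lfun1_integrable; apply: Lfun_subset12; first exact: fin_num_measure.
by have [] := g2.
Qed.

Let integrable_product b v :
  P.-integrable setT (EFin \o (fun x => tcos b (g x * monomial v x))).
Proof.
have h1 := integrable_mul_bounded integrable_Re (@bounded_measurable_tcos R b v).
have h2 := integrable_mul_bounded integrable_Im (@bounded_measurable_tcos R (b + pi / 2) v).
have := integrableD measurableT h1 h2.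
by apply: eq_integrable => // x _; rewrite /= tcos_mul EFinD.
Qed.

Let cabs_sqr (z : R[i]) : cabs z ^+ 2 = complex.Re z ^+ 2 + complex.Im z ^+ 2.
Proof.
have := add_Re2_Im2 z; rewrite cabsE -rmorphXn => -[<-].
by case: z => ? ?; rewrite /= !expr2.
Qed.

Let integrable_sqr : P.-integrable setT (EFin \o (fun x => cabs (g x) ^+ 2)).
Proof.
have [gr gi] := g2.
have := integrableD measurableT (Lfun2_integrable_sqr gr) (Lfun2_integrable_sqr gi).
by apply: eq_integrable => // x _; rewrite /= cabs_sqr EFinD.
Qed.

Let J b v : R := (\int[P]_x tcos b (g x * monomial v x))%R.

Let J_shift b v : J b v = J (b + theta) (translate 1 v).
Proof.
have [iT e] := @integral_invariant R _ X P (@seq_shift R) _ P_shift (integrable_product b v).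
rewrite /J -[LHS]e; apply: (congr1 fine); apply: ae_eq_integral => //.
- by have [] := integrableP _ _ _ iT.
- by have [] := integrableP _ _ _ (integrable_product (b + theta) (translate 1 v)).
move: g_eigen; apply: filterS => x gx _; congr EFin.
rewrite gx -(monomial_iter 1) /= /tcos expiD.
by congr complex.Re; ring.
Qed.

Let J_iter n b v : J b v = J (b + n%:R * theta) (translate n v).
Proof.
elim: n => [|n IHn]; first by rewrite mul0r addr0 translate0.
by rewrite IHn J_shift translateD addn1 -addrA -natr1 mulrDl mul1r.
Qed.

(** Summing the translates with the powers of the eigenvalue turns the invariance
    of [J] into a single integral against [g]. *)
Let twisted b v N x : R[i] :=
  \sum_(n < N) monomial (translate n v) x * expi (b + n%:R * theta).

Let twisted_sqr b v N x : cabs (twisted b v N x) ^+ 2 =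
  \sum_(n < N) \sum_(m < N)
    tcos (n%:R * theta - m%:R * theta) (monomial (difference n m v) x).
Proof.
rewrite /twisted (cabs_sum_sqr N (fun n => monomial (translate n v) x * expi (b + n%:R * theta))).
apply: eq_bigr => n _; apply: eq_bigr => m _; rewrite /tcos /difference.
rewrite monomial_cat monomial_opposite.
have -> (z w : R[i]) : (z * w)^*%C = z^*%C * w^*%C by exact: rmorphM.
rewrite expiJ.
rewrite (_ : n%:R * theta - m%:R * theta = (b + n%:R * theta) + - (b + m%:R * theta)); last by ring.
by rewrite [in RHS]expiD; congr complex.Re; ring.
Qed.

Let twisted_integral b v N :
  P.-integrable setT (EFin \o (fun x => cabs (twisted b v N x) ^+ 2)) /\
  (\int[P]_x (cabs (twisted b v N x) ^+ 2) = \sum_(n < N) \sum_(m < N)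
    M (difference n m v) * cos (n%:R * theta - m%:R * theta))%R.
Proof.
have I n := @Rintegral_sum R P _ (index_enum 'I_N)
   (fun m x => tcos (n%:R * theta - m%:R * theta) (monomial (difference n m v) x))
   (fun m => integrable_tcos _ _).
have [i1 e1] := @Rintegral_sum R P _ (index_enum 'I_N) _ (fun n => (I n).1).
split.
  by apply: eq_integrable i1 => // x _; rewrite /= twisted_sqr.
under eq_Rintegral do rewrite twisted_sqr.
rewrite e1; apply: eq_bigr => n _; rewrite (I n).2.
by apply: eq_bigr => m _; rewrite P_moment.
Qed.

(** Off the diagonal the correlations have a common value, which multiplies a
    bounded sum; the diagonal contributes at most [2] per term. *)
Let correlation_bound : exists2 K : R, 0 <= K & forall v N,
  \sum_(n < N) \sum_(m < N) M (difference n m v) * cos (n%:R * theta - m%:R * theta)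
    <= K + 2 * N%:R.
Proof.
have [K HK] := geometric_sum_bounded theta1.
exists K => [|v N]; first exact: le_trans (normr_ge0 _) (HK 0%N).
pose kappa := M (difference 1 0 v).
have E (n m : nat) : M (difference n m v) * cos (n%:R * theta - m%:R * theta) =
    kappa * cos (n%:R * theta - m%:R * theta) + (M (difference n n v) - kappa) *+ (n == m).
  case: eqVneq => [<-|nm]; first by rewrite subrr cos0 mulr1n; ring.
  by rewrite M_difference// addr0.
under eq_bigr do under eq_bigr do rewrite E.
under eq_bigr do rewrite big_split/= -mulr_sumr.
rewrite big_split/= -mulr_sumr; apply: lerD.
  apply: le_trans (ler_norm _) _; rewrite normrM.
  by apply: le_trans (HK N); apply: ler_piMl => //; exact: M_norm.
rewrite (_ : 2 * N%:R = \sum_(n < N) 2); last by rewrite sumr_const card_ord mulr_natr.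
apply: ler_sum => n _; rewrite (bigD1 n)//= eqxx mulr1n big1 => [|m mn]; last first.
  by rewrite -val_eqE eq_sym in mn; rewrite (negbTE mn).
rewrite addr0; have := M_norm (difference n n v); have := M_norm (difference 1 0 v).
by rewrite -/kappa !ler_norml; lra.
Qed.

(** Averaging over [N] translates and using the inequality between the arithmetic
    and geometric means with parameter [delta] of order [N * eps] leaves [eps] times
    the squared norm of [g], plus a term that tends to [0] with [1 / N]. *)
Let J_le0 b v : J b v <= 0.
Proof.
have [K K0 HK] := correlation_bound.
pose G := (\int[P]_x (cabs (g x) ^+ 2))%R.
have G0 : 0 <= G by apply: Rintegral_ge0 => x _; exact: sqr_ge0.
have bound delta N : 0 < delta -> N%:R * J b v <= delta * G + delta^-1 * (K + 2 * N%:R).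
  move=> d0; have [it et] := twisted_integral b v N.
  have [is_ es] := @Rintegral_sum R P _ (index_enum 'I_N)
    (fun n x => tcos (b + n%:R * theta) (g x * monomial (translate n v) x))
    (fun n => integrable_product _ _).
  have tw x : \sum_(n < N) tcos (b + n%:R * theta) (g x * monomial (translate n v) x) =
      complex.Re (g x * twisted b v N x).
    rewrite /twisted mulr_sumr raddf_sum.
    by apply: eq_bigr => n _; rewrite /tcos mulrA.
  have -> : N%:R * J b v = (\int[P]_x complex.Re (g x * twisted b v N x))%R.
    rewrite mulr_natl -[N in LHS]card_ord -sumr_const.
    under eq_bigr => n _ do rewrite (J_iter n).
    by rewrite -es; apply: eq_Rintegral => x _; rewrite tw.
  have i1 : P.-integrable setT (EFin \o (fun x => delta * cabs (g x) ^+ 2)).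
    have := integrableZl measurableT delta integrable_sqr.
    by apply: eq_integrable => // x _; rewrite /= EFinM.
  have i2 : P.-integrable setT (EFin \o (fun x => delta^-1 * cabs (twisted b v N x) ^+ 2)).
    have := integrableZl measurableT delta^-1 it.
    by apply: eq_integrable => // x _; rewrite /= EFinM.
  apply: (@le_trans _ _ (\int[P]_x (delta * cabs (g x) ^+ 2 +
      delta^-1 * cabs (twisted b v N x) ^+ 2))%R).
    apply: le_Rintegral => //; last by move=> x _; exact: weak_AM_GM.
    - by apply: eq_integrable is_ => // x _; rewrite /= tw.
    - have := integrableD measurableT i1 i2.
      by apply: eq_integrable => // x _; rewrite /= EFinD.
  rewrite RintegralD// !RintegralZl//; apply: lerD => //.
  by rewrite ler_pM2l ?invr_gt0// et.
rewrite leNgt; apply/negP => j0; set j := J b v in j0.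
pose eps := j / (2 * (G + 1)).
have G1 : 0 < G + 1 by rewrite ltr_wpDl.
have eps0 : 0 < eps by rewrite divr_gt0// mulr_gt0.
have eG : eps * (G + 1) = j / 2 by rewrite /eps; field; lra.
pose N := (Num.truncn ((K + 2) / eps ^+ 2)).+1.
have hN : (K + 2) / eps < N%:R * eps.
  rewrite -ltr_pdivrMr// -mulrA -invfM -expr2; exact: truncnS_gt.
have N0 : 0 < N%:R :> R by rewrite ltr0n.
have N1 : 1 <= N%:R :> R by rewrite ler1n.
have := bound (N%:R * eps) N (mulr_gt0 N0 eps0); rewrite -/j.
have : (N%:R * eps)^-1 * (K + 2 * N%:R) <= (K + 2) / eps.
  rewrite mulrC ler_pdivrMr ?(mulr_gt0 N0 eps0)// [X in _ <= _ * X]mulrC mulrA divfK ?gt_eqF//.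
  by rewrite [leRHS]mulrDl lerD2r ler_peMr.
have : N%:R * eps * G + N%:R * eps = N%:R * j / 2.
  by rewrite -mulrA -[in RHS]mulrA -eG; ring.
have : 0 < N%:R * j by rewrite mulr_gt0.
move: hN; set u := (K + 2) / eps; set w := _^-1 * _; set z := N%:R * eps * G.
move: (N%:R * eps) (N%:R * j) => p q; lra.
Qed.

Let J_eq0 b v : J b v = 0.
Proof.
apply/eqP; rewrite eq_le J_le0/= -oppr_le0; apply: le_trans (J_le0 (b + pi) v).
rewrite /J -mulN1r -(RintegralZl _ measurableT (integrable_product b v)).
rewrite le_eqVlt; apply/orP; left; apply/eqP; apply: eq_Rintegral => x _.
by rewrite /tcos /expi cosDpi sinDpi; case: (g x * _) => ? ? /=; ring.
Qed.

Let tcosN_conj b (w : R[i]) : tcos (- b) w^*%C = tcos b w.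
Proof. by rewrite /tcos /expi cosN sinN; case: w => ? ? /=; ring. Qed.

Let tcosNDpihalf_conj b (w : R[i]) :
  tcos (- b + pi / 2) w^*%C = - tcos (b + pi / 2) w.
Proof.
rewrite /tcos /expi !cosDpihalf !sinDpihalf cosN sinN.
by case: w => ? ? /=; ring.
Qed.

Let components_eq0 b v :
  (\int[P]_x (complex.Re (g x) * tcos b (monomial v x)))%R = 0 /\
  (\int[P]_x (complex.Im (g x) * tcos (b + pi / 2) (monomial v x)))%R = 0.
Proof.
have i1 u w := integrable_mul_bounded integrable_Re (@bounded_measurable_tcos R u w).
have i2 u w := integrable_mul_bounded integrable_Im (@bounded_measurable_tcos R u w).
have := J_eq0 b v; have := J_eq0 (- b) (opposite v); rewrite /J.
under eq_Rintegral do rewrite tcos_mul monomial_opposite tcosN_conj tcosNDpihalf_conj mulrN.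
rewrite RintegralB// => e1.
under eq_Rintegral do rewrite tcos_mul.
rewrite RintegralD// => e2; move: e1 e2; lra.
Qed.

(** The eigenfunction is orthogonal to all monomials; separating real and
    imaginary parts with the help of the conjugate monomials, both components
    vanish almost everywhere. *)
Lemma eigenfunction_eq0 : {ae P, forall x, g x = 0}.
Proof.
have Re0 z : complex.Re z = tcos 0 z by rewrite /tcos expi0 mulr1.
have Im0 z : complex.Im z = tcos (- (pi / 2)) z.
  by rewrite /tcos /expi cosN cos_pihalf sinN sin_pihalf; case: z => ? ? /=; ring.
have hr : {ae P, forall x, complex.Re (g x) = 0}.
  apply: ae_eq0_of_moments => // v; split.
    by under eq_Rintegral do rewrite [X in _ * X]Re0; exact: (components_eq0 0 v).1.
  by under eq_Rintegral do rewrite [X in _ * X]Im0; exact: (components_eq0 _ v).1.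
have hi : {ae P, forall x, complex.Im (g x) = 0}.
  apply: ae_eq0_of_moments => // v; split.
    under eq_Rintegral do rewrite [X in _ * X]Re0 -(addrNK (pi / 2) 0).
    exact: (components_eq0 _ v).2.
  under eq_Rintegral do rewrite [X in _ * X]Im0 -(addrNK (pi / 2) (- (pi / 2))).
  exact: (components_eq0 _ v).2.
apply: filterS2 hr hi => x; by case: (g x) => a b /= -> ->.
Qed.

End eigenfunctions.

(** * Spectrum and strong stationarity *)

Section spectrum_and_stationarity.
Context {R : realType}.
Local Notation X := (seqspace R).
Variables (c : R) (hc : 0 < c).

Lemma spectrum_mu_c : spectrum (mu_c hc) (@seq_shift R) = [set 0].
Proof.
apply/seteqP; split => [a [/andP[a0 a1] [g [g2 gn0 ge]]]|_ ->] /=.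
  apply/eqP; apply: contrapT => /negP aN0; apply: gn0.
  apply: (eigenfunction_eq0 (mu_c_shift hc) (integral_mu_c hc)
    (@total_mass_difference R c) _ g2 ge).
  apply/eqP => /expi_2pi_eq1/intrP[k ak]; move/eqP: aN0; apply.
  move: a0 a1; rewrite ak ler0z ltrz1 => k0 k1.
  by have -> : k = 0 by lia.
split; first by rewrite lexx ltr01.
exists (fun=> 1); split.
- by split; apply: (@Lfun_cst _ X R (mu_c hc)).
- move=> [N [mN N0 sub]].
  have : mu_c hc setT = 0%E.
    apply: (@subset_measure0 _ _ _ (mu_c hc) _ N) => // x _; apply: sub => /=.
    by move/eqP; rewrite oner_eq0.
  by rewrite probability_setT => /eqP; rewrite eqe oner_eq0.
- by apply: aeW => x; rewrite mulr0 expi0 mul1r.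
Qed.

Definition dilate (r : int) (v : config) : config := [seq (r * p.1, p.2) | p <- v].

Lemma moment_dilate r v i : moment (dilate r v) i = r ^+ i * moment v i.
Proof.
rewrite /moment big_map mulr_sumr; apply: eq_bigr => p _ /=.
by rewrite exprMn mulrCA.
Qed.

Lemma total_mass_dilate r v : r != 0 -> total_mass c (dilate r v) = total_mass c v.
Proof.
move=> r0; apply: total_mass_ext => d; split => H i id.
  have := H i id; rewrite moment_dilate => /eqP; rewrite mulf_eq0 expf_eq0.
  by rewrite (negbTE r0) andbF => /eqP.
by rewrite moment_dilate H// mulr0.
Qed.

Lemma Cintegral_monomial v :
  Cintegral (mu_c hc) (monomial v) = (total_mass c v)%:C.
Proof. by rewrite /Cintegral integral_mu_c_Re integral_mu_c_Im. Qed.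

Lemma strongly_stationary_mu_c : strongly_stationary (mu_c hc).
Proof.
move=> l r n F _ r0 HF.
have /choice[b Hb] : forall j, exists b : bool,
    F j = fun x => if b then (F0 x)^*%C else F0 x.
  by move=> j; have [->|->] := HF j; [exists false|exists true].
pose v : config := [seq (n j, b j) | j <- index_enum 'I_l].
have E (k : int) (x : X) : \prod_(j < l) F j (shiftz (k * n j) x) = monomial (dilate k v) x.
  rewrite /monomial /dilate !big_map; apply: eq_bigr => j _.
  by rewrite Hb /coord_factor /= /F0 /seq_coord /shiftz add0r.
rewrite (_ : (fun x => _) = monomial (dilate 1 v)); last first.
  by apply/funext => x; rewrite -E; apply: eq_bigr => j _; rewrite mul1r.
rewrite [in RHS](_ : (fun x => _) = monomial (dilate r v)); last first.
  by apply/funext => x; rewrite -E.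
by rewrite !Cintegral_monomial !total_mass_dilate// eqz_nat -lt0n.
Qed.

End spectrum_and_stationarity.

(** * Shadowing by archimedean characters *)

Section shadowing.
Context {R : realType}.
Local Notation X := (seqspace R).
Implicit Types (h : nat -> R) (v : config).

Lemma sum_subrange_le h A A' B' B : (forall n, 0 <= h n) -> (A <= A')%N ->
  (B' <= B)%N -> \sum_(A' <= n < B') h n <= \sum_(A <= n < B) h n.
Proof.
move=> h0 AA BB; have s0 a b : 0 <= \sum_(a <= n < b) h n by apply: sumr_ge0.
have [BA|AB] := leqP B' A'; first by rewrite big_geq.
rewrite (big_cat_nat AA (leq_trans (ltnW AB) BB))/= (big_cat_nat (ltnW AB) BB)/=.
by rewrite addrCA lerDl addr_ge0.
Qed.

Lemma sum_shift_le h (k : int) (r M : nat) : (forall n, 0 <= h n <= 2) ->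
  (`|k| <= r)%N ->
  \sum_(r.+1 <= n < M.+1) h (absz (n%:Z + k)) <=
  \sum_(1 <= n < M.+1) h n + 2 * `|k|%N%:R.
Proof.
move=> h2 kr; have h0 n : 0 <= h n by have /andP[] := h2 n.
case: k kr => q /= qr.
  have -> : \sum_(r.+1 <= n < M.+1) h (absz (n%:Z + q%:Z)) =
      \sum_(r.+1 + q <= n < M.+1 + q) h n.
    by rewrite big_addn addnK; apply: eq_bigr => n _; rewrite -PoszD.
  apply: le_trans (@sum_subrange_le h 1 _ _ (M.+1 + q) h0 _ (leqnn _)) _ => //.
  rewrite (@big_cat_nat _ _ _ M.+1 1 (M.+1 + q))//=; last exact: leq_addr.
  rewrite lerD2l (le_trans (_ : _ <= \sum_(M.+1 <= n < M.+1 + q) 2))//.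
    by apply: ler_sum => n _; have /andP[] := h2 n.
  by rewrite sumr_const_nat addKn mulr_natr.
have -> : \sum_(r.+1 <= n < M.+1) h (absz (n%:Z + Negz q)) =
    \sum_(r.+1 - q.+1 <= n < M.+1 - q.+1) h n.
  rewrite -[r.+1 in LHS](@subnK q.+1)//; last exact: ltnW.
  rewrite big_addn; apply: eq_bigr => n _; congr h; lia.
rewrite (le_trans (@sum_subrange_le h 1 _ _ M.+1 h0 _ _))// ?lerDl//; lia.
Qed.

Lemma cabs_prod_sub (I : Type) (s : seq I) (F G : I -> R[i]) :
  (forall i, cabs (F i) <= 1) -> (forall i, cabs (G i) <= 1) ->
  cabs (\prod_(i <- s) F i - \prod_(i <- s) G i) <= \sum_(i <- s) cabs (F i - G i).
Proof.
move=> F1 G1; elim: s => [|i s IHs]; first by rewrite !big_nil subrr cabs0.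
have P1 : cabs (\prod_(j <- s) F j) <= 1.
  elim: s {IHs} => [|j s IHs]; first by rewrite big_nil /cabs normr1.
  by rewrite big_cons cabsM mulr_ile1 ?cabs_ge0.
rewrite !big_cons; set p := \prod_(j <- s) F j in IHs P1 *.
set q := \prod_(j <- s) G j in IHs *.
have -> : F i * p - G i * q = (F i - G i) * p + G i * (p - q) by ring.
apply: le_trans (cabsD _ _) _; rewrite !cabsM; apply: lerD.
  by rewrite ler_piMr ?cabs_ge0.
by apply: le_trans IHs; rewrite ler_piMl ?cabs_ge0.
Qed.

(** For [n] above the reach all the integers [n + k] are positive, where the
    power [n ^ (i s)] is meaningful. *)
Lemma expi_logsum (v : config) (s : int) (n : nat) : (reach v < n)%N ->
  expi (s%:~R * logsum R v n) = \prod_(p <- v)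
    (if p.2 then (npowi R (absz (n%:Z + p.1)) s)^* else npowi R (absz (n%:Z + p.1)) s).
Proof.
move=> vn; rewrite /logsum mulr_sumr.
have H : forall p, p \in v -> (0 < absz (n%:Z + p.1)%R)%N /\ 0 <= n%:Z + p.1.
  move=> p /reachP; lia.
elim: v {vn} H => [|p v IHv] H; first by rewrite !big_nil expi0.
rewrite !big_cons expiD IHv; last by move=> q qv; apply: H; rewrite inE qv orbT.
have [_ h] := H p (mem_head _ _).
congr (_ * _); rewrite /npowi.
have <- : (n%:Z + p.1)%:~R = (absz (n%:Z + p.1))%:R :> R.
  by rewrite natr_absz ger0_norm.
case: p.2; rewrite ?expr1 ?expr0 ?mul1r// mulN1r mulrN.
by rewrite [RHS]expiJ.
Qed.

End shadowing.

Section shadowing_average.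
Context {R : realType}.
Local Notation X := (seqspace R).

(** Replacing the factors of the monomial one at a time costs the distance of [f]
    and [n ^ (i s)] at the shifted integers [n + k]. Shifting back multiplies the
    weights [1 / n] by at most [1 + |k|] and adds finitely many terms. *)
Lemma monomial_shadow (v : config) : exists2 C : R, 0 <= C &
  forall (f : nat -> R[i]) (x : X) (s : int) (M : nat),
    (forall n, (0 < n)%N -> `|f n| = 1) -> extends_to_Z f x ->
    \sum_(1 <= n < M.+1)
      cabs (monomial v (iter n (@seq_shift R) x) - expi (s%:~R * logsum R v n)) / n%:R
    <= C * (1 + \sum_(1 <= n < M.+1) cabs (f n - npowi R n s) / n%:R).
Proof.
pose w (p : int * bool) : R := (1 + (absz p.1)%:R) * (1 + 2 * (absz p.1)%:R).
have w0 p : 0 <= w p by rewrite mulr_ge0// addr_ge0// mulr_ge0.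
exists (2 * (reach v)%:R + \sum_(p <- v) w p).
  by rewrite addr_ge0 ?mulr_ge0 ?sumr_ge0.
move=> f x s M f1 fx; set A := \sum_(1 <= n < M.+1) cabs (f n - npowi R n s) / n%:R.
pose h n : R := cabs (f n - npowi R n s) / n%:R.
have h2 n : 0 <= h n <= 2.
  rewrite /h; case: n => [|n]; first by rewrite invr0 mulr0 lexx ler0n.
  rewrite divr_ge0 ?cabs_ge0//= ler_pdivrMr ?ltr0n//.
  apply: le_trans (cabsD _ _) _; rewrite /cabs normrN f1// [X in _ + X](_ : _ = 1).
    by rewrite -[leLHS]/(2 : R) ler_peMr// ler1n.
  by rewrite -/(cabs _) cabs_expi.
have h0 n : 0 <= h n by have /andP[] := h2 n.
have A0 : 0 <= A by apply: sumr_ge0 => n _; exact: h0.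
set m := fun n => monomial v (iter n (@seq_shift R) x).
set e := fun n => expi (s%:~R * logsum R v n) : R[i].
pose t n : R := cabs (m n - e n) / n%:R.
have t0 n : 0 <= t n by rewrite divr_ge0 ?cabs_ge0.
have t2 n : (0 < n)%N -> t n <= 2.
  move=> n0; rewrite ler_pdivrMr ?ltr0n//.
  apply: le_trans (cabsD _ _) _.
  have -> : cabs (- e n) = 1 by rewrite /cabs normrN -/(cabs _) cabs_expi.
  apply: (@le_trans _ _ 2); last by rewrite ler_peMr// ler1n.
  by rewrite -[leRHS]/(1 + 1) lerD2r monomial_cabs.
have tail n : (reach v < n)%N ->
    t n <= \sum_(p <- v) (1 + (absz p.1)%:R) * h (absz (n%:Z + p.1)).
  move=> rn; have n0 : 0 < n%:R :> R by rewrite ltr0n (leq_ltn_trans _ rn).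
  pose F (p : int * bool) := coord_factor (iter n (@seq_shift R) x) p.
  pose G (p : int * bool) : R[i] :=
    if p.2 then (npowi R (absz (n%:Z + p.1)) s)^*%C else npowi R (absz (n%:Z + p.1)) s.
  have F1 p : cabs (F p) <= 1.
    by rewrite /F /coord_factor; case: p.2; rewrite ?cabsJ seq_coord_cabs.
  have G1 p : cabs (G p) <= 1 by rewrite /G; case: p.2; rewrite ?cabsJ cabs_expi.
  rewrite /t /m /e expi_logsum// ler_pdivrMr//.
  apply: le_trans (cabs_prod_sub v F1 G1) _.
  rewrite mulr_suml big_seq [leRHS]big_seq; apply: ler_sum => -[k b] pv.
  have kr := reachP pv; rewrite /= in kr.
  have j0 : (0 < absz (n%:Z + k)%R)%N by lia.
  have jR : 0 < (absz (n%:Z + k))%:R :> R by rewrite ltr0n.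
  have -> : cabs (F (k, b) - G (k, b)) = cabs (f (absz (n%:Z + k)) - npowi R (absz (n%:Z + k)) s).
    have -> : F (k, b) = if b then (f (absz (n%:Z + k)))^*%C else f (absz (n%:Z + k)).
      rewrite /F /coord_factor /= -shiftz_iter.
      have -> : seq_coord (shiftz n x) k = seq_coord x (absz (n%:Z + k))%:Z.
        by rewrite /seq_coord /shiftz; congr (set_val (x _)); lia.
      by rewrite fx.
    rewrite /G /=; case: b {pv} => //.
    by rewrite -(cabsJ (f _ - _)); congr cabs; rewrite rmorphB.
  rewrite /h /=; set a := cabs _; set q := (absz (n%:Z + k))%:R.
  have -> : (1 + (absz k)%:R) * (a / q) * n%:R = a * ((1 + (absz k)%:R) * n%:R / q) by ring.
  rewrite ler_peMr ?cabs_ge0// ler_pdivlMr// mul1r nat1r -natrM ler_nat; nia.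
apply: (@le_trans _ _ (\sum_(1 <= n < (reach v).+1) t n +
                       \sum_((reach v).+1 <= n < M.+1) t n)).
  have [Mr|rM] := leqP M (reach v).
    rewrite [X in _ <= _ + X]big_geq// addr0.
    by rewrite (@sum_subrange_le _ t 1 1 M.+1).
  by rewrite (@big_cat_nat _ _ _ (reach v).+1)//= ltnS ltnW.
rewrite mulrDl; apply: lerD.
  apply: (@le_trans _ _ (\sum_(1 <= n < (reach v).+1) 2)).
    by rewrite big_nat [leRHS]big_nat; apply: ler_sum => n /andP[n0 _]; exact: t2.
  rewrite sumr_const_nat subn1 /= -[leLHS]mulr_natr ler_peMr ?mulr_ge0//.
  by rewrite lerDl.
apply: (@le_trans _ _ (\sum_((reach v).+1 <= n < M.+1)
   \sum_(p <- v) (1 + (absz p.1)%:R) * h (absz (n%:Z + p.1)))).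
  by rewrite big_nat [leRHS]big_nat; apply: ler_sum => n /andP[n0 _]; exact: tail.
rewrite exchange_big mulr_suml /= big_seq [leRHS]big_seq; apply: ler_sum => p pv.
rewrite -mulr_sumr /w -mulrA; apply: ler_wpM2l; first by rewrite addr_ge0.
apply: le_trans (sum_shift_le M h2 (reachP pv)) _; rewrite -/A.
have k0 : 0 <= (absz p.1)%:R :> R by [].
move: k0 A0; set k := (absz p.1)%:R; move: A => B; nra.
Qed.

End shadowing_average.

(** * Equidistribution of the orbit *)

Section equidistribution.
Context {R : realType}.
Local Notation X := (seqspace R).
Variables (f : nat -> R[i]) (t s : nat -> int) (hf : is_MRT f t s).
Lemma MRT_t_ge m : m.+1%:Z <= t m.
Proof.
elim: m => [|m IHm]; first by rewrite (MRT_t0 hf).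
have := MRT_t_increasing hf (ltnSn m); lia.
Qed.

Lemma MRT_s_ge m : m%:R <= (s m.+1)%:~R :> R.
Proof.
have [h _ _] := MRT_growth hf m; have h2 := MRT_t_ge m.
rewrite -[m%:R]/(m%:Z%:~R) ler_int; lia.
Qed.

Lemma MRT_log_average_close m (M : nat) : M%:R <= (t m.+1)%:~R :> R ->
  \sum_(1 <= n < M.+1) cabs (f n - npowi R n (s m.+1)) / n%:R <=
  2 / m.+1%:R * hsum 1 M.+1.
Proof.
move=> MP; have tm := MRT_t_ge m; have tm1 := MRT_t_ge m.+1.
have [T tT] : exists T : nat, t m = T%:Z by exists (absz (t m)); lia.
have [P tP] : exists P : nat, t m.+1 = P%:Z by exists (absz (t m.+1)); lia.
have mT : (m < T)%N by lia.
apply: (@le_trans _ _ (2 / T%:R * hsum 1 M.+1)); last first.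
  apply: ler_wpM2r; first exact: hsum_ge0.
  apply: ler_wpM2l => //; rewrite lef_pV2 ?posrE ?ltr0n ?(leq_trans _ mT)//.
  by rewrite ler_nat.
apply: (@log_average_close R f _ T P M) => //.
- exact: MRT_unimodular hf.
- by move=> n _; exact: norm_expi.
- exact: MRT_mult hf.
- by move=> a b a0 b0; exact: npowiM.
- by rewrite (leq_trans _ mT).
- by move=> p pp /andP[Tp pP]; apply: (MRT_block hf) => //; lia.
- move=> p pp pT; have pm : p%:Z <= t m by lia.
  have := MRT_approx hf pp pm; rewrite tT cabsE.
  have -> : 1 / (T%:Z)%:~R ^+ 2 = ((T ^ 2)%:R^-1 : R)%:C :> R[i].
    by rewrite div1r fmorphV rmorph_nat natrX.
  by rewrite lecR.
- by move: MP; rewrite tP -[P%:Z%:~R]/(P%:R) ler_nat.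
Qed.

Variables (c : R) (hc : 0 < c).
Hypothesis fast : \forall m \near \oo, ((s m.+1)%:~R : R) `^ c^-1 <= (t m.+1)%:~R.
Variables (x : X) (fx : extends_to_Z f x).

Let N (m : nat) : R := ((s m.+1)%:~R : R) `^ c^-1.

(** The average of the monomial along [f] differs little from its average along
    [n ^ (i s)], for which the limit is known; the error terms are compared with the
    harmonic sum, which tends to infinity. *)
Lemma Elog_monomial_cvg b v :
  Elog (N m) (fun n => tcos b (monomial v (iter n (@seq_shift R) x))) @[m --> \oo]
  --> total_mass c v * cos b.
Proof.
have [C C0 HC] := monomial_shadow (R := R) v.
apply/cvgrPdist_le => e e0; pose d := e / 3; have d0 : 0 < d by rewrite divr_gt0.
have [S0 HS0] := osc_limit v hc d0.
have [S1 HS1] := cutoff_large (C / d + 1) hc.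
near=> m.
have mS0 : S0 <= (s m.+1)%:~R.
  apply: le_trans (MRT_s_ge m); near: m; exact: nbhs_infty_ger.
have mS1 : S1 <= (s m.+1)%:~R.
  apply: le_trans (MRT_s_ge m); near: m; exact: nbhs_infty_ger.
have mC : C * 2 / d <= m.+1%:R.
  apply: (@le_trans _ _ m%:R); last by rewrite ler_nat.
  near: m; exact: nbhs_infty_ger.
have mt : N m <= (t m.+1)%:~R by near: m; exact: fast.
have [s1 [hC _]] := HS1 _ mS1.
have osc_m := HS0 _ mS0 b.
pose M := Num.truncn (N m).
have MN : M%:R <= N m by rewrite Num.Theory.truncn_le powR_ge0.
have HM := MRT_log_average_close (le_trans MN mt).
have sh := HC f x (s m.+1) M (MRT_unimodular hf) fx.
rewrite /cutoff -/(N m) -/M in osc_m hC.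
rewrite /Elog -/M -/(hsum 1 M.+1).
set H := hsum 1 M.+1 in osc_m hC HM *.
set D := \sum_(1 <= n < M.+1) _.
have close : `|D - osc v (s m.+1)%:~R b 1 M.+1| <= C * (1 + 2 / m.+1%:R * H).
  apply: (@le_trans _ _ (C * (1 + \sum_(1 <= n < M.+1) cabs (f n - npowi R n (s m.+1)) / n%:R))).
    apply: le_trans sh; rewrite /D /osc -sumrB.
    apply: le_trans (ler_norm_sum _ _ _) _; apply: ler_sum => n _.
    rewrite -mulrBl normrM [X in _ * X]ger0_norm ?invr_ge0//.
    apply: ler_wpM2r; first by rewrite invr_ge0.
    rewrite -tcos_expi /tcos -raddfB/= -mulrBl.
    by apply: le_trans (Re_le_cabs _) _; rewrite cabsM cabs_expi mulr1.
  by apply: ler_wpM2l => //; rewrite lerD2l.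
have H0 : 0 < H.
  by apply: lt_le_trans hC; rewrite ltr_wpDl ?ltr01// divr_ge0// ltW.
have C1 : C <= d * H.
  by rewrite mulrC -ler_pdivrMr//; apply: le_trans hC; rewrite lerDl.
have C2 : C * (2 / m.+1%:R * H) <= d * H.
  rewrite !mulrA; apply: ler_wpM2r; first exact: ltW.
  by rewrite ler_pdivrMr ?ltr0n// [leRHS]mulrC -ler_pdivrMr.
rewrite -(ler_pM2r H0) -[X in `|_| * X](ger0_norm (ltW H0)) -normrM.
have -> : (total_mass c v * cos b - H^-1 * D) * H = total_mass c v * cos b * H - D.
  by field; rewrite gt_eqF.
have -> : e * H = d * H + d * H + d * H by rewrite /d; field.
rewrite distrC -(subrK (osc v (s m.+1)%:~R b 1 M.+1) D) -addrA.
apply: le_trans (ler_normD _ _) _; apply: lerD => //.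
by apply: le_trans close _; rewrite mulrDr mulr1 lerD.
Unshelve. all: by end_near. Qed.

End equidistribution.

Section test_functions.
Context {R : realType}.
Local Notation X := (seqspace R).
Implicit Types (a b : nat -> R) (M : R).

Lemma ElogD M a b : Elog M (fun n => a n + b n) = Elog M a + Elog M b.
Proof.
rewrite /Elog -mulrDr -big_split; congr (_ * _).
by apply: eq_bigr => n _; rewrite mulrDl.
Qed.

Lemma ElogZ M (r : R) a : Elog M (fun n => r * a n) = r * Elog M a.
Proof.
rewrite /Elog [RHS]mulrCA [X in _ = _ * X]mulr_sumr; congr (_ * _).
by apply: eq_bigr => n _; rewrite mulrA.
Qed.

Lemma Elog_close M a b (eps : R) : 0 <= eps -> (forall n, `|a n - b n| <= eps) ->
  `|Elog M a - Elog M b| <= eps.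
Proof.
move=> e0 ab; rewrite /Elog -mulrBr normrM -sumrB.
set H := \sum_(1 <= n < _) n%:R^-1; have H0 : 0 <= H.
  by apply: sumr_ge0 => n _; rewrite invr_ge0.
have [H00|HN0] := eqVneq H 0; first by rewrite H00 invr0 normr0 mul0r.
have {}H0 : 0 < H by rewrite lt_neqAle eq_sym HN0.
rewrite ger0_norm ?invr_ge0 ?(ltW H0)// mulrC ler_pdivrMr// /H mulr_sumr.
apply: le_trans (ler_norm_sum _ _ _) _; apply: ler_sum => n _.
by rewrite -mulrBl normrM [X in _ * X]ger0_norm ?invr_ge0// ler_wpM2r ?invr_ge0.
Qed.

Variables (P : probability X R) (N : nat -> R) (u : nat -> X).
Hypothesis monomials : forall (b : R) (v : config),
  Elog (N m) (fun n => tcos b (monomial v (u n))) @[m --> \oo] -->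
  (\int[P]_x tcos b (monomial v x))%R.

Let equidistributed (phi : X -> R) : Prop := bounded_measurable phi /\
  (Elog (N m) (fun n => phi (u n)) @[m --> \oo] --> (\int[P]_x phi x)%R).

Let equidistributedD phi psi : equidistributed phi -> equidistributed psi ->
  equidistributed (fun x => phi x + psi x).
Proof.
move=> [b1 c1] [b2 c2]; split; first exact: bounded_measurable_add.
under eq_fun do rewrite ElogD.
rewrite RintegralD//; [exact: cvgD|exact: bounded_measurable_integrable..].
Qed.

Let equidistributedZ r phi : equidistributed phi ->
  equidistributed (fun x => r * phi x).
Proof.
move=> [b1 c1]; split.
  by apply: bounded_measurable_mul => //; exact: bounded_measurable_cst.
under eq_fun do rewrite ElogZ.
rewrite RintegralZl//; last exact: bounded_measurable_integrable.
by apply: cvgM => //; exact: cvg_cst.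
Qed.

Let equidistributed_tcos (b : R) v : equidistributed (fun x => tcos b (monomial v x)).
Proof. by split; [exact: bounded_measurable_tcos|exact: monomials]. Qed.

Let equidistributed_tp (q : trig_poly (R := R)) :
  equidistributed (fun x => complex.Re (tp_eval q x)).
Proof.
elim: q => [|[z v] q IHq].
  rewrite (_ : (fun x => _) = fun x => 0 * tcos 0 (monomial [::] x)).
    exact: equidistributedZ.
  by apply/funext => x; rewrite mul0r /tp_eval big_nil.
rewrite (_ : (fun x => _) = fun x => (complex.Re z * tcos 0 (monomial v x) +
   complex.Im z * tcos (0 + pi / 2) (monomial v x)) + complex.Re (tp_eval q x)).
  by do 2?apply: equidistributedD => //; exact: equidistributedZ.
by apply/funext => x; rewrite -tcos_mul {1}/tp_eval big_cons raddfD /tcos expi0 mulr1.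
Qed.

(** The class of functions with the right limit is stable under linear
    combinations and uniform limits. *)
Lemma Elog_continuous_cvg (phi : X -> R) : continuous phi ->
  Elog (N m) (fun n => phi (u n)) @[m --> \oo] --> (\int[P]_x phi x)%R.
Proof.
move=> cphi; apply/cvgrPdist_le => e e0; pose d := e / 3.
have d0 : 0 < d by rewrite divr_gt0.
have [q Hq] := continuous_approximable cphi d0.
have [bq cq] := equidistributed_tp q.
have iq := bounded_measurable_integrable P bq.
have iphi := bounded_measurable_integrable P (bounded_measurable_continuous cphi).
have I : `|(\int[P]_x phi x)%R - (\int[P]_x complex.Re (tp_eval q x))%R| <= d.
  rewrite -RintegralB//.
  have ib : P.-integrable setT (EFin \o (fun x => phi x - complex.Re (tp_eval q x))).
    have := integrableB measurableT iphi iq.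
    by apply: eq_integrable => // x _; rewrite /= EFinB.
  apply: le_trans (le_normr_Rintegral measurableT ib) _.
  apply: (@le_trans _ _ (\int[P]_x d)%R).
    apply: le_Rintegral => //.
      have := integrable_abse ib; by apply: eq_integrable.
    by apply: bounded_measurable_integrable; exact: bounded_measurable_cst.
  by rewrite Rintegral_cst// [X in fine X](@probability_setT _ _ _ P) mulr1.
move/cvgrPdist_le: cq => /(_ _ d0) cq; near=> m.
have h : `|(\int[P]_x complex.Re (tp_eval q x))%R -
    Elog (N m) (fun n => complex.Re (tp_eval q (u n)))| <= d by near: m; exact: cq.
have close := @Elog_close (N m) (fun n => phi (u n))
  (fun n => complex.Re (tp_eval q (u n))) d (ltW d0) (fun n => Hq (u n)).
have -> : e = d + d + d by rewrite /d; field.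
move: I h close.
set I := (\int[_]_x phi x)%R; set J := (\int[_]_x _)%R; set A := Elog _ _; set B := Elog _ _.
by move=> IJ JB AB; move: IJ JB AB; rewrite !ler_norml; lra.
Unshelve. all: by end_near. Qed.

End test_functions.

(** * The Furstenberg systems of an MRT function *)

Theorem theorem2p20 (R : realType) (f : nat -> R[i]) (t s : nat -> int)
  (hf : is_MRT f t s) (c : R) (hc : 0 < c) :
  (2^-1 <= c ->
   \forall m \near \oo, ((s m.+1)%:~R : R) `^ c^-1 <= (t m.+1)%:~R) /\
  ((\forall m \near \oo, ((s m.+1)%:~R : R) `^ c^-1 <= (t m.+1)%:~R) ->
   exists mu_c : probability (seqspace R) R,
     [/\ forall x : seqspace R, extends_to_Z f x ->
           log_furstenberg x (fun m => ((s m.+1)%:~R : R) `^ c^-1) mu_c,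
         spectrum mu_c (@seq_shift R) = [set 0],
         strongly_stationary mu_c &
         isomorphic_systems mu_c (@seq_shift R) (nuZ hc) (@Rc R c)]).
Proof.
split => [c2|fast].
  apply: nearW => m; have [tm _ sm] := MRT_growth hf m.
  have s1 : 1 <= (s m.+1)%:~R :> R by have := MRT_t_ge hf m; rewrite ler1z; lia.
  apply: (@le_trans _ _ (((s m.+1)%:~R : R) `^ 2)).
    by rewrite ler_powR// -[leRHS]invrK lef_pV2 ?posrE ?invr_gt0.
  rewrite powR_mulrn ?(le_trans ler01)//.
  by rewrite -rmorphXn ler_int.
exists (mu_c hc); split.
- move=> x fx phi cphi; apply: Elog_continuous_cvg => // b v.
  by rewrite integral_mu_c; exact: (Elog_monomial_cvg hf hc fast fx).
- exact: spectrum_mu_c.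
- exact: strongly_stationary_mu_c.
- exact: furstenberg_isomorphic.
Qed.
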